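(* Let $A\in\mathbb Z^{d_A\times n_A}$, $B\in\mathbb Z^{d_A\times n_B}$, $C\in\mathbb Z^{d_C\times n_B}$, $D\in\mathbb Z^{d_C\times n_A}$ be fixed matrices. For given $N\in\mathbb Z_+$ let $\mathbf l\in(\mathbb Z\cup\{-\infty\})^{n_B+Nn_A}$, $\mathbf u\in(\mathbb Z\cup\{+\infty\})^{n_B+Nn_A}$, $\mathbf b\in\mathbb Z^{d_C+Nd_A}$, let $f\colon\mathbb R^{n_B+Nn_A}\to\mathbb R$ be a separable convex function that takes integer values on $\mathbb Z^{n_B+Nn_A}$, and let $\hat f$ denote an upper bound on the maximum of $|f|$ over the feasible region of the $N$-fold $4$-block decomposable convex integer minimization problem $$(\mathrm{IP})\colon\quad \min\left\{f(\mathbf z): \begin{pmatrix} C& D\\ B& A\end{pmatrix}^{(N)}\mathbf z=\mathbf b,\ \mathbf l\le \mathbf z\le \mathbf u,\ \mathbf z\in\mathbb Z^{n_B+Nn_A}\right\}.$$ Assume that the objective function $f$ is given by an evaluation oracle and by an approximate continuous convex optimization oracle for the continuous relaxation $(\mathrm{CP})$ of $(\mathrm{IP})$. Then there exists an algorithm that finds an optimal solution to $(\mathrm{IP})$ or decides that $(\mathrm{IP})$ is infeasible or unbounded, and that runs in time polynomial in $N$ and in the binary encoding lengths $\langle \mathbf l,\mathbf u,\mathbf b,\hat f\rangle$.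
   Context: A function $f\colon\mathbb R^n\to\mathbb R$ is separable convex if $f(x_1,\dots,x_n)=\sum_{i=1}^n f_i(x_i)$ with each $f_i\colon\mathbb R\to\mathbb R$ convex. The $N$-fold $4$-block matrix is $$\begin{pmatrix} C& D\\ B& A\end{pmatrix}^{(N)} := \begin{pmatrix} C & D & D & \cdots & D\\ B & A & O & & O\\ B & O & A & & O\\ \vdots & & & \ddots & \\ B & O & O & & A\end{pmatrix},$$ with $N$ copies of each of $A$, $B$, $D$, and $O$ denoting zero matrices; it has $d_C+Nd_A$ rows and $n_B+Nn_A$ columns. The continuous relaxation is $$(\mathrm{CP})\colon\quad \min\left\{f(\mathbf r): \begin{pmatrix} C& D\\ B& A\end{pmatrix}^{(N)}\mathbf r=\mathbf b,\ \mathbf l\le \mathbf r\le \mathbf u,\ \mathbf r\in\mathbb R^{n_B+Nn_A}\right\}.$$ An evaluation oracle returns $f(\mathbf z)$ when queried on $\mathbf z$. An approximate continuous convex optimization oracle for $(\mathrm{CP})$ solves the following problem: given the data $A,B,C,D,N,\mathbf l,\mathbf u,\mathbf b$ and a number $\epsilon\in\mathbb Q_{>0}$, find a feasible solution $\mathbf r_\epsilon\in\mathbb Q^{n_B+Nn_A}$ of $(\mathrm{CP})$ such that there exists an optimal solution $\hat{\mathbf r}$ of $(\mathrm{CP})$ with $\|\hat{\mathbf r}-\mathbf r_\epsilon\|_\infty\le\epsilon$, or report Infeasible or Unbounded. $\langle\cdot\rangle$ denotes binary encoding length. The block matrices $A,B,C,D$ (and hence $d_A,d_C,n_A,n_B$)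 are constants, not part of the input. *)

(* Defs.v *)
From HB Require Import structures.
From mathcomp Require Import all_boot all_order all_algebra.
From mathcomp Require Import all_classical all_reals all_analysis.

Set Implicit Arguments.
Unset Strict Implicit.
Unset Printing Implicit Defensive.

Import Order.TTheory GRing.Theory Num.Theory.
Import numFieldNormedType.Exports.

Local Open Scope ring_scope.

(* m + N k, in the shape in which MathComp types block matrices with N blocks
   of size k. *)
Notation nfold_dim m N k := (m + \sum_(i < N) k)%N (only parsing).

Definition nfold4 (dA dC nA nB : nat)
    (A : 'M[int]_(dA, nA)) (B : 'M[int]_(dA, nB))
    (C : 'M[int]_(dC, nB)) (D : 'M[int]_(dC, nA)) (N : nat) :
    'M[int]_(nfold_dim dC N dA, nfold_dim nB N nA) :=
  block_mx C                 (\mxrow_(j < N) D)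
           (\mxcol_(i < N) B) (\mxblock_(i < N, j < N) (if i == j then A else 0)).

(* [None] is an infinite bound: -oo in a vector of lower bounds, +oo in a
   vector of upper bounds. *)
Definition lower_bounded (T : numDomainType) (l : option int) (x : T) : Prop :=
  if l is Some a then a%:~R <= x else True.

Definition upper_bounded (T : numDomainType) (u : option int) (x : T) : Prop :=
  if u is Some a then x <= a%:~R else True.

(* The constraints M x = b, l <= x <= u for x in T^n; T = int gives the
   feasible region of (IP), T = R that of (CP). *)
Definition feasible (T : numDomainType) (m n : nat) (M : 'M[int]_(m, n))
    (b : 'cV[int]_m) (l u : 'cV[option int]_n) (x : 'cV[T]_n) : Prop :=
  map_mx intr M *m x = map_mx intr b /\
  forall i, lower_bounded (l i 0) (x i 0) /\ upper_bounded (u i 0) (x i 0).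

Section Minimization.
Context (R : realType) (X : Type) (S : X -> Prop) (f : X -> R).

Definition is_minimizer (x : X) : Prop := S x /\ forall y, S y -> f x <= f y.
Definition infeasible : Prop := forall x, ~ S x.
Definition unbounded : Prop := forall c : R, exists2 x, S x & f x < c.

End Minimization.

Definition separable_convex (R : realType) (n : nat) (f : 'cV[R]_n -> R) : Prop :=
  exists g : 'I_n -> R^o -> R^o,
    (forall i, convex_function [set: R^o] (g i)) /\
    (forall x, f x = \sum_(i < n) g i (x i 0)).

Inductive answer (T : Type) (n : nat) : Type :=
| Solution of 'cV[T]_n
| Infeasible
| Unbounded.
Arguments Infeasible {T n}.
Arguments Unbounded {T n}.

(* f restricted to integer points; the value is an integer by hypothesis. *)
Definition evaluation_oracle (R : realType) (n : nat) (f : 'cV[R]_n -> R)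
    (ev : 'cV[int]_n -> int) : Prop :=
  forall z, (ev z)%:~R = f (map_mx intr z).

(* The norm of a real column vector is the sup norm. *)
Definition approx_cont_oracle (R : realType) (n : nat) (f : 'cV[R]_n -> R)
    (S : 'cV[R]_n -> Prop) (cp : rat -> answer rat n) : Prop :=
  forall eps : rat, 0 < eps ->
  match cp eps with
  | Solution r =>
      S (map_mx ratr r) /\
      exists2 rhat, is_minimizer S f rhat & `|rhat - map_mx ratr r| <= ratr eps
  | Infeasible => infeasible S
  | Unbounded => unbounded S f
  end.

Definition correct_answer (R : realType) (n : nat) (f : 'cV[R]_n -> R)
    (S : 'cV[int]_n -> Prop) (a : answer int n) : Prop :=
  let fz (z : 'cV[int]_n) := f (map_mx intr z) in
  match a with
  | Solution z => is_minimizer S fz z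
  | Infeasible => infeasible S
  | Unbounded => unbounded S fz
  end.

(* Model of computation: programs of a WHILE language over binary trees with
   integer leaves, with logarithmic cost.  Every primitive is charged the bit
   length of its argument and of its result, and each result is at most about
   as long as its argument (up to a constant of the program), so this time is
   polynomially equivalent to that of multitape oracle Turing machines. *)

Inductive val : Type :=
| VInt of int
| VPair of val & val.

(* 1 + ceil(log2(|z| + 1)) *)
Definition int_size (z : int) : nat := (up_log 2 `|z|.+1).+1.

Fixpoint val_size (v : val) : nat :=
  match v with
  | VInt z => int_size z
  | VPair v w => (val_size v + val_size w).+1
  end.

Inductive prog : Type :=
| PId
| PConst of int
| PFst
| PSnd
| PIsInt
| PAdd
| PSub
| PMul
| PDiv
| PLe
| PPair of prog & prog
| PSeq of prog & prog
| PIf of prog & prog & prog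
| PWhile of prog & prog
| PEval
| PCont.

Definition vbool (c : bool) : val := VInt (c : nat).

Inductive prim : prog -> val -> val -> Prop :=
| prim_id v : prim PId v v
| prim_const z v : prim (PConst z) v (VInt z)
| prim_fst v w : prim PFst (VPair v w) v
| prim_snd v w : prim PSnd (VPair v w) w
| prim_isint v : prim PIsInt v (vbool (if v is VInt _ then true else false))
| prim_add x y : prim PAdd (VPair (VInt x) (VInt y)) (VInt (x + y))
| prim_sub x y : prim PSub (VPair (VInt x) (VInt y)) (VInt (x - y))
| prim_mul x y : prim PMul (VPair (VInt x) (VInt y)) (VInt (x * y))
| prim_div x y : prim PDiv (VPair (VInt x) (VInt y)) (VInt (x %/ y)%Z)
| prim_le x y : prim PLe (VPair (VInt x) (VInt y)) (vbool (x <= y)).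

(* [run ev cp P v w t]: on argument v the program P halts with result w after
   time t; [ev] and [cp] are the graphs of the two oracles.  Both writing a
   query and reading a reply are charged. *)
Inductive run (ev cp : val -> val -> Prop) : prog -> val -> val -> nat -> Prop :=
| run_prim P v w : prim P v w -> run ev cp P v w (val_size v + val_size w).+1
| run_eval v w : ev v w -> run ev cp PEval v w (val_size v + val_size w).+1
| run_cont v w : cp v w -> run ev cp PCont v w (val_size v + val_size w).+1
| run_pair P Q v w1 w2 t1 t2 :
    run ev cp P v w1 t1 -> run ev cp Q v w2 t2 ->
    run ev cp (PPair P Q) v (VPair w1 w2) (val_size v + t1 + t2).+1
| run_seq P Q v w x t1 t2 :
    run ev cp P v w t1 -> run ev cp Q w x t2 ->
    run ev cp (PSeq P Q) v x (t1 + t2).+1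
| run_if P Q1 Q2 v z w t1 t2 :
    run ev cp P v (VInt z) t1 ->
    run ev cp (if z != 0 then Q1 else Q2) v w t2 ->
    run ev cp (PIf P Q1 Q2) v w (val_size v + t1 + t2).+1
| run_while_stop P Q v t :
    run ev cp P v (VInt 0) t ->
    run ev cp (PWhile P Q) v v (val_size v + t).+1
| run_while_step P Q v z w x t1 t2 t3 :
    run ev cp P v (VInt z) t1 -> z != 0 ->
    run ev cp Q v w t2 -> run ev cp (PWhile P Q) w x t3 ->
    run ev cp (PWhile P Q) v x (val_size v + t1 + t2 + t3).+1.

(* Lists are right-nested pairs closed by the leaf 0. *)
Definition enc_col (T : Type) (e : T -> val) (n : nat) (x : 'cV[T]_n) : val :=
  foldr VPair (VInt 0) [seq e (x i 0) | i <- enum 'I_n].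

Definition enc_bound (o : option int) : val :=
  if o is Some z then VPair (VInt 0) (VInt z) else VInt 0.

Definition enc_rat (q : rat) : val := VPair (VInt (numq q)) (VInt (denq q)).

Definition enc_answer (T : Type) (e : T -> val) (n : nat) (a : answer T n) : val :=
  match a with
  | Solution x => VPair (VInt 0) (enc_col e x)
  | Infeasible => VInt 0
  | Unbounded => VInt 1
  end.

Definition enc_instance (m n : nat) (N : nat) (l u : 'cV[option int]_n)
    (b : 'cV[int]_m) : val :=
  VPair (VInt N%:Z)
    (VPair (enc_col enc_bound l) (VPair (enc_col enc_bound u) (enc_col VInt b))).

Definition eval_graph (n : nat) (ev : 'cV[int]_n -> int) (v w : val) : Prop :=
  exists z, v = enc_col VInt z /\ w = VInt (ev z).

Definition cont_graph (n : nat) (cp : rat -> answer rat n) (v w : val) : Prop :=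
  exists eps : rat, [/\ 0 < eps, v = enc_rat eps & w = enc_answer enc_rat (cp eps)].

(* N + <l, u, b, fhat> *)
Definition input_size (m n : nat) (N : nat) (l u : 'cV[option int]_n)
    (b : 'cV[int]_m) (fhat : int) : nat :=
  (N + val_size (enc_col enc_bound l) + val_size (enc_col enc_bound u)
     + val_size (enc_col VInt b) + int_size fhat)%N.

(* Nothing bounds the length of the vector r_eps that a continuous oracle may
   return, and the time for reading it is charged.  As usual for oracle
   algorithms, the bound may therefore also depend on the length of the replies,
   but only of the replies to queries of polynomial length: [L] bounds these.
   In particular, if the replies are polynomially long in s and in the query,
   then t is bounded by a polynomial in s alone. *)
Definition oracle_poly_bound (p q : {poly nat}) (n : nat)
    (cp : rat -> answer rat n) (s t : nat) : Prop :=
  forall L : nat,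
    (forall eps : rat, 0 < eps -> (val_size (enc_rat eps) <= q.[s])%N ->
       (val_size (enc_answer enc_rat (cp eps)) <= L)%N) ->
    (t <= p.[(s + L)%N])%N.

(* Main.v *)
Require Import Defs.
From HB Require Import structures.
From mathcomp Require Import all_boot all_order all_algebra.
From mathcomp Require Import all_classical all_reals all_analysis.
From mathcomp Require Import fingroup perm zify ring lra.
From Stdlib Require List.

Set Implicit Arguments.
Unset Strict Implicit.
Unset Printing Implicit Defensive.

Import Order.TTheory GRing.Theory Num.Theory.
Import numFieldNormedType.Exports.

Local Open Scope ring_scope.

(** A single query to the continuous oracle suffices. Let [c] be the reply at
precision 1, rounded down. If (IP) is feasible, some integer optimum lies
within a distance of [c] that is polynomial in [N], so it is enough to optimize
over the integer points of a cube of polynomial radius around [c]; there, a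
dynamic program over the [N] blocks has only polynomially many states.

Proximity ([proximity]). Let [z] be integer feasible, let [r] be a real optimum
and put [d = r - z], a kernel vector of the 4-block matrix. There is an integer
kernel vector [a] that lies coordinatewise between 0 and [d] and differs from
[d] by a polynomial in [N] ([kernel_rounding]). Both [z + a] and [r - a] are
feasible, and separable convexity gives
[f (z + a) + f (r - a) <= f z + f r] ([separable_exchange]), whence
[f (z + a) <= f z]. The rounding has two levels. Without the linking rows
[C D ... D], blocks with equal support are interchangeable, so the circuits of
the remaining rows are bounded by a constant independent of [N]
([two_stage_bound]). Decompose [d] conformally into multiples of such circuits.
The multipliers solve a system with only [dC] rows and entries of order [N]; by
Cramer's rule its circuits are polynomial in [N] ([kernel_int_small]), and
rounding down the multipliers of a second decomposition rounds the multipliers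
of the first ([rounding_coupled]). The same rounding bounds the relaxation from
below as soon as (IP) is feasible and its objective bounded
([relaxation_bounded]), so that both other replies of the oracle mean that (IP)
is infeasible.

Dynamic programming ([dpP]). A state consists of the shared block [x] and of
what is left of the linking right-hand side. After any number of blocks, the
reachable states lie in a product of boxes of polynomial size
([forward_states_bound]). The objective can be arbitrarily large at infeasible
points, where reading the answer of the evaluation oracle would take too long;
partial solutions therefore cannot be priced. Instead, a forward pass stores
one prefix for every reachable state, and a backward pass finds a best
completion of every state by comparing complete feasible points, all extending
the stored prefix. Since the objective is separable, the outcome does not
depend on that prefix.

Running time. Programs are built from a class of polynomial-time functions on
encoded data ([ptime]), closed under composition, branching, loops and folds.
All sizes are compared with one number attached to the instance: the size of
the input plus the length of the reply of the continuous oracle. *)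

(** * Small integer kernel vectors *)

Lemma det_bound n (A : 'M[int]_n) (D : nat) :
  (forall i j, `|A i j| <= D%:Z) -> `|\det A| <= (n`! * D ^ n)%N%:Z.
Proof.
move=> leA; apply: le_trans (ler_norm_sum _ _ _) _.
apply: (@le_trans _ _ (\sum_(s : 'S_n) (D ^ n)%N%:Z)).
  apply: ler_sum => s _; rewrite normrM normrX normrN1 expr1n mul1r normr_prod.
  apply: (@le_trans _ _ (\prod_(i < n) D%:Z)).
    by apply: ler_prod => i _; rewrite normr_ge0 leA.
  by rewrite prodr_const card_ord -!natz natrX.
by rewrite sumr_const card_Sn -mulr_natl natz PoszM.
Qed.

Lemma ler_int_sum_const (I : finType) (x : I -> int) (c : int) :
  (forall i, `|x i| <= c) -> `|\sum_i x i| <= #|I|%:Z * c.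
Proof.
move=> lex; apply: le_trans (ler_norm_sum _ _ _) _.
apply: (@le_trans _ _ (\sum_(i : I) c)); first exact: ler_sum.
by rewrite sumr_const -mulr_natl natz.
Qed.

Lemma adjmul_bound r (A : 'M[int]_r) (w : 'cV_r) (D : nat) i :
  (forall i j, `|A i j| <= D%:Z) -> (forall i, `|w i 0| <= D%:Z) ->
  `|(\adj A *m w) i 0| <= (r`! * D ^ r)%N%:Z.
Proof.
move=> leA lew; rewrite mxE.
case: r => [|r] in A w i leA lew *; first by case: i.
have -> : (r.+1`! * D ^ r.+1)%N%:Z
       = (#|'I_r.+1|%:Z) * ((r`! * D ^ r)%N%:Z * D%:Z).
  by rewrite card_ord factS expnS -!PoszM; congr Posz; lia.
apply: ler_int_sum_const => k; rewrite normrM ler_pM // mxE /cofactor.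
rewrite normrM normrX normrN1 expr1n mul1r.
by apply: det_bound => a c; rewrite !mxE.
Qed.

(** Cramer's rule. A maximal nonsingular minor on the support of [x] leaves a
further column [j0] of that support, because [x] is a dependency of these
columns; [y] expresses this column through the minor. Zeroing the columns
outside the support of [x] beforehand confines [y] to it. The bound does not
depend on the number of columns. *)
Lemma kernel_int_small (F : realFieldType) m n (W : 'M[int]_(m, n)) (D : nat)
    (x : 'cV[F]_n) :
  (0 < D)%N -> (forall i j, `|W i j| <= D%:Z) ->
  map_mx intr W *m x = 0 -> x != 0 ->
  exists y : 'cV[int]_n,
    [/\ y != 0, W *m y = 0, forall j, x j 0 = 0 -> y j 0 = 0
      & forall j, `|y j 0| <= (m`! * D ^ m)%N%:Z].
Proof.
move=> D0 leW Wx x0.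
pose A : 'M[int]_(m, n) := \matrix_(i, j) if x j 0 == 0 then 0 else W i j.
pose AF : 'M[F]_(m, n) := map_mx intr A.
have leA i j : `|A i j| <= D%:Z.
  by rewrite mxE; case: ifP => // _; rewrite normr0.
have AFx : AF *m x = 0.
  rewrite -[RHS]Wx; apply/matrixP => i k; rewrite !mxE; apply: eq_bigr => j _.
  by rewrite !mxE (ord1 k); case: eqP => [->|//]; rewrite !mulr0.
pose g := maxrankfun AF; pose A1 := rowsub g A.
have A1E : map_mx intr A1 = rowsub g AF by rewrite /A1 map_mxsub.
have full1 : row_full (map_mx intr A1 : 'M[F]__)^T.
  by rewrite /row_full mxrank_tr A1E; exact: maxrowsub_free.
pose h := fullrankfun full1; have hinj : injective h := @fullrankfun_inj _ _ _ _ full1.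
pose A2 := colsub h A1.
have A2unit : (map_mx intr A2 : 'M[F]__) \in unitmx.
  rewrite -unitmx_tr; suff -> : (map_mx intr A2)^T = rowsub h (map_mx intr A1 : 'M[F]__)^T.
    exact: fullrowsub_unit.
  by apply/matrixP => i k; rewrite !mxE.
have det0 : \det A2 != 0.
  move: A2unit; rewrite unitmxE unitfE det_map_mx; apply: contraNneq => ->.
  by rewrite rmorph0.
pose P (T : comNzRingType) : 'M[T]_(n, \rank AF) := \matrix_(j, i) (j == h i)%:R.
have PE (T : comNzRingType) (v : 'cV[T]__) i : (P T *m v) (h i) 0 = v i 0.
  rewrite mxE (bigD1 i) //= mxE eqxx mul1r big1 ?addr0 // => k ki.
  by rewrite mxE (inj_eq hinj) eq_sym (negbTE ki) mul0r.
have PE0 (T : comNzRingType) (v : 'cV[T]__) j :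
    j \notin codom h -> (P T *m v) j 0 = 0.
  move=> jh; rewrite mxE big1 // => k _; rewrite mxE.
  case: eqP => [jE|]; last by rewrite mul0r.
  by rewrite jE codom_f in jh.
have AP : A1 *m P int = A2.
  apply/matrixP => i k; rewrite !mxE (bigD1 (h k)) //= !mxE eqxx mulr1 big1 ?addr0 // => j jh.
  by rewrite !mxE (negbTE jh) mulr0.
(* Otherwise the nonsingular minor would annihilate the restriction of [x]. *)
have [j0 j0h xj0] : exists2 j0, j0 \notin codom h & x j0 0 != 0.
  case: (pickP [pred j | (j \notin codom h) && (x j 0 != 0)]) => [j /andP[]|none].
    by exists j.
  case/eqP: x0.
  pose x' : 'cV_(\rank AF) := \col_i x (h i) 0.
  have xE : x = P F *m x'.
    apply/matrixP => j k; rewrite (ord1 k).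
    have [/codomP[i ->]|jh] := boolP (j \in codom h); first by rewrite PE mxE.
    by rewrite PE0 //; have := none j; rewrite /= jh /= => /negbFE/eqP.
  have A1x : map_mx intr A1 *m x = 0.
    by rewrite A1E mul_rowsub_mx AFx; apply/matrixP => ? ?; rewrite !mxE.
  have PF : map_mx intr (P int) = P F.
    by apply/matrixP => i k; rewrite !mxE; case: eqP.
  move: A1x; rewrite xE mulmxA -PF -map_mxM AP => /(congr1 (mulmx (invmx (map_mx intr A2)))).
  by rewrite mulKmx // mulmx0 => ->; rewrite mulmx0.
pose w := col j0 A1; pose v := \adj A2 *m w.
(* The adjugate instead of the inverse keeps the entries integral. *)
pose y := \det A2 *: (delta_mx j0 0 : 'cV_n) - P int *m v.
have yj0 : y j0 0 = \det A2.
  by rewrite /y [LHS]mxE [X in _ + X]mxE PE0 // !mxE !eqxx mulr1 subr0.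
have yh i : y (h i) 0 = - v i 0.
  rewrite /y [LHS]mxE [X in _ + X]mxE PE !mxE.
  case: eqP => [hi|_]; last by rewrite mulr0 add0r.
  by rewrite -hi codom_f in j0h.
have yN j : j \notin codom h -> j != j0 -> y j 0 = 0.
  move=> jh jj0; rewrite /y [LHS]mxE [X in _ + X]mxE PE0 // !mxE (negbTE jj0).
  by rewrite mulr0 subr0.
have ysupp j : x j 0 = 0 -> y j 0 = 0.
  move=> xj; have [/codomP[i ji]|jh] := boolP (j \in codom h); last first.
    by apply: yN => //; apply: contraNneq xj0 => <-; apply/eqP.
  case/negP: det0; have A2i : forall k, A2 k i = 0.
    by move=> k; rewrite !mxE -ji xj eqxx.
  by apply/eqP; rewrite (expand_det_col _ i) big1 // => k _; rewrite A2i mul0r.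
have A1y : A1 *m y = 0.
  rewrite /y mulmxBr -scalemxAr mulmxA AP /v mulmxA mul_mx_adj mul_scalar_mx.
  by rewrite -colE subrr.
clearbody y.
have AFy : AF *m map_mx intr y = 0.
  have /submxP[X AFE] : (AF <= (map_mx intr A1 : 'M[F]_(_, n)))%MS.
    by rewrite A1E eq_maxrowsub.
  have : X *m map_mx intr A1 *m map_mx intr y = 0 :> 'M[F]_(_, 1).
    by rewrite -mulmxA -map_mxM A1y map_mx0 mulmx0.
  by rewrite -AFE.
have Wy : W *m y = 0.
  have Ay : A *m y = 0.
    apply/matrixP => i k; apply/eqP; move/matrixP/(_ i k)/eqP: AFy.
    by rewrite -map_mxM mxE [X in _ == X]mxE intr_eq0 [X in _ -> _ == X]mxE.
  rewrite -[RHS]Ay; apply/matrixP => i k; rewrite !mxE; apply: eq_bigr => j _.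
  by rewrite !mxE (ord1 k); case: eqP => // xj; rewrite ysupp // !mulr0.
exists y; split => //.
  by apply: contra_neq det0 => y0; rewrite -yj0 y0 mxE.
have rm : (\rank AF <= m)%N := rank_leq_row AF.
have leD : ((\rank AF)`! * D ^ \rank AF)%N%:Z <= (m`! * D ^ m)%N%:Z.
  by rewrite lez_nat leq_mul // ?leq_pexp2l // leq_fact.
move=> j; apply: le_trans leD; have leA2 i k : `|A2 i k| <= D%:Z by rewrite !mxE;
  have := leA (g i) (h k); rewrite mxE.
have [/codomP[i ->]|jh] := boolP (j \in codom h).
  rewrite yh normrN; apply: adjmul_bound => // k; rewrite !mxE; have := leA (g k) j0;
    by rewrite mxE.
have [->|jj0] := eqVneq j j0; first by rewrite yj0; exact: det_bound.
by rewrite yN // normr0.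
Qed.

(** * Conformal decompositions in integer kernels *)

(** Families over finite types instead of matrices: blocks can then be
re-indexed without casts. *)
Definition ker (F : pzRingType) (I J : finType) (W : I -> J -> int) (x : J -> F) : Prop :=
  forall i, \sum_j (W i j)%:~R * x j = 0.

(** [K] bounds integer representatives of the circuits of [W]. Only supports are
compared here; [conformal_bound] recovers the signs. *)
Definition kernel_bound (F : realFieldType) (I J : finType) (W : I -> J -> int) (K : int) : Prop :=
  forall x : J -> F, ker W x -> (exists j, x j != 0) ->
  exists y : J -> int,
    [/\ ker W (fun j => (y j)%:~R : F), exists j, y j != 0,
        forall j, x j = 0 -> y j = 0 & forall j, `|y j| <= K].

Definition sign_conformal (F : realFieldType) (J : finType) (y x : J -> F) : Prop :=
  forall j, 0 <= y j * x j /\ (x j = 0 -> y j = 0).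

Definition between (F : realFieldType) (a x : F) : Prop :=
  0 <= a <= x \/ x <= a <= 0.

Lemma kernel_bound_fact (F : realFieldType) (I J : finType) (W : I -> J -> int) (D M : nat) :
  (0 < D)%N -> (#|I| <= M)%N -> (forall i j, `|W i j| <= D%:Z) ->
  kernel_bound F W (M`! * D ^ M)%N%:Z.
Proof.
move=> D0 IM leW x Wx [j xj].
pose WM : 'M[int]_(#|I|, #|J|) := \matrix_(i, j) W (enum_val i) (enum_val j).
pose xM : 'cV[F]_#|J| := \col_j x (enum_val j).
have reI (G : J -> F) : \sum_j G j = \sum_(j < #|J|) G (enum_val j).
  by rewrite (reindex _ (onW_bij _ (enum_val_bij J))).
have [] := @kernel_int_small F _ _ WM D xM D0.
- by move=> i k; rewrite mxE.
- apply/matrixP => i k; rewrite !mxE -[RHS](Wx (enum_val i)) reI.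
  by apply: eq_bigr => l _; rewrite !mxE.
- apply: contraNneq xj => /matrixP/(_ (enum_rank j) 0).
  by rewrite !mxE enum_rankK => ->.
move=> y [y0 Wy ysupp leY]; exists (fun j => y (enum_rank j) 0); split.
- move=> i; rewrite reI; move/matrixP/(_ (enum_rank i) 0): Wy.
  rewrite !mxE => E; have := congr1 (fun z : int => z%:~R : F) E.
  rewrite rmorph0 rmorph_sum /=; apply: etrans.
  by apply: eq_bigr => k _; rewrite mxE rmorphM /= enum_rankK enum_valK.
- case: (pickP (fun k => y k 0 != 0)) => [k yk|none].
    by exists (enum_val k); rewrite enum_valK.
  by case/eqP: y0; apply/matrixP => k l; rewrite (ord1 l) mxE; apply/eqP/negbFE/none.
- by move=> k xk; apply: ysupp; rewrite mxE enum_rankK.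
- move=> k; apply: le_trans (leY _) _; rewrite lez_nat leq_mul ?leq_fact //.
  exact: leq_pexp2l.
Qed.

Section Conformal.
Variables (F : archiRealFieldType) (I J : finType) (W : I -> J -> int) (K : int).
Hypothesis K0 : 0 <= K.
Hypothesis bndK : kernel_bound F W K.
Implicit Types x c : J -> F.

Lemma kerB x c (t : F) : ker W x -> ker W c -> ker W (fun j => x j - t * c j).
Proof.
move=> Wx Wc i; under eq_bigr do rewrite mulrBr mulrCA.
by rewrite sumrB -mulr_sumr Wx Wc mulr0 subr0.
Qed.

Lemma ker_sum (T : Type) (s : seq T) (mu : T -> F) (h : T -> J -> F) :
  (forall p, ker W (h p)) -> ker W (fun j => \sum_(p <- s) mu p * h p j).
Proof.
move=> Wh i; under eq_bigr do rewrite mulr_sumr; rewrite exchange_big /=.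
by rewrite big1 // => p _; under eq_bigr do rewrite mulrCA; rewrite -mulr_sumr Wh mulr0.
Qed.

Definition nsupp x := #|[set j | x j != 0]|.

Lemma signed_trans y x z : @sign_conformal F J y x -> sign_conformal x z -> sign_conformal y z.
Proof.
move=> yx xz j; have [yx0 yx1] := yx j; have [xz0 xz1] := xz j; split; last first.
  by move=> /xz1/yx1.
have [/yx1->|x0] := eqVneq (x j) 0; first by rewrite mul0r.
have x2 : 0 < x j ^+ 2 by rewrite exprn_even_gt0.
by rewrite -(pmulr_lge0 _ x2); nra.
Qed.

(** [mu] is the largest step along [c] that changes no sign of [x]; it makes the
coordinate that attains the minimal ratio vanish. *)
Lemma cancel_coordinate x c : (forall j, x j = 0 -> c j = 0) -> (exists j, 0 < c j * x j) ->
  exists2 mu : F, 0 < mu &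
    sign_conformal (fun j => x j - mu * c j) x /\
    (nsupp (fun j => x j - mu * c j)%R < nsupp x)%N.
Proof.
move=> supp [j0 cx0].
(* The step is the minimal ratio over the coordinates where [c] and [x] agree. *)
have [j jc jmin] :=
  @Order.TotalTheory.arg_minP _ _ _ j0 (fun j => 0 < c j * x j) (fun j => x j / c j) cx0.
have cj : c j != 0 by apply: contraTneq jc => ->; rewrite mul0r ltxx.
have xj : x j != 0 by apply/eqP => xj; move: jc; rewrite xj mulr0 ltxx.
have sgn : sign_conformal (fun k => x k - x j / c j * c k) x.
  move=> k; split; last by move=> xk; rewrite xk (supp _ xk) mulr0 subr0.
  have [ck|ck] := ltP 0 (c k * x k).
    have ck0 : c k != 0 by apply: contraTneq ck => ->; rewrite mul0r ltxx.
    have -> : (x k - x j / c j * c k) * x k = (c k * x k) * (x k / c k - x j / c j).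
      by field; rewrite ck0 cj.
    by rewrite mulr_ge0 ?subr_ge0 ?jmin // ltW.
  have mu0 : 0 < x j / c j.
    by have -> : x j / c j = (c j * x j) / c j ^+ 2; [field | rewrite divr_gt0 // exprn_even_gt0].
  by have x2 := sqr_ge0 (x k); nra.
exists (x j / c j).
  by have -> : x j / c j = (c j * x j) / c j ^+ 2; [field | rewrite divr_gt0 // exprn_even_gt0].
split=> //; apply: fintype.proper_card; apply/fintype.properP; split.
  by apply/fintype.subsetP => k; rewrite !inE; apply: contraNneq => xk; have [_ ->] := sgn k.
by exists j; rewrite !inE // divfK // subrr eqxx.
Qed.

(** A circuit in the support of [x] may disagree with [x] in sign elsewhere, but
then subtracting a multiple of it from [x] shrinks the support, keeps the
signs, and does not give 0. *)
Lemma conformal_bound x : ker W x -> (exists j, x j != 0) ->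
  exists y : J -> int,
    [/\ ker W (fun j => (y j)%:~R : F), exists j, y j != 0,
        sign_conformal (fun j => (y j)%:~R) x & forall j, `|y j| <= K].
Proof.
have [n] := ubnP (nsupp x); elim: n x => // n IH x ltn Wx x0.
have [c' [Wc' [j cj'] supp' leK']] := bndK Wx x0.
have [c [Wc supp leK [j0 cj0]]] : exists c : J -> int,
  [/\ ker W (fun j => (c j)%:~R : F), forall j, x j = 0 -> c j = 0,
      forall j, `|c j| <= K & exists j, 0 < (c j)%:~R * x j].
  have := mulf_neq0 (_ : (c' j)%:~R != 0 :> F) (_ : x j != 0).
  rewrite intr_eq0 => /(_ cj') /(_ _)/lt_total/orP[||].
  - by apply: contraNneq cj' => /supp'->.
  - move=> neg; exists (fun j => - c' j); split=> [|k /supp'->|k|]; rewrite ?oppr0 ?normrN //.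
      move=> i; apply: etrans (_ : - \sum_j (W i j)%:~R * (c' j)%:~R = 0); last first.
        by rewrite Wc' oppr0.
      by rewrite -sumrN; apply: eq_bigr => k _; rewrite rmorphN mulrN.
    by exists j; rewrite rmorphN mulNr oppr_gt0.
  - by move=> pos; exists c'; split=> //; exists j.
have [|mu mu0 [sgn lts]] := @cancel_coordinate x (fun j => (c j)%:~R) _ (ex_intro _ j0 cj0).
  by move=> k /supp->.
case: (pickP (fun j => x j - mu * (c j)%:~R != 0)) => [j1 xj1|none].
  have [|||y [Wy y0 sy leY]] := IH (fun j => x j - mu * (c j)%:~R).
  - exact: leq_trans lts _.
  - exact: kerB.
  - by exists j1.
  by exists y; split=> //; apply: signed_trans sgn.
exists c; split=> //.
  by exists j0; apply: contraTneq cj0 => ->; rewrite mul0r ltxx.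
move=> k; split; last by move=> /supp->.
have /negbFE/eqP/subr0_eq-> := none k.
by rewrite mulrCA mulr_ge0 ?(ltW mu0) // -expr2 sqr_ge0.
Qed.

(** Greedy subtraction of conformal vectors: each step removes a coordinate from
the support, hence the number of terms. *)
Lemma conformal_decomposition x : ker W x ->
  exists s : seq (F * (J -> int)),
    [/\ (size s <= nsupp x)%N,
        forall p, List.In p s -> [/\ 0 <= p.1, ker W (fun j => (p.2 j)%:~R : F),
            sign_conformal (fun j => (p.2 j)%:~R) x & forall j, `|p.2 j| <= K]
      & forall j, x j = \sum_(p <- s) p.1 * (p.2 j)%:~R].
Proof.
have [n] := ubnP (nsupp x); elim: n x => // n IH x ltn Wx.
case: (pickP (fun j => x j != 0)) => [j xj|none]; last first.
  exists [::]; split=> // j; rewrite big_nil; exact/eqP/negbFE/none.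
have [y [Wy [k yk] sy leY]] := conformal_bound Wx (ex_intro _ j xj).
have [||mu mu0 [sgn lts]] := @cancel_coordinate x (fun j => (y j)%:~R).
- by move=> l xl; have [_ ->] := sy l.
- exists k; have [ge0 xk] := sy k; rewrite lt_neqAle ge0 andbT eq_sym mulf_neq0 ?intr_eq0 //.
  by apply: contraNneq yk => /xk/eqP; rewrite intr_eq0.
have [||s [ls sP sE]] := IH (fun j => x j - mu * (y j)%:~R).
- exact: leq_trans lts _.
- exact: kerB.
exists ((mu, y) :: s); split=> [|p [<-|/sP[p0 Wp sp leP]]|l].
- exact: leq_ltn_trans ls lts.
- by split=> //; exact: ltW.
- by split=> //; apply: signed_trans sgn.
- by rewrite big_cons -sE /=; ring.
Qed.

Lemma ler_sum_In (T : Type) (s : seq T) (f g : T -> F) :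
  (forall p, List.In p s -> f p <= g p) -> \sum_(p <- s) f p <= \sum_(p <- s) g p.
Proof.
elim: s => [|p s IH] H; first by rewrite !big_nil.
by rewrite !big_cons lerD ?H //=; [left | apply: IH => q Hq; apply: H; right].
Qed.

(** No cancellation: all terms have the sign of [x j], so smaller multipliers
move the sum monotonically towards 0. *)
Lemma sum_signed (T : Type) (s : seq T) (h : T -> J -> int) (x : J -> F) (a b : T -> F) j :
  (forall p, List.In p s -> sign_conformal (fun j => (h p j)%:~R) x) ->
  (forall p, List.In p s -> 0 <= a p <= b p) ->
  x j = \sum_(p <- s) b p * (h p j)%:~R ->
  between (\sum_(p <- s) a p * (h p j)%:~R) (x j).
Proof.
move=> sP ab xE; have [x0|x0|x0] := ltgtP (x j) 0; rewrite /between.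
- right; rewrite xE; apply/andP; split.
    apply: ler_sum_In => p ps; have [+ _] := sP p ps j => sg.
    have /andP[a0 ab'] := ab p ps; have : (h p j)%:~R <= 0 :> F by nra.
    by nra.
  rewrite [leRHS](_ : 0 = \sum_(p <- s) (0 : F)); last by rewrite big1.
  apply: ler_sum_In => p ps.
  have [+ _] := sP p ps j => sg; have /andP[a0 ab'] := ab p ps.
  by have : (h p j)%:~R <= 0 :> F; nra.
- left; rewrite xE; apply/andP; split; last first.
    apply: ler_sum_In => p ps; have [+ _] := sP p ps j => sg.
    have /andP[a0 ab'] := ab p ps; have : 0 <= (h p j)%:~R :> F by nra.
    by nra.
  rewrite [leLHS](_ : 0 = \sum_(p <- s) (0 : F)); last by rewrite big1.
  apply: ler_sum_In => p ps.
  have [+ _] := sP p ps j => sg; have /andP[a0 ab'] := ab p ps.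
  by have : 0 <= (h p j)%:~R :> F; nra.
- left; suff -> : \sum_(p <- s) a p * (h p j)%:~R = 0 by rewrite x0 lexx.
  suff : forall p, List.In p s -> (h p j)%:~R = 0 :> F.
    elim: (s) => [|p s' IH] H; first by rewrite big_nil.
    rewrite big_cons H /=; last by left.
    by rewrite mulr0 add0r IH // => q Hq; apply: H; right.
  by move=> p ps; have [_ ->] := sP p ps j.
Qed.

(** The multipliers of a conformal decomposition are rounded down; each of the
fractional parts moves the sum by at most [K]. *)
Lemma conformal_rounding x : ker W x ->
  exists a : J -> int,
    [/\ ker W (fun j => (a j)%:~R : F), forall j, between (a j)%:~R (x j)
      & forall j, `|x j - (a j)%:~R| <= (#|J|%:Z * K)%:~R].
Proof.
move=> Wx; have [s [ls sP xE]] := conformal_decomposition Wx.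
pose a j := \sum_(p <- s) (Num.truncn p.1)%:Z * p.2 j.
have aE j : (a j)%:~R = \sum_(p <- s) (Num.truncn p.1)%:R * (p.2 j)%:~R :> F.
  by rewrite rmorph_sum; apply: eq_bigr => p _; rewrite rmorphM.
have Ws (f : F -> F) : ker W (fun j => \sum_(p <- s) f p.1 * (p.2 j)%:~R).
  move=> i; under eq_bigr do rewrite mulr_sumr; rewrite exchange_big /=.
  have : forall p, List.In p s -> \sum_j (W i j)%:~R * (f p.1 * (p.2 j)%:~R) = 0.
    move=> p /sP[_ Wp _ _]; under eq_bigr do rewrite mulrCA.
    by rewrite -mulr_sumr Wp mulr0.
  elim: (s) => [|p s' IH] H; first by rewrite big_nil.
  rewrite big_cons H; last by left.
  by rewrite add0r IH // => q Hq; apply: H; right.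
exists a; split.
- by move=> i; under eq_bigr do rewrite aE; exact: Ws (fun m => (Num.truncn m)%:R) i.
- move=> j; rewrite aE; apply: (sum_signed (h := fun p => p.2) (b := fst) _ _ (xE j));
  first by move=> p /sP[].
  by move=> p /sP[p0 _ _ _]; rewrite ler0n truncn_le.
move=> j; rewrite aE xE -sumrB.
apply: le_trans (ler_norm_sum _ _ _) _.
apply: (@le_trans _ _ (\sum_(p <- s) K%:~R)).
  apply: ler_sum_In => p /sP[p0 _ _ leK]; rewrite -mulrBl normrM.
  have := leK j; rewrite -(ler_int F) => leK'.
  have := truncn_le p.1; rewrite p0 => t1; have := truncnS_gt p.1; rewrite -natr1 => t2.
  rewrite ger0_norm ?subr_ge0 // -intr_norm.
  have : 0 <= `|p.2 j|%:~R :> F by rewrite ler0z.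
  by nra.
rewrite big_const_seq count_predT iter_addr_0 rmorphM /= -[leLHS]mulr_natl ler_pM ?ler0n ?ler0z //.
by rewrite ler_nat (leq_trans ls) // max_card.
Qed.
End Conformal.

(** * Rounding kernel vectors of four-block matrices *)

(** Rounding on two levels. The vector [x] is decomposed into bounded conformal
kernel vectors [h t] of [U] alone. Its multipliers satisfy the system [W]
obtained by applying [G] to the [h t], which has as few rows as [G];
rounding them in the kernel of [W] rounds [x] in both kernels. *)
Lemma rounding_coupled (F : archiRealFieldType) (I1 I2 J : finType)
    (U : I1 -> J -> int) (G : I2 -> J -> int) (kappa g : nat) (x : J -> F) :
  (0 < kappa)%N -> (0 < g)%N ->
  kernel_bound F U kappa%:Z -> (forall i j, `|G i j| <= g%:Z) ->
  ker U x -> ker G x ->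
  exists a : J -> int,
    [/\ ker U (fun j => (a j)%:~R : F), ker G (fun j => (a j)%:~R : F),
        forall j, between (a j)%:~R (x j)
      & forall j, `|x j - (a j)%:~R| <=
         (#|J| * ((#|J| * (#|I2| `! * (#|J|.+1 * g * kappa) ^ #|I2|)) * kappa))%N%:R].
Proof.
move=> k0 g0 bndU leG Ux Gx.
have [s [ls sP xE]] := conformal_decomposition bndU Ux.
pose h (t : 'I_(size s)) := (tnth (in_tuple s) t).2.
pose mu (t : 'I_(size s)) := (tnth (in_tuple s) t).1.
have hP t : [/\ 0 <= mu t, ker U (fun j => (h t j)%:~R : F),
            sign_conformal (fun j => (h t j)%:~R) x & forall j, `|h t j| <= kappa%:Z].
  apply: sP; rewrite (tnth_nth (0, fun=> 0)) /=.
  have: (t < size s)%N by []. move: (nat_of_ord t) => {t}.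
  elim: (s) => // p s' IH [|t] /=; first by left.
  by rewrite ltnS => /IH; right.
have leJ : (size s <= #|J|)%N by rewrite (leq_trans ls) // max_card.
have xE' j : x j = \sum_t mu t * (h t j)%:~R.
  by rewrite xE (big_tnth _ _ s).
pose W (i : I2) (t : 'I_(size s)) := \sum_j G i j * h t j.
have leW i t : `|W i t| <= (#|J|.+1 * g * kappa)%N%:Z.
  have [_ _ _ leh] := hP t.
  apply: le_trans (@ler_int_sum_const _ _ (g * kappa)%N%:Z _) _ => [j|].
    by rewrite normrM PoszM ler_pM.
  by rewrite -PoszM lez_nat -mulnA leq_mul.
have Wmu : ker W mu.
  move=> i; rewrite -[RHS](Gx i); under [RHS]eq_bigr do rewrite xE' mulr_sumr.
  rewrite exchange_big /=; apply: eq_bigr => t _.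
  rewrite rmorph_sum /= mulr_suml; apply: eq_bigr => j _.
  by rewrite rmorphM /=; ring.
have D0 : (0 < #|J|.+1 * g * kappa)%N by rewrite !muln_gt0 g0 k0.
have [] := @conformal_rounding F _ _ W (#|I2| `! * (#|J|.+1 * g * kappa) ^ #|I2|)%N%:Z _ _ mu Wmu.
- by [].
- exact: kernel_bound_fact.
move=> b [Wb bmu leb]; have b0 t : 0 <= ((b t)%:~R : F) <= mu t.
  have [mu0 _ _ _] := hP t; case: (bmu t) => // /andP[le1 le2].
  by rewrite (le_trans mu0 le1) (le_trans le2 mu0).
pose a j := \sum_t b t * h t j.
have aE j : (a j)%:~R = \sum_t (b t)%:~R * (h t j)%:~R :> F.
  by rewrite rmorph_sum; apply: eq_bigr => t _; rewrite rmorphM.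
exists a; split.
- move=> i; under eq_bigr do rewrite aE.
  by apply: (@ker_sum F _ _ U _ (index_enum _) (fun t => (b t)%:~R) (fun t j => (h t j)%:~R)) =>
    t; case: (hP t).
- move=> i; rewrite -[RHS](Wb i); under [LHS]eq_bigr do rewrite aE mulr_sumr.
  rewrite exchange_big /=; apply: eq_bigr => t _.
  rewrite rmorph_sum /= mulr_suml; apply: eq_bigr => j _.
  by rewrite rmorphM /=; ring.
- move=> j; rewrite aE; apply: (sum_signed (h := h) (b := mu) _ _ (xE' j)) => // t _.
  by case: (hP t).
move=> j; rewrite xE' aE -sumrB.
apply: le_trans (ler_norm_sum _ _ _) _.
apply: (@le_trans _ _ (\sum_(t < size s) (#|J| * (#|I2| `! * (#|J|.+1 * g * kappa) ^ #|I2|) *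
  kappa)%N%:R)).
  apply: ler_sum => t _; rewrite -mulrBl normrM natrM ler_pM //; last first.
    by have [_ _ _ /(_ j)] := hP t; rewrite -intr_norm -(ler_int F).
  apply: le_trans (leb t) _; rewrite -PoszM card_ord ler_nat leq_mul //.
by rewrite sumr_const card_ord -mulrnA ler_nat mulnC leq_mul.
Qed.

Section FourBlock.
Variables (dA dC nA nB : nat).
Variables (A : 'M[int]_(dA, nA)) (B : 'M[int]_(dA, nB)).
Variables (C : 'M[int]_(dC, nB)) (D : 'M[int]_(dC, nA)).

(** The blocks are indexed by an arbitrary finite type, because the proof of
[two_stage_bound] merges blocks. *)
Definition column (T : finType) : finType := ('I_nB + T * 'I_nA)%type.

Definition two_stage (T : finType) (r : T * 'I_dA) (j : column T) : int :=
  match j with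
  | inl c => B r.2 c
  | inr (t, c) => if t == r.1 then A r.2 c else 0
  end.

Definition linking (T : finType) (r : 'I_dC) (j : column T) : int :=
  match j with inl c => C r c | inr (_, c) => D r c end.

Lemma sum_column (F : nmodType) (T : finType) (G : column T -> F) :
  \sum_j G j = \sum_c G (inl c) + \sum_t \sum_c G (inr (t, c)).
Proof. by rewrite big_sumType /= pair_bigA; congr (_ + _); apply: eq_bigr => -[]. Qed.

Lemma two_stageE (F : pzRingType) (T : finType) (x : column T -> F) t r :
  \sum_j (two_stage (t, r) j)%:~R * x j =
  \sum_c (B r c)%:~R * x (inl c) + \sum_c (A r c)%:~R * x (inr (t, c)).
Proof.
rewrite sum_column /=; congr (_ + _); rewrite (bigD1 t) //= eqxx [X in _ + X]big1 ?addr0 // => i it.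
by rewrite (negbTE it) big1 // => c _; rewrite mul0r.
Qed.

(** Blocks in which [x] has the same support can share one block of the solution,
so at most [2 ^ nA] blocks matter, whatever their number. *)
Lemma two_stage_bound : exists2 kappa : nat, (0 < kappa)%N &
  forall (F : realFieldType) (T : finType), kernel_bound F (@two_stage T) kappa%:Z.
Proof.
pose d := (\sum_r \sum_c `|A r c| + \sum_r \sum_c `|B r c|).+1%N.
have leA r c : `|A r c| <= d%:Z.
  by rewrite -abszE lez_nat /d (bigD1 r) //= (bigD1 c) //=; lia.
have leB r c : `|B r c| <= d%:Z.
  rewrite -abszE lez_nat /d [X in (_ <= (_ + X).+1)%N](bigD1 r) //=.
  by rewrite [X in (_ <= (_ + (X + _)).+1)%N](bigD1 c) //=; lia.
pose M := (2 ^ nA * dA)%N; exists (M`! * d ^ M)%N.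
  by rewrite muln_gt0 fact_gt0 expn_gt0.
move=> F T x Ux [j xj].
pose sg t := [set c | x (inr (t, c)) != 0].
(* Only supports that occur: each of them needs a block that represents it. *)
pose S : finType := {s : {set 'I_nA} | s \in codom sg}.
pose rep (s : S) : T := iinv (valP s).
have repE s : sg (rep s) = val s by apply: f_iinv.
pose cl (t : T) : S := exist _ (sg t) (codom_f sg t).
have rcl t : sg (rep (cl t)) = sg t by rewrite repE.
have clr s : cl (rep s) = s by apply: val_inj; rewrite /= repE.
pose lift (j : column S) : column T :=
  match j with inl c => inl c | inr (s, c) => inr (rep s, c) end.
pose proj (j : column T) : column S :=
  match j with inl c => inl c | inr (t, c) => inr (cl t, c) end.
have Ux' : ker (@two_stage S) (fun j => x (lift j)).
  by move=> [s r]; rewrite two_stageE /= -(two_stageE x) Ux.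
have S_le : (#|{: S * 'I_dA}| <= M)%N.
  rewrite card_prod card_ord leq_mul2r -[2%N]card_bool; apply/orP; right.
  by rewrite card_sig (leq_trans (max_card _)) // -cardsT -powersetT card_powerset cardsT
    card_ord card_bool.
have bnd := @kernel_bound_fact F _ _ (@two_stage S) d M isT S_le.
have [||y [Uy [k yk] supp leY]] := bnd _ (fun j => x (lift j)) Ux'.
- by move=> r [c|[s c]] //=; case: ifP => // _; rewrite normr0.
- exists (proj j); case: j xj => [c|[t c]] //= xj.
  by have : c \in sg t; [rewrite inE | rewrite -rcl inE].
exists (fun j => y (proj j)); split.
- by move=> [t r]; rewrite two_stageE /= -(two_stageE (fun j => (y j)%:~R)) Uy.
- by exists (lift k); case: k yk => [c|[s c]] //=; rewrite clr.
- move=> [c|[t c]] /= xc; apply: supp => //=; apply/eqP/negbNE.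
  by have : c \notin sg t; [rewrite inE xc eqxx | rewrite -rcl inE].
- by move=> l; apply: leY.
Qed.

Lemma leq_const_exp (c n : nat) : (c <= n.+2 ^ c)%N.
Proof. exact/ltnW/ltn_expl. Qed.

Lemma leq_exp2r_weak m n e : (m <= n -> m ^ e <= n ^ e)%N.
Proof. by case: e => // e; rewrite leq_exp2r. Qed.

(** The linking rows, applied to circuits of constant size, have entries of order
[N]; only their number [dC] enters the exponent. *)
Lemma four_block_rounding : exists e : nat,
  forall (F : archiRealFieldType) (N : nat) (x : column 'I_N -> F),
  ker (@two_stage 'I_N) x -> ker (@linking 'I_N) x ->
  exists a : column 'I_N -> int,
    [/\ ker (@two_stage 'I_N) (fun j => (a j)%:~R : F),
        ker (@linking 'I_N) (fun j => (a j)%:~R : F),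
        forall j, between (a j)%:~R (x j)
      & forall j, `|x j - (a j)%:~R| <= (N.+2 ^ e)%N%:R].
Proof.
have [kappa k0 bnd] := two_stage_bound.
pose g := (\sum_r \sum_c `|C r c| + \sum_r \sum_c `|D r c|).+1%N.
have leC r c : `|C r c| <= g%:Z.
  by rewrite -abszE lez_nat /g (bigD1 r) //= (bigD1 c) //=; lia.
have leD r c : `|D r c| <= g%:Z.
  rewrite -abszE lez_nat /g [X in (_ <= (_ + X).+1)%N](bigD1 r) //=.
  by rewrite [X in (_ <= (_ + (X + _)).+1)%N](bigD1 c) //=; lia.
pose m := (nB + nA).+1; pose fc := dC`!.
exists (m.+1 + (m.+1 + (fc + (m.+1 + g + kappa) * dC) + kappa))%N => F N x Ux Lx.
have [|a [Ua La bet lea]] := rounding_coupled k0 (isT : 0 < g)%N (bnd F 'I_N) _ Ux Lx.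
  by move=> r [c|[t c]] /=.
exists a; split=> // j; apply: le_trans (lea j) _; rewrite ler_nat card_sum card_prod !card_ord.
have le1 : ((nB + N * nA).+1 <= N.+2 ^ m.+1)%N.
  rewrite expnS; apply: leq_trans (leq_mul (leqnn N.+2) (leq_const_exp m N)).
  rewrite /m; nia.
have le0 : (nB + N * nA <= N.+2 ^ m.+1)%N by apply: leq_trans le1.
rewrite expnD leq_mul // expnD leq_mul ?leq_const_exp // expnD leq_mul //.
rewrite expnD leq_mul ?leq_const_exp // expnM leq_exp2r_weak // !expnD.
by rewrite !leq_mul ?leq_const_exp.
Qed.
End FourBlock.

(** * Proximity for separable convex objectives *)

Definition block_index m N k (j : column k m 'I_N) : 'I_(nfold_dim m N k) :=
  match j with
  | inl c => lshift _ c
  | inr (t, c) => rshift m (@tagnat.Rank N (fun=> k) t c)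
  end.

Lemma block_index_bij m N k : bijective (@block_index m N k).
Proof.
exists (fun s => match fintype.split s with
  | inl c => inl c
  | inr s => inr (tagnat.sig1 s, tagnat.sig2 s) end) => [[c|[t c]]|s] /=.
- case: fintype.splitP => [c' /= E|c' /= E]; first by congr inl; apply: val_inj.
  by have := ltn_ord c; rewrite E ltnNge leq_addr.
- case: fintype.splitP => [c' /= E|c' /= E].
    by have := ltn_ord c'; rewrite -E ltnNge leq_addr.
  have -> : c' = tagnat.Rank t c by apply: val_inj; apply: (@addnI m).
  rewrite tagnat.Rank1K; congr (inr (_, _)); apply: val_inj => /=.
  by rewrite tagnat.Rank2K /=.
case: fintype.splitP => [c E|c E]; apply: val_inj => //=.
by rewrite E -[in RHS](tagnat.sig2K c).
Qed.

Lemma map_intr_id m n (M : 'M[int]_(m, n)) : map_mx intr M = M.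
Proof. by apply/matrixP => i j; rewrite !mxE intz. Qed.

Lemma mulmx_intr (T : pzRingType) m n (M : 'M[int]_(m, n)) (a : 'cV[int]_n) :
  map_mx intr (map_mx intr M *m a) = map_mx intr M *m map_mx intr a :> 'cV[T]_m.
Proof. by rewrite map_intr_id map_mxM. Qed.

Section FourBlockMatrix.
Variables (dA dC nA nB : nat).
Variables (A : 'M[int]_(dA, nA)) (B : 'M[int]_(dA, nB)).
Variables (C : 'M[int]_(dC, nB)) (D : 'M[int]_(dC, nA)).
Local Notation M N := (nfold4 A B C D N).

Lemma nfold4_linking N r j :
  M N (lshift _ r) (block_index j) = linking C D r j.
Proof.
case: j => [c|[t c]] /=; first by rewrite block_mxEul.
rewrite block_mxEur; have /matrixP/(_ r c) := @mxrowK _ _ (fun=> nA) _ (fun=> D) t.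
by rewrite mxE => ->.
Qed.

Lemma nfold4_two_stage N t r j :
  M N (rshift _ (@tagnat.Rank N (fun=> dA) t r)) (block_index j) = two_stage A B (t, r) j.
Proof.
case: j => [c|[t' c]] /=.
  rewrite block_mxEdl; have /matrixP/(_ r c) := @mxcolK _ _ (fun=> dA) _ (fun=> B) t.
  by rewrite mxE => ->.
rewrite block_mxEdr.
have /matrixP/(_ r c) := @mxblockK _ _ _ (fun=> dA) (fun=> nA) (fun i j =>
  if i == j then A else 0) t t'.
by rewrite mxE => ->; rewrite eq_sym; case: eqP; rewrite // mxE.
Qed.

Lemma nfold4_mulE (T : pzRingType) N (x : 'cV[T]_(nfold_dim nB N nA)) i :
  (map_mx intr (M N) *m x) i 0 = \sum_j (M N i (block_index j))%:~R * x (block_index j) 0.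
Proof.
rewrite mxE (reindex _ (onW_bij _ (block_index_bij nB N nA))) /=.
by apply: eq_bigr => j _; rewrite mxE.
Qed.

Lemma nfold4_ker (T : pzRingType) N (x : 'cV[T]_(nfold_dim nB N nA)) :
  map_mx intr (M N) *m x = 0 <->
  ker (@two_stage _ _ _ A B 'I_N) (fun j => x (block_index j) 0) /\
  ker (@linking _ _ _ C D 'I_N) (fun j => x (block_index j) 0).
Proof.
split=> [/matrixP Mx|[Ux Lx]].
  split=> [[t r]|r].
    have := Mx (rshift _ (@tagnat.Rank N (fun=> dA) t r)) 0;
      rewrite nfold4_mulE [X in _ = X]mxE => E.
    by under eq_bigr do rewrite -nfold4_two_stage.
  have := Mx (lshift _ r) 0; rewrite nfold4_mulE [X in _ = X]mxE => E.
  by under eq_bigr do rewrite -nfold4_linking.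
apply/matrixP => i k; rewrite (ord1 k) nfold4_mulE [RHS]mxE.
have [j' _ ji] := block_index_bij dC N dA; rewrite -(ji i); case: (j' i) => [r|[t r]] /=.
  by under eq_bigr do rewrite nfold4_linking.
by under eq_bigr do rewrite nfold4_two_stage.
Qed.

Lemma kernel_rounding : exists e : nat,
  forall (F : archiRealFieldType) (N : nat) (x : 'cV[F]_(nfold_dim nB N nA)),
  map_mx intr (M N) *m x = 0 ->
  exists a : 'cV[int]_(nfold_dim nB N nA),
    [/\ map_mx intr (M N) *m a = 0, forall i, between (a i 0)%:~R (x i 0)
      & forall i, `|x i 0 - (a i 0)%:~R| <= (N.+2 ^ e)%N%:R].
Proof.
have [e rnd] := four_block_rounding A B C D; exists e => F N x /nfold4_ker[Ux Lx].
have [a [Ua La bet lea]] := rnd _ _ _ Ux Lx.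
have [inv invK Kinv] := block_index_bij nB N nA.
exists (\col_i a (inv i)); split.
- suff MF : map_mx intr (map_mx intr (M N) *m \col_i a (inv i)) = 0 :> 'cV[F]__.
    apply/matrixP => i k; apply/eqP; move/matrixP/(_ i k)/eqP: MF.
    by rewrite mxE [X in _ == X]mxE intr_eq0 [X in _ -> _ == X]mxE.
  rewrite mulmx_intr; apply/nfold4_ker; split=> i.
    by under eq_bigr do rewrite !mxE invK; exact: Ua.
  by under eq_bigr do rewrite !mxE invK; exact: La.
- by move=> i; rewrite mxE -{2}(Kinv i).
- by move=> i; rewrite mxE -{1}(Kinv i).
Qed.
End FourBlockMatrix.

Section Convex.
Variable R : realType.

Lemma convexE (g : R^o -> R^o) : convex_function [set: R^o] g ->
  forall (a b t : R), 0 <= t <= 1 -> g (t * a + (1 - t) * b) <= t * g a + (1 - t) * g b.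
Proof.
move=> cvx a b t t01.
pose t' : {i01 R} := Itv01 (proj1 (andP t01)) (proj2 (andP t01)).
by have := cvx t' a b (mem_set I) (mem_set I); rewrite /conv /=.
Qed.

(** [x + a] and [y - a] are convex combinations of [x] and [y] with exchanged
weights. *)
Lemma convex_exchange (g : R^o -> R^o) : convex_function [set: R^o] g ->
  forall (x y a : R), between a (y - x) -> g (x + a) + g (y - a) <= g x + g y.
Proof.
move=> cvx x y a axy.
have [xy|xy] := eqVneq y x.
  have -> : a = 0 by case: axy => /andP[]; rewrite xy subrr; lra.
  by rewrite addr0 subr0.
have yx : y - x != 0 by rewrite subr_eq0.
pose t := a / (y - x); have t01 : 0 <= t <= 1.
  rewrite /t; case: axy => /andP[a0 a1].
    have yx0 : 0 < y - x by rewrite lt_neqAle eq_sym yx (le_trans a0 a1).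
    by rewrite divr_ge0 ?(ltW yx0) //= ler_pdivrMr // mul1r.
  have yx0 : y - x < 0 by rewrite lt_neqAle yx (le_trans a0 a1).
  by rewrite ler_ndivlMr // mul0r a1 /= ler_ndivrMr // mul1r.
have aE : a = t * (y - x) by rewrite /t divfK.
have t01' : 0 <= 1 - t <= 1 by move: t01 => /andP[? ?]; apply/andP; lra.
have := convexE cvx y x t01; have := convexE cvx y x t01'.
have -> : t * y + (1 - t) * x = x + a by rewrite aE; ring.
have -> : (1 - t) * y + (1 - (1 - t)) * x = y - a by rewrite aE; ring.
have -> : 1 - (1 - t) = t by ring.
by move=> h1 h2; move: (lerD h1 h2); rewrite addrC => h; apply: le_trans h _; rewrite le_eqVlt;
  apply/orP; left; apply/eqP; ring.
Qed.

Lemma convex_ub (g : R^o -> R^o) : convex_function [set: R^o] g ->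
  forall (x d T : R), `|d| <= T -> g (x + d) <= `|g (x - T)| + `|g (x + T)|.
Proof.
move=> cvx x d T dT; have T0 : 0 <= T by apply: le_trans dT.
have := @convex_exchange g cvx (x - T) (x + T) (T + d).
have -> : x - T + (T + d) = x + d by ring.
have -> : x + T - (T + d) = x - d by ring.
have [T00|T00] := eqVneq T 0.
  have -> : d = 0 by apply/eqP; rewrite -normr_le0 -[X in _ <= X]T00.
  by rewrite T00 !addr0 subr0 => _; have := ler_norm (g x); have := normr_ge0 (g x); lra.
have Tpos : 0 < T by rewrite lt_neqAle eq_sym T00.
move: dT; rewrite ler_norml => /andP[d1 d2] _.
(* [x + d] as a convex combination of [x + T] and [x - T]. *)
pose t := (d + T) / (T + T).
have TT : T + T != 0 by rewrite -mulr2n mulrn_eq0.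
have tE : t * (T + T) = d + T by rewrite /t divfK.
have t01 : 0 <= t <= 1 by apply/andP; split; nra.
have := convexE cvx (x + T) (x - T) t01.
have -> : t * (x + T) + (1 - t) * (x - T) = x + d.
  by transitivity (x - T + t * (T + T)); [ring | rewrite tE; ring].
have := ler_norm (g (x - T)); have := ler_norm (g (x + T)).
have := normr_ge0 (g (x - T)); have := normr_ge0 (g (x + T)).
by move: t01 => /andP[? ?]; nra.
Qed.

(** By midpoint convexity [g (x + d) >= 2 * g x - g (x - d)], and [g (x - d)] is
bounded above by the values at the ends of the interval. *)
Lemma convex_lb (g : R^o -> R^o) : convex_function [set: R^o] g ->
  forall (x d T : R), `|d| <= T ->
  2 * g x - (`|g (x - T)| + `|g (x + T)|) <= g (x + d).
Proof.
move=> cvx x d T dT.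
have h01 : 0 <= (2^-1 : R) <= 1 by apply/andP; lra.
have := convexE cvx (x + d) (x - d) h01.
have -> : 2^-1 * (x + d) + (1 - 2^-1) * (x - d) = x by field.
have := @convex_ub g cvx x (- d) T; rewrite normrN => /(_ dT); lra.
Qed.

Lemma separable_exchange n (f : 'cV[R]_n -> R) : separable_convex f ->
  forall (x y a : 'cV[R]_n), (forall i, between (a i 0) (y i 0 - x i 0)) ->
  f (x + a) + f (y - a) <= f x + f y.
Proof.
move=> [g [cvx fE]] x y a bet; rewrite !fE -!big_split /=; apply: ler_sum => i _.
by rewrite !mxE; apply: convex_exchange.
Qed.

Lemma separable_lb n (f : 'cV[R]_n -> R) : separable_convex f ->
  forall (x : 'cV[R]_n) (T : R), exists c : R,
  forall d : 'cV[R]_n, (forall i, `|d i 0| <= T) -> c <= f (x + d).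
Proof.
move=> [g [cvx fE]] x T.
exists (\sum_i (2 * g i (x i 0) - (`|g i (x i 0 - T)| + `|g i (x i 0 + T)|))) => d dT.
by rewrite fE; apply: ler_sum => i _; rewrite !mxE; apply: convex_lb.
Qed.
End Convex.

Section Proximity.
Variable R : realType.

Lemma between_bounds (l u : option int) (z a : int) (r : R) :
  between a%:~R (r - z%:~R) ->
  lower_bounded l z -> upper_bounded u z -> lower_bounded l r -> upper_bounded u r ->
  [/\ lower_bounded l (z + a), upper_bounded u (z + a),
      lower_bounded l (r - a%:~R) & upper_bounded u (r - a%:~R)].
Proof.
move=> bet lz uz lr ur.
have ez (c : int) : (c%:~R : int) = c by rewrite intz.
split; case: l lz lr => [l|] //=; case: u uz ur => [u|] //=; rewrite ?ez -?(ler_int R) ?rmorphD /=;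
  by move=> *; case: bet => /andP[]; lra.
Qed.

Section Region.
Context (m n : nat) (M : 'M[int]_(m, n)) (b : 'cV[int]_m) (l u : 'cV[option int]_n).
Local Notation IP := (@feasible int m n M b l u).
Local Notation CP := (@feasible R m n M b l u).

Lemma feasible_exchange (z a : 'cV[int]_n) (r : 'cV[R]_n) :
  IP z -> CP r -> map_mx intr M *m a = 0 ->
  (forall i, between (a i 0)%:~R (r i 0 - (z i 0)%:~R)) ->
  IP (z + a) /\ CP (r - map_mx intr a).
Proof.
move=> [Mz bz] [Mr br] Ma bet.
have Ma' : map_mx intr M *m map_mx intr a = 0 :> 'cV[R]_m.
  by rewrite -mulmx_intr Ma map_mx0.
split; split.
- by rewrite mulmxDr Mz Ma addr0.
- by move=> i; have [lz uz] := bz i; have [lr ur] := br i; rewrite !mxE;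
  case: (between_bounds (bet i) lz uz lr ur).
- by rewrite mulmxBr Mr Ma' subr0.
- by move=> i; have [lz uz] := bz i; have [lr ur] := br i; rewrite !mxE;
  case: (between_bounds (bet i) lz uz lr ur).
Qed.
End Region.

Variables (dA dC nA nB : nat).
Variables (A : 'M[int]_(dA, nA)) (B : 'M[int]_(dA, nB)).
Variables (C : 'M[int]_(dC, nB)) (D : 'M[int]_(dC, nA)).

Lemma diff_ker m n (M : 'M[int]_(m, n)) b l u (z : 'cV[int]_n) (r : 'cV[R]_n) :
  feasible M b l u z -> feasible M b l u r ->
  map_mx intr M *m (r - map_mx intr z) = 0.
Proof.
move=> [Mz _] [Mr _]; rewrite mulmxBr Mr.
by rewrite -mulmx_intr Mz map_intr_id subrr.
Qed.

Definition optima_within (e : nat) : Prop :=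
  forall N (l u : 'cV[option int]_(nfold_dim nB N nA)) b
    (f : 'cV[R]_(nfold_dim nB N nA) -> R)
    (z : 'cV[int]_(nfold_dim nB N nA)) (r : 'cV[R]_(nfold_dim nB N nA)),
  let IP := @feasible int _ _ (nfold4 A B C D N) b l u in
  let CP := @feasible R _ _ (nfold4 A B C D N) b l u in
  separable_convex f -> IP z -> is_minimizer CP f r ->
  exists z', [/\ IP z', f (map_mx intr z') <= f (map_mx intr z)
    & forall i, `|r i 0 - (z' i 0)%:~R| <= (N.+2 ^ e)%N%:R].

(** Otherwise the exchange inequality for the rounding of [r - z] would improve
the real optimum [r]. *)
Theorem proximity : exists e, optima_within e.
Proof.
have [e rnd] := kernel_rounding A B C D; exists e => N l u b f z r IP CP cvx Iz [Cr rmin].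
have [a [Ma bet lea]] := rnd _ _ _ (diff_ker Iz Cr).
have bet' i : between (a i 0)%:~R (r i 0 - (z i 0)%:~R) by have := bet i; rewrite !mxE.
have [Iza Cra] := feasible_exchange Iz Cr Ma bet'.
exists (z + a); split=> //.
  have bet2 i : between (map_mx intr a i 0) (r i 0 - map_mx intr z i 0) by rewrite !mxE.
  have := rmin _ Cra; have := separable_exchange cvx bet2.
  have -> : map_mx intr (z + a) = map_mx intr z + map_mx intr a :> 'cV[R]__ by rewrite map_mxD.
  by lra.
by move=> i; have := lea i; rewrite !mxE rmorphD /= opprD addrA.
Qed.

(** A feasible [r] is [z0 + a + d] with [z0 + a] integer feasible and [d] bounded.
By the exchange inequality [f r] is at least
[f (z0 + a) + f (z0 + d) - f z0], and each term is bounded below. *)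
Theorem relaxation_bounded N (l u : 'cV[option int]_(nfold_dim nB N nA)) b
    (f : 'cV[R]_(nfold_dim nB N nA) -> R) (c : R) z0 :
  let IP := @feasible int _ _ (nfold4 A B C D N) b l u in
  let CP := @feasible R _ _ (nfold4 A B C D N) b l u in
  separable_convex f -> IP z0 -> (forall z, IP z -> `|f (map_mx intr z)| <= c) ->
  ~ unbounded CP f.
Proof.
move=> IP CP cvx Iz0 lec unb.
have [e rnd] := kernel_rounding A B C D.
have [c' lower_ok] := separable_lb cvx (map_mx intr z0) (N.+2 ^ e)%N%:R.
have [r Cr] := unb (c' - c - c).
have [a [Ma bet lea]] := rnd _ _ _ (diff_ker Iz0 Cr).
have bet' i : between (a i 0)%:~R (r i 0 - (z0 i 0)%:~R) by have := bet i; rewrite !mxE.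
have [Iza Cra] := feasible_exchange Iz0 Cr Ma bet'.
have bet2 i : between (map_mx intr a i 0) (r i 0 - map_mx intr z0 i 0) by rewrite !mxE.
have := separable_exchange cvx bet2.
have -> : map_mx intr z0 + map_mx intr a = map_mx intr (z0 + a) :> 'cV[R]__ by rewrite map_mxD.
have := lec _ Iza; have := lec _ Iz0; rewrite !ler_norml => /andP[_ h1] /andP[h2 _].
have lea2 i : `|(r - map_mx intr a - map_mx intr z0) i 0| <= (N.+2 ^ e)%N%:R.
  by have := lea i; rewrite !mxE addrAC.
have := lower_ok _ lea2.
have -> : map_mx intr z0 + (r - map_mx intr a - map_mx intr z0) = r - map_mx intr a.
  by rewrite addrC subrK.
by lra.
Qed.
End Proximity.

(** * Polynomial-time functions on encoded data *)

Local Open Scope nat_scope.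

Notation tree := Defs.val.

(** A structure, so that unification finds the encoding of nested pairs, lists and
options. *)
Structure encType := EncType { enc_sort :> Type; enc : enc_sort -> tree }.
Arguments enc {e} x : rename.

Canonical tree_encType := EncType (@id tree).
Canonical int_encType := EncType VInt.
Canonical nat_encType := EncType (fun n : nat => VInt n%:Z).
Canonical bool_encType := EncType vbool.
Canonical rat_encType := EncType enc_rat.
Canonical pair_encType (T U : encType) :=
  EncType (fun p : T * U => VPair (enc p.1) (enc p.2)).
Canonical seq_encType (T : encType) :=
  EncType (fun s : seq T => foldr VPair (VInt 0) (map enc s)).
Canonical option_encType (T : encType) :=
  EncType (fun o : option T => if o is Some x then VPair (VInt 0) (enc x) else VInt 0).

Lemma int_size_le z e : `|z|%N < 2 ^ e -> int_size z <= e.+1.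
Proof. by move=> h; rewrite /int_size ltnS; apply: up_log_min. Qed.

Lemma int_size_gt z : `|z|%N < 2 ^ (int_size z).-1.
Proof. exact: up_logP. Qed.

Lemma int_size_mono (x y : int) : `|x|%N <= `|y|%N -> int_size x <= int_size y.
Proof.
move=> le; rewrite -[int_size y]prednK //; apply: int_size_le.
exact: leq_ltn_trans le (int_size_gt _).
Qed.

Lemma int_sizeD x y : int_size (x + y)%R <= int_size x + int_size y.
Proof.
have := int_size_gt x; have := int_size_gt y => hy hx.
apply: leq_trans (int_size_le (e := (int_size x).-1 + (int_size y).-1) _) _.
  rewrite expnD; apply: (@leq_trans (`|x|.+1 * `|y|.+1)); last exact: leq_mul.
  by nia.
by rewrite /int_size; lia.
Qed.

Lemma int_sizeB x y : int_size (x - y)%R <= int_size x + int_size y.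
Proof. by rewrite -[int_size y](_ : int_size (- y)%R = _) ?int_sizeD // /int_size abszN. Qed.

Lemma int_sizeM x y : int_size (x * y)%R <= int_size x + int_size y.
Proof.
have := int_size_gt x; have := int_size_gt y => hy hx.
apply: leq_trans (int_size_le (e := (int_size x).-1 + (int_size y).-1) _) _.
  rewrite expnD abszM; apply: (@leq_trans (`|x|.+1 * `|y|.+1)); last exact: leq_mul.
  by nia.
by rewrite /int_size; lia.
Qed.

Lemma int_size_div x y : int_size (x %/ y)%Z <= int_size x + int_size y.
Proof.
apply: leq_trans _ (leq_addr _ _); apply: int_size_mono.
case: (eqVneq y 0%R) => [->|y0]; first by rewrite divz0.
have := divz_eq x y; have := modz_ge0 x y0; have := ltz_mod x y0.
set q := (x %/ y)%Z; set r := (x %% y)%Z => h1 h2 h3.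
have : (1 <= `|y|)%R by lia.
by nia.
Qed.

Lemma val_size_gt0 v : 0 < val_size v.
Proof. by case: v. Qed.

Section PolynomialTime.
Variables (Ctx : Type) (msize : Ctx -> nat) (ev cp : Ctx -> tree -> tree -> Prop).

(** One size [msize k] for the whole instance [k]; the powers of [(msize k).+2]
absorb constants, sums, products and powers. *)
Definition pbounded (I : Type) (D : Ctx -> I -> Prop) (x : Ctx -> I -> nat) : Prop :=
  exists c, forall k i, D k i -> x k i <= (msize k).+2 ^ c.

Section Pbd.
Variables (I : Type) (D : Ctx -> I -> Prop).
Implicit Types x y : Ctx -> I -> nat.

Lemma pbounded_le x y : pbounded D y -> (forall k i, D k i -> x k i <= y k i) -> pbounded D x.
Proof. by move=> [c yc] xy; exists c => k i Di; apply: leq_trans (xy _ _ Di) (yc _ _ Di). Qed.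

Lemma pbounded_cst c : pbounded D (fun _ _ => c).
Proof. by exists c => k i _; apply: leq_const_exp. Qed.

Lemma pbounded_sz : pbounded D (fun k _ => msize k).
Proof. by exists 1 => k i _; rewrite expn1; lia. Qed.

Lemma pboundedM x y : pbounded D x -> pbounded D y -> pbounded D (fun k i => x k i * y k i).
Proof.
move=> [c xc] [d yd]; exists (c + d) => k i Di.
by rewrite expnD leq_mul ?xc ?yd.
Qed.

Lemma pboundedD x y : pbounded D x -> pbounded D y -> pbounded D (fun k i => x k i + y k i).
Proof.
move=> [c xc] [d yd]; exists (c + d).+1 => k i Di.
have := xc _ _ Di; have := yd _ _ Di; rewrite expnS expnD.
have : 0 < (msize k).+2 ^ c by rewrite expn_gt0.
have : 0 < (msize k).+2 ^ d by rewrite expn_gt0.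
by nia.
Qed.

Lemma pboundedS x : pbounded D x -> pbounded D (fun k i => (x k i).+1).
Proof. by move=> px; apply: pbounded_le (pboundedD px (pbounded_cst 1)) _ => k i _;
  rewrite addn1. Qed.

Lemma pboundedX x e : pbounded D x -> pbounded D (fun k i => x k i ^ e).
Proof.
move=> [c xc]; exists (c * e) => k i Di.
by rewrite expnM leq_exp2r_weak ?xc.
Qed.

Lemma pbounded_sub (D' : Ctx -> I -> Prop) x :
  pbounded D x -> (forall k i, D' k i -> D k i) -> pbounded D' x.
Proof. by move=> [c xc] DD'; exists c => k i /DD'; apply: xc. Qed.
End Pbd.

Lemma pbounded_comp I I' (D : Ctx -> I -> Prop) (D' : Ctx -> I' -> Prop) (g : Ctx -> I' -> I) x :
  pbounded D x -> (forall k i, D' k i -> D k (g k i)) -> pbounded D' (fun k i => x k (g k i)).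
Proof. by move=> [c xc] DD'; exists c => k i /DD'; apply: xc. Qed.

Definition enc_size (T : encType) (x : T) := val_size (enc x).
Arguments enc_size : simpl never.

Section Ptime.
Context (X Y : encType).

(** The domain [D] may depend on the instance. Since it forces the arguments to
be polynomially small ([ptime_in]), composition needs no composition of
polynomials. *)
Definition ptime (D : Ctx -> X -> Prop) (F : Ctx -> X -> Y) : Prop :=
  exists (P : prog) (tau : Ctx -> X -> nat), pbounded D tau /\
  forall k x, D k x ->
  exists2 t, run (ev k) (cp k) P (enc x) (enc (F k x)) t & t <= tau k x.
End Ptime.

Definition small (X : encType) (D : Ctx -> X -> Prop) : Prop :=
  pbounded D (fun _ x => enc_size x).

Lemma run_size e c P v w t : run e c P v w t -> val_size v <= t /\ val_size w <= t.
Proof. by elim=> /=; intros; lia. Qed.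

Section Closure.
Context (X : encType) (D : Ctx -> X -> Prop).

Lemma ptime_in (Y : encType) (F : Ctx -> X -> Y) : ptime D F -> small D.
Proof.
move=> [P [tau [ptau HP]]]; apply: pbounded_le ptau _ => k x Dx.
by have [t /run_size[le1 _] /(leq_trans le1)] := HP k x Dx.
Qed.

Lemma ptime_out (Y : encType) (F : Ctx -> X -> Y) :
  ptime D F -> pbounded D (fun k x => enc_size (F k x)).
Proof.
move=> [P [tau [ptau HP]]]; apply: pbounded_le ptau _ => k x Dx.
by have [t /run_size[_ le2] /(leq_trans le2)] := HP k x Dx.
Qed.

(** Programs see only encodings, so a function may change its types as long as
its encoded arguments and values stay the same. *)
Lemma ptime_cast (Y Z : encType) (F : Ctx -> X -> Y) (G : Ctx -> X -> Z) :
  ptime D F -> (forall k x, D k x -> enc (F k x) = enc (G k x)) -> ptime D G.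
Proof.
move=> [P [tau [ptau HP]]] FG; exists P, tau; split=> // k x Dx.
by rewrite -FG //; apply: HP.
Qed.

Lemma ptime_eq (Y : encType) (F G : Ctx -> X -> Y) :
  ptime D F -> (forall k x, D k x -> F k x = G k x) -> ptime D G.
Proof. by move=> pF FG; apply: ptime_cast pF _ => k x Dx; rewrite FG. Qed.

Lemma ptime_weak (Y : encType) (D' : Ctx -> X -> Prop) (F : Ctx -> X -> Y) :
  ptime D' F -> (forall k x, D k x -> D' k x) -> ptime D F.
Proof.
move=> [P [tau [ptau HP]]] DD'; exists P, tau; split; first exact: pbounded_sub ptau DD'.
by move=> k x /DD'; apply: HP.
Qed.

Lemma ptime_prim (Y Z : encType) (F : Ctx -> X -> Y) (G : Ctx -> X -> Z) Q :
  ptime D F -> (forall k x, D k x -> prim Q (enc (F k x)) (enc (G k x))) ->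
  pbounded D (fun k x => enc_size (G k x)) -> ptime D G.
Proof.
move=> pF QP pG; have pFs := ptime_out pF; case: pF => P [tau [ptau HP]].
exists (PSeq P Q), (fun k x => (tau k x + (enc_size (F k x) + enc_size (G k x)).+1).+1); split.
  by apply: pboundedS; apply: pboundedD ptau _; apply: pboundedS; apply: pboundedD.
move=> k x Dx; have [t rt let_] := HP k x Dx; eexists.
  apply: run_seq rt _; apply: run_prim; exact: QP.
by rewrite /enc_size; lia.
Qed.

Lemma ptime_comp (Y Z : encType) (D2 : Ctx -> Y -> Prop)
    (F : Ctx -> X -> Y) (G : Ctx -> Y -> Z) :
  ptime D2 G -> ptime D F -> (forall k x, D k x -> D2 k (F k x)) ->
  ptime D (fun k x => G k (F k x)).
Proof.
move=> [Q [tau [ptau HQ]]] [P [tau' [ptau' HP]]] DD2.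
exists (PSeq P Q), (fun k x => (tau' k x + tau k (F k x)).+1); split.
  by apply: pboundedS; apply: pboundedD ptau' _; apply: (pbounded_comp ptau DD2).
move=> k x Dx; have [t rt let_] := HP k x Dx; have [t' rt' let'] := HQ k _ (DD2 _ _ Dx).
by eexists; [apply: run_seq rt rt' | lia].
Qed.

Lemma ptime_id : small D -> ptime D (fun _ x => x).
Proof.
move=> sD; exists PId, (fun _ x => (enc_size x + enc_size x).+1); split.
  by apply: pboundedS; apply: pboundedD.
by move=> k x Dx; eexists; [apply: run_prim; apply: prim_id |].
Qed.

Lemma ptime_cst (Y : encType) (y : Y) : small D -> ptime D (fun _ _ => y).
Proof.
move=> sD; suff cstP (w : tree) : exists P (tau : Ctx -> X -> nat), pbounded D tau /\ forall k x,
  D k x ->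
    exists2 t, run (ev k) (cp k) P (@enc X x) w t & t <= tau k x by apply: cstP.
elim: w => [z|v [P [tau [ptau HP]]] w [Q [tau' [ptau' HQ]]]].
  exists (PConst z), (fun _ x => (enc_size x + int_size z).+1); split.
    by apply: pboundedS; apply: pboundedD sD (pbounded_cst _ _).
  by move=> k x Dx; eexists; [apply: run_prim; apply: prim_const | ].
exists (PPair P Q), (fun k x => (enc_size x + tau k x + tau' k x).+1); split.
  by apply: pboundedS; apply: pboundedD ptau'; apply: pboundedD.
move=> k x Dx; have [t rt let_] := HP k x Dx; have [t' rt' let'] := HQ k x Dx.
by eexists; [apply: run_pair rt rt' | rewrite /enc_size; lia].
Qed.

Lemma ptime_pair (Y Z : encType) (F : Ctx -> X -> Y) (G : Ctx -> X -> Z) :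
  ptime D F -> ptime D G -> ptime D (fun k x => (F k x, G k x)).
Proof.
move=> pF; have sD := ptime_in pF; case: pF => P [tau [ptau HP]] [Q [tau' [ptau' HQ]]].
exists (PPair P Q), (fun k x => (enc_size x + tau k x + tau' k x).+1); split.
  by apply: pboundedS; apply: pboundedD ptau'; apply: pboundedD.
move=> k x Dx; have [t rt let_] := HP k x Dx; have [t' rt' let'] := HQ k x Dx.
by eexists; [apply: run_pair rt rt' | rewrite /enc_size; lia].
Qed.

Lemma ptime_fst (Y Z : encType) (F : Ctx -> X -> Y * Z) :
  ptime D F -> ptime D (fun k x => (F k x).1).
Proof.
move=> pF; apply: (ptime_prim (Q := PFst) pF); first by move=> k x _; apply: prim_fst.
by apply: pbounded_le (ptime_out pF) _ => k x _; rewrite /enc_size /=; lia.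
Qed.

Lemma ptime_snd (Y Z : encType) (F : Ctx -> X -> Y * Z) :
  ptime D F -> ptime D (fun k x => (F k x).2).
Proof.
move=> pF; apply: (ptime_prim (Q := PSnd) pF); first by move=> k x _; apply: prim_snd.
by apply: pbounded_le (ptime_out pF) _ => k x _; rewrite /enc_size /=; lia.
Qed.

Lemma ptime_add (F G : Ctx -> X -> int) : ptime D F -> ptime D G ->
  ptime D (fun k x => (F k x + G k x)%R).
Proof.
move=> pF pG; apply: (ptime_prim (Q := PAdd) (ptime_pair pF pG)).
  by move=> k x _; apply: prim_add.
by apply: pbounded_le (pboundedD (ptime_out pF) (ptime_out pG)) _ => k x _; apply: int_sizeD.
Qed.

Lemma ptime_sub (F G : Ctx -> X -> int) : ptime D F -> ptime D G ->
  ptime D (fun k x => (F k x - G k x)%R).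
Proof.
move=> pF pG; apply: (ptime_prim (Q := PSub) (ptime_pair pF pG)).
  by move=> k x _; apply: prim_sub.
by apply: pbounded_le (pboundedD (ptime_out pF) (ptime_out pG)) _ => k x _; apply: int_sizeB.
Qed.

Lemma ptime_mul (F G : Ctx -> X -> int) : ptime D F -> ptime D G ->
  ptime D (fun k x => (F k x * G k x)%R).
Proof.
move=> pF pG; apply: (ptime_prim (Q := PMul) (ptime_pair pF pG)).
  by move=> k x _; apply: prim_mul.
by apply: pbounded_le (pboundedD (ptime_out pF) (ptime_out pG)) _ => k x _; apply: int_sizeM.
Qed.

Lemma ptime_div (F G : Ctx -> X -> int) : ptime D F -> ptime D G ->
  ptime D (fun k x => (F k x %/ G k x)%Z).
Proof.
move=> pF pG; apply: (ptime_prim (Q := PDiv) (ptime_pair pF pG)).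
  by move=> k x _; apply: prim_div.
by apply: pbounded_le (pboundedD (ptime_out pF) (ptime_out pG)) _ => k x _; apply: int_size_div.
Qed.

Lemma pbounded_bool (F : Ctx -> X -> bool) : pbounded D (fun k x => enc_size (F k x)).
Proof. by apply: pbounded_le (pbounded_cst D (int_size 1)) _ => k x _; case: (F k x). Qed.

Lemma ptime_le (F G : Ctx -> X -> int) : ptime D F -> ptime D G ->
  ptime D (fun k x => (F k x <= G k x)%R).
Proof.
move=> pF pG; apply: (ptime_prim (Q := PLe) (ptime_pair pF pG)); last exact: pbounded_bool.
by move=> k x _; apply: prim_le.
Qed.

Definition is_leaf (v : tree) := if v is VInt _ then true else false.

Lemma ptime_isleaf (Y : encType) (F : Ctx -> X -> Y) : ptime D F ->
  ptime D (fun k x => is_leaf (enc (F k x))).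
Proof.
move=> pF; apply: (ptime_prim (Q := PIsInt) pF); last exact: pbounded_bool.
by move=> k x _; apply: prim_isint.
Qed.

End Closure.

Lemma ptime_if (X : encType) (D : Ctx -> X -> Prop) (Y : encType)
   (b : Ctx -> X -> bool) (F G : Ctx -> X -> Y) :
  ptime D b -> (small D -> ptime (fun k x => D k x /\ b k x) F) ->
  (small D -> ptime (fun k x => D k x /\ ~~ b k x) G) ->
  ptime D (fun k x => if b k x then F k x else G k x).
Proof.
move=> pb; have sD := ptime_in pb =>
  /(_ sD)[P1 [t1 [[c1 pt1] HP1]]] /(_ sD)[P2 [t2 [[c2 pt2] HP2]]].
case: pb => P [tau [ptau HP]].
exists (PIf P P1 P2), (fun k x => (enc_size x + tau k x + (msize k).+2 ^ (c1 + c2)).+1); split.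
  apply: pboundedS; apply: pboundedD; first by apply: pboundedD.
  by exists (c1 + c2).
have sub k c d : (msize k).+2 ^ c <= (msize k).+2 ^ (c + d) by rewrite leq_pexp2l // leq_addr.
move=> k x Dx; have [t rt let_] := HP k x Dx.
have [bx|bx] := boolP (b k x).
  have [t' rt' let'] := HP1 k x (conj Dx bx); rewrite bx in rt; eexists.
    exact: (@run_if _ _ P P1 P2 _ 1%Z _ _ _ rt rt').
  have := pt1 k x (conj Dx bx); have := sub k c1 c2; rewrite /enc_size; lia.
have [t' rt' let'] := HP2 k x (conj Dx bx); rewrite (negbTE bx) in rt; eexists.
  exact: (@run_if _ _ P P1 P2 _ 0%Z _ _ _ rt rt').
have := pt2 k x (conj Dx bx); have := sub k c2 c1; rewrite /enc_size (addnC c2); lia.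
Qed.

(** [F] is the function computed by the loop and [m] a variant for it. *)
Lemma ptime_while (X : encType) (D : Ctx -> X -> Prop) (b : Ctx -> X -> bool)
   (g F : Ctx -> X -> X) (m : Ctx -> X -> nat) :
  ptime D b -> ptime (fun k x => D k x /\ b k x) g -> pbounded D m ->
  (forall k x, D k x -> b k x ->
     [/\ D k (g k x), m k (g k x) < m k x & F k x = F k (g k x)]) ->
  (forall k x, D k x -> ~~ b k x -> F k x = x) ->
  ptime D F.
Proof.
move=> pb [Q [tq [[cq ptq] HQ]]] pm step stop; have [cs sD] := ptime_in pb.
case: pb => P [tp [[cp' ptp] HP]].
pose T k := ((msize k).+2 ^ cs + (msize k).+2 ^ cp' + (msize k).+2 ^ cq).+1.
exists (PWhile P Q), (fun k x => (m k x).+1 * T k); split.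
  apply: pboundedM; first exact: pboundedS.
  apply: pboundedS; apply: pboundedD; first apply: pboundedD.
  - by exists cs.
  - by exists cp'.
  - by exists cq.
move=> k x; have [n] := ubnP (m k x); elim: n x => // n IH x ltn Dx.
have [t rt let_] := HP k x Dx; have sx := sD k x Dx; have tx := ptp k x Dx.
have [bx|bx] := boolP (b k x); last first.
  rewrite stop //; rewrite (negbTE bx) in rt; eexists; first exact: run_while_stop rt.
  by rewrite /enc_size in sx; rewrite /T; nia.
have [Dg mg ->] := step _ _ Dx bx.
have [t' rt' let'] := HQ k x (conj Dx bx); have tx' := ptq k x (conj Dx bx).
have [||t3 rt3 let3] := IH (g k x) => //; first exact: leq_trans mg _.
rewrite bx in rt; eexists; first exact: run_while_step rt _ rt' rt3.
apply: (@leq_trans (T k + (m k (g k x)).+1 * T k)).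
  by rewrite /enc_size in sx; rewrite {1}/T; lia.
by rewrite -mulSn leq_mul2r; apply/orP; right.
Qed.

End PolynomialTime.

(** * Polynomial-time list operations *)

Section Sizes.
Context (X Y : encType).
Implicit Types (s t : seq X).

Lemma enc_size_gt0 (x : X) : 0 < enc_size x. Proof. exact: val_size_gt0. Qed.

Lemma enc_size_pair (x : X) (y : Y) : enc_size (x, y) = (enc_size x + enc_size y).+1.
Proof. by []. Qed.

Lemma enc_size_nil : enc_size ([::] : seq X) = 1.
Proof. by []. Qed.

Lemma enc_size_cons x s : enc_size (x :: s) = (enc_size x + enc_size s).+1.
Proof. by []. Qed.

Lemma enc_size_cat s t : (enc_size (s ++ t)).+1 = enc_size s + enc_size t.
Proof. by elim: s => [|x s IH]; rewrite ?enc_size_nil // cat_cons !enc_size_cons; lia. Qed.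

Lemma enc_size_rev s : enc_size (rev s) = enc_size s.
Proof.
elim: s => // x s IH; rewrite rev_cons -cats1 enc_size_cons.
by have := enc_size_cat (rev s) [:: x]; rewrite enc_size_cons enc_size_nil; lia.
Qed.

Lemma size_enc_size s : size s < enc_size s.
Proof. by elim: s => // x s IH; rewrite enc_size_cons /=; have := enc_size_gt0 x; lia. Qed.

Lemma enc_size_mem x s : List.In x s -> enc_size x < enc_size s.
Proof. by elim: s => // y s IH [->|/IH]; rewrite enc_size_cons; lia. Qed.

Lemma enc_size_seq_le s b : (forall x, List.In x s -> enc_size x <= b) ->
  enc_size s <= (size s * b.+1).+1.
Proof.
elim: s => // x s IH H; rewrite enc_size_cons /=.
have := H x (or_introl erefl); have := IH (fun y ys => H y (or_intror ys)).
by rewrite mulSn; lia.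
Qed.
End Sizes.

Lemma enc_size_flatten (X : encType) (ss : seq (seq X)) :
  enc_size (flatten ss) <= enc_size ss.
Proof.
elim: ss => // s ss IH /=; rewrite enc_size_cons.
by have := enc_size_cat s (flatten ss); lia.
Qed.

Lemma In_mem (T : eqType) (x : T) s : List.In x s <-> x \in s.
Proof.
elim: s => // y s IH /=; rewrite inE; split.
  by case=> [->|/IH->]; rewrite ?eqxx ?orbT.
by case/predU1P => [->|/IH]; [left | right].
Qed.

Section ListPrograms.
Variables (Ctx : Type) (msize : Ctx -> nat) (ev cp : Ctx -> tree -> tree -> Prop).
Local Notation pt D F := (ptime msize ev cp D F).
Local Notation pbounded D x := (pbounded msize D x).
Local Notation small D := (small msize D).

Lemma small_body (X Y : encType) (D : Ctx -> X -> Prop)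
    (s : Ctx -> X -> seq Y) : pt D s ->
  small (fun k (p : X * Y) => D k p.1 /\ List.In p.2 (s k p.1)).
Proof.
move=> ps; have [c sD] := ptime_in ps; have [d sd] := ptime_out ps.
exists (c + d).+1 => k [x y] /= [Dx /enc_size_mem ys]; rewrite enc_size_pair.
have := sD k x Dx; have := sd k x Dx; rewrite expnS expnD.
have : 0 < (msize k).+2 ^ c by rewrite expn_gt0.
have : 0 < (msize k).+2 ^ d by rewrite expn_gt0.
by nia.
Qed.

Section Basic.
Context (X : encType) (D : Ctx -> X -> Prop).

Lemma ptime_not (b : Ctx -> X -> bool) : pt D b -> pt D (fun k x => ~~ b k x).
Proof.
move=> pb; apply: (ptime_eq (F := fun k x => if b k x then false else true)).
  by apply: ptime_if pb _ _ => sD; apply: ptime_cst; apply: pbounded_sub sD _ => k x [].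
by move=> k x _; case: (b k x).
Qed.

Lemma ptime_and (b c : Ctx -> X -> bool) : pt D b ->
  pt (fun k x => D k x /\ b k x) c -> pt D (fun k x => b k x && c k x).
Proof.
move=> pb pc; apply: (ptime_eq (F := fun k x => if b k x then c k x else false)) => //.
by apply: ptime_if pb _ _ => sD //; apply: ptime_cst; apply: pbounded_sub sD _ => k x [].
Qed.

Lemma ptime_eqz (F G : Ctx -> X -> int) : pt D F -> pt D G -> pt D (fun k x => F k x == G k x).
Proof.
move=> pF pG; apply: (ptime_eq (F := fun k x => (F k x <= G k x)%R && (G k x <= F k x)%R)).
  apply: ptime_and; first exact: ptime_le.
  by apply: ptime_weak (ptime_le pG pF) _ => k x [].
by move=> k x _; rewrite -eq_le.
Qed.

Section Seq.
Context (Y : encType).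

Lemma ptime_cons (F : Ctx -> X -> Y) (G : Ctx -> X -> seq Y) :
  pt D F -> pt D G -> pt D (fun k x => F k x :: G k x).
Proof. by move=> pF pG; apply: (ptime_cast (ptime_pair pF pG)). Qed.

Lemma ptime_nilp (F : Ctx -> X -> seq Y) : pt D F -> pt D (fun k x => nilp (F k x)).
Proof. by move=> pF; apply: (ptime_eq (ptime_isleaf pF)) => k x _; case: (F k x). Qed.

Lemma ptime_uncons y0 (F : Ctx -> X -> seq Y) : pt D F -> (forall k x, D k x -> ~~ nilp (F k x)) ->
  pt D (fun k x => (head y0 (F k x), behead (F k x))).
Proof. by move=> pF ne; apply: (ptime_cast pF) => k x /ne; case: (F k x). Qed.

End Seq.
End Basic.

Section HeadBehead.
Context (X : encType) (D : Ctx -> X -> Prop) (Y : encType).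

Lemma ptime_head (y0 : Y) (F : Ctx -> X -> seq Y) : pt D F -> pt D (fun k x => head y0 (F k x)).
Proof.
move=> pF; apply: (ptime_eq (F := fun k x =>
  if nilp (F k x) then y0 else (head y0 (F k x), behead (F k x)).1)).
  apply: ptime_if; first exact: ptime_nilp.
    by move=> sD; apply: ptime_cst; apply: pbounded_sub sD _ => k x [].
  move=> sD; apply: ptime_fst; apply: ptime_uncons; last by move=> k x [].
  by apply: ptime_weak pF _ => k x [].
by move=> k x _ /=; case: (F k x).
Qed.

Lemma ptime_behead (F : Ctx -> X -> seq Y) : pt D F -> pt D (fun k x => behead (F k x)).
Proof.
move=> pF.
apply: (ptime_eq (F := fun k x => if nilp (F k x) then [::] else behead (F k x))).
  apply: ptime_if; first exact: ptime_nilp.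
    by move=> sD; apply: ptime_cst; apply: pbounded_sub sD _ => k x [].
  move=> sD.
  apply: (ptime_prim (Q := PSnd) (ptime_weak pF _)) => [k x []//|k x [Dx]|].
    by case: (F k x) => // y s _; apply: prim_snd.
  apply: pbounded_le (pbounded_sub (ptime_out pF) _) _ => [k x []|k x _]; first by [].
  by case: (F k x) => // y s; rewrite enc_size_cons /=; lia.
by move=> k x _; case: (F k x).
Qed.
End HeadBehead.

Section Foldl.
Context (X Y A : encType).
Variables (D : Ctx -> X -> Prop) (y0 : Y) (s : Ctx -> X -> seq Y) (a0 : Ctx -> X -> A).
Variable (st : Ctx -> X -> A -> Y -> A).

Let acc k x := foldl (st k x) (a0 k x).

(** The loop state consists of the environment, the remaining list and the
accumulator. The growth of the accumulator cannot be bounded in general and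
is a hypothesis on all prefixes; the domain of [st] is what these prefixes
reach. *)
Lemma ptime_foldl :
  pt D s -> pt D a0 ->
  pbounded (fun k (p : X * seq Y) => D k p.1 /\ exists post, s k p.1 = p.2 ++ post)
    (fun k p => enc_size (foldl (st k p.1) (a0 k p.1) p.2)) ->
  let DB := fun k (p : X * (Y * A)) => D k p.1 /\ exists pre post,
     s k p.1 = pre ++ p.2.1 :: post /\ p.2.2 = foldl (st k p.1) (a0 k p.1) pre in
  (small DB -> pt DB (fun k p => st k p.1 p.2.2 p.2.1)) ->
  pt D (fun k x => foldl (st k x) (a0 k x) (s k x)).
Proof.
move=> ps pa bnd DB pst; have sD := ptime_in ps.
pose DZ k (z : X * (seq Y * A)) :=
  D k z.1 /\ exists2 pre, s k z.1 = pre ++ z.2.1 & z.2.2 = acc k z.1 pre.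
have sDZ : small DZ.
  have [c1 H1] := sD; have [c2 H2] := ptime_out ps; have [c3 H3] := bnd.
  apply: pbounded_le (_ : pbounded _ (fun k _ =>
    ((msize k).+2 ^ c1 + ((msize k).+2 ^ c2 + (msize k).+2 ^ c3).+1).+1)) _.
    by do ![apply: pboundedS | apply: pboundedD]; [exists c1|exists c2|exists c3].
  move=> k [x [post a]] [/= Dx [pre sE ->]]; rewrite !enc_size_pair.
  have := H1 k x Dx; have := H2 k x Dx; have := H3 k (x, pre) (conj Dx (ex_intro _ post sE)).
  rewrite sE /= /acc; have := enc_size_cat pre post; have := enc_size_gt0 pre; lia.
pose F k (z : X * (seq Y * A)) : X * (seq Y * A) := (z.1, ([::], foldl (st k z.1) z.2.2 z.2.1)).
suff pF : pt DZ F.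
  have pin : pt D (fun k x => (x, (s k x,
    a0 k x))) by apply: ptime_pair (ptime_id _ _ sD) (ptime_pair ps pa).
  have pc := ptime_comp pF pin.
  apply: (ptime_snd (ptime_snd (pc _))) => k x Dx; split=> //=; by exists [::].
pose b (k : Ctx) (z : X * (seq Y * A)) := ~~ nilp z.2.1.
pose g k (z : X * (seq Y * A)) := (z.1, (behead z.2.1, st k z.1 z.2.2 (head y0 z.2.1))).
have pz := ptime_id ev cp sDZ.
apply: (ptime_while (b := b) (g := g) (m := fun _ z => size z.2.1)).
- exact: ptime_not (ptime_nilp (ptime_fst (ptime_snd pz))).
- have pz' : pt (fun k z => DZ k z /\ b k z) (fun _ z => z) by apply: ptime_weak pz _ => k z [].
  have sDB : small DB.
    have [c1 H1] := sDZ; exists c1 => k [x [y a]] [/= Dx [pre [post [sE aE]]]].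
    have DZx : DZ k (x, (y :: post, a)) by split=> //=; exists pre.
    have := H1 _ _ DZx; rewrite !enc_size_pair enc_size_cons /=; lia.
  have pb := pst sDB.
  apply: ptime_pair (ptime_fst pz') (ptime_pair (ptime_behead (ptime_fst (ptime_snd pz'))) _).
  have pi : pt (fun k z => DZ k z /\ b k z) (fun k (z : X * (seq Y * A)) =>
    (z.1, (head y0 z.2.1, z.2.2))).
    exact: ptime_pair (ptime_fst pz') (ptime_pair (ptime_head _ (ptime_fst (ptime_snd pz')))
      (ptime_snd (ptime_snd pz'))).
  apply: (ptime_comp pb pi) => k [x [[|y post] a]]; first by case.
  by move=> [[/= Dx [pre sE aE]] _]; split=> //=; exists pre, post.
- apply: pbounded_le sDZ _ => k [x [post a]] _ /=; rewrite !enc_size_pair.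
  by have := size_enc_size post; lia.
- move=> k [x [[|y post] a]] [/= Dx [pre sE aE]] bz; first by [].
  split=> //; split=> //=.
  by exists (rcons pre y); rewrite ?cat_rcons // /acc foldl_rcons -/(acc _ _ _) aE.
- by move=> k [x [[|y post] a]] //= _ _; rewrite /F.
Qed.
End Foldl.

Section Lists.
Context (X : encType) (D : Ctx -> X -> Prop).

Lemma foldl_catrev T (s t : seq T) : foldl (fun a x => x :: a) t s = catrev s t.
Proof. by elim: s t => //= x s IH t. Qed.

Section OneType.
Context (Y : encType) (y0 : Y).

Lemma ptime_catrev (s t : Ctx -> X -> seq Y) : pt D s -> pt D t ->
  pt D (fun k x => catrev (s k x) (t k x)).
Proof.
move=> ps pt_; apply: (ptime_eq (F := fun k x => foldl (fun a x => x :: a) (t k x) (s k x)));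
  last first.
  by move=> k x _; rewrite foldl_catrev.
apply: (ptime_foldl y0 ps pt_).
  have [c1 H1] := ptime_out ps; have [c2 H2] := ptime_out pt_.
  apply: pbounded_le (_ : pbounded _ (fun k _ => ((msize k).+2 ^ c1 + (msize k).+2 ^ c2))) _.
    by apply: pboundedD; [exists c1|exists c2].
  move=> k [x pre] [/= Dx [post sE]]; rewrite foldl_catrev catrevE.
  have := H1 k x Dx; have := H2 k x Dx; rewrite sE.
  have := enc_size_cat (rev pre) (t k x); have := enc_size_cat pre post; rewrite enc_size_rev;
    have := enc_size_gt0 post.
  by lia.
move=> sDB; have pz := ptime_id ev cp sDB.
exact: ptime_cons (ptime_fst (ptime_snd pz)) (ptime_snd (ptime_snd pz)).
Qed.

Lemma ptime_rev (s : Ctx -> X -> seq Y) : pt D s -> pt D (fun k x => rev (s k x)).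
Proof.
move=> ps; apply: (ptime_eq (ptime_catrev ps (ptime_cst _ _ ([::] : seq Y) (ptime_in ps)))) =>
  k x _.
by rewrite catrevE cats0.
Qed.

End OneType.
End Lists.

Section MapFlatten.
Context (X : encType) (D : Ctx -> X -> Prop).

Lemma ptime_map (Y Z : encType) (y0 : Y) (z0 : Z)
   (s : Ctx -> X -> seq Y) (f : Ctx -> X -> Y -> Z) :
  pt D s ->
  let DB := fun k (p : X * Y) => D k p.1 /\ List.In p.2 (s k p.1) in
  (small DB -> pt DB (fun k p => f k p.1 p.2)) ->
  pt D (fun k x => map (f k x) (s k x)).
Proof.
move=> ps DB pf'; have {pf'}pf := pf' (small_body ps).
have foldlE k x pre : foldl (fun a y => f k x y :: a) [::] pre = rev (map (f k x) pre).
  elim/last_ind: pre => // pre y IH; rewrite foldl_rcons IH map_rcons rev_rcons //.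
apply: (ptime_eq (F := fun k x => rev (foldl (fun a y => f k x y :: a) [::] (s k x)))); last first.
  by move=> k x _; rewrite foldlE revK.
apply: (ptime_rev z0); apply: (ptime_foldl (st := fun k x a y => f k x y :: a) y0 ps).
- exact: ptime_cst (ptime_in ps).
- have [c1 H1] := ptime_out ps; have [c2 H2] := ptime_out pf.
  apply: pbounded_le (_ : pbounded _ (fun k _ =>
    ((msize k).+2 ^ c1 * ((msize k).+2 ^ c2).+1).+1)) _.
    by do ![apply: pboundedS | apply: pboundedM]; [exists c1|exists c2].
  move=> k [x pre] [/= Dx [post sE]]; rewrite foldlE enc_size_rev.
  apply: leq_trans (enc_size_seq_le (b := (msize k).+2 ^ c2) _) _.
    move=> z /List.in_map_iff[y [<- ypre]]; apply: (H2 k (x, y)); split=> //=.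
    by rewrite sE; apply/List.in_app_iff; left.
  rewrite size_map ltnS leq_mul2r; apply/orP; right.
  apply: leq_trans (H1 k x Dx); have := size_enc_size (s k x); rewrite sE size_cat; lia.
move=> sDB'; have pz := ptime_id ev cp sDB'.
apply: ptime_cons (ptime_snd (ptime_snd pz)).
have pi := ptime_pair (ptime_fst pz) (ptime_fst (ptime_snd pz)).
apply: (ptime_comp pf pi) => k [x [y a]] [/= Dx [pre [post [sE aE]]]]; split=> //=.
by rewrite sE; apply/List.in_app_iff; right; left.
Qed.

Lemma ptime_flatten (Y : encType) (y0 : Y) (s : Ctx -> X -> seq (seq Y)) :
  pt D s -> pt D (fun k x => flatten (s k x)).
Proof.
move=> ps.
have foldlE pre : foldl (fun (a y : seq Y) => catrev y a) [::] pre = rev (flatten pre).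
  elim/last_ind: pre => // pre y IH; rewrite foldl_rcons IH.
  by rewrite -cats1 flatten_cat rev_cat /= cats0 catrevE.
apply: (ptime_eq (F := fun k x => rev (foldl (fun (a y : seq Y) => catrev y a) [::] (s k x))));
  last first.
  by move=> k x _; rewrite foldlE revK.
apply: (ptime_rev y0); apply: (ptime_foldl (st := fun k x (a y : seq Y) => catrev y a) [::] ps).
- exact: ptime_cst (ptime_in ps).
- have [c1 H1] := ptime_out ps; exists c1 => k [x pre] [/= Dx [post sE]].
  rewrite foldlE enc_size_rev; apply: leq_trans (H1 k x Dx); rewrite sE.
  apply: leq_trans (enc_size_flatten pre) _.
  by rewrite -ltnS (enc_size_cat pre post) -addn1 leq_add2l enc_size_gt0.
move=> sDB'; have pz := ptime_id ev cp sDB'.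
exact: (ptime_catrev y0 (ptime_fst (ptime_snd pz)) (ptime_snd (ptime_snd pz))).
Qed.
End MapFlatten.
End ListPrograms.

(** * Polynomial-time vector operations *)

Fixpoint seq_dot (r v : seq int) : int :=
  if r is c :: r' then (c * head 0 v + seq_dot r' (behead v))%R else 0%R.

Fixpoint seq_residual (rows : seq (seq int)) (rho v : seq int) : seq int :=
  if rows is r :: rows' then (head 0 rho - seq_dot r v)%R :: seq_residual rows' (behead rho) v
  else [::].

Fixpoint enum_box n (rs : seq (seq int)) : seq (seq int) :=
  if n is n'.+1 then [seq x :: v | x <- head [::] rs, v <- enum_box n' (behead rs)]
  else [:: [::]].

Definition floorq (q : rat) : int := (numq q %/ denq q)%Z.

Definition lower_ok (o : option int) (z : int) : bool := if o is Some a then (a <= z)%R else true.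
Definition upper_ok (o : option int) (z : int) : bool := if o is Some a then (z <= a)%R else true.

Section MorePrograms.
Variables (Ctx : Type) (msize : Ctx -> nat) (ev cp : Ctx -> tree -> tree -> Prop).
Local Notation pt D F := (ptime msize ev cp D F).
Local Notation pbounded D x := (pbounded msize D x).
Local Notation small D := (small msize D).

Lemma ptime_filter (X : encType) (D : Ctx -> X -> Prop) (Y : encType) (y0 : Y)
    (s : Ctx -> X -> seq Y) (p : Ctx -> X -> Y -> bool) :
  pt D s ->
  let DB := fun k (q : X * Y) => D k q.1 /\ List.In q.2 (s k q.1) in
  (small DB -> pt DB (fun k q => p k q.1 q.2)) ->
  pt D (fun k x => seq.filter (p k x) (s k x)).
Proof.
move=> ps DB pp.
apply: (ptime_eq (F := fun k x => flatten (map (fun y =>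
  if p k x y then [:: y] else [::]) (s k x)))); last first.
  by move=> k x _; elim: (s k x) => //= y ys ->; case: ifP.
apply: (ptime_flatten y0); apply: (ptime_map y0 [::] ps) => sDB; apply: ptime_if; first exact: pp.
  move=> _; have pz := ptime_weak (ptime_id ev cp sDB) (fun k x (H : (fun k q =>
    DB k q /\ p k q.1 q.2) k x) => proj1 H).
  exact: ptime_cons (ptime_snd pz) (ptime_cst _ _ [::] (ptime_in pz)).
by move=> _; apply: ptime_cst; apply: pbounded_sub sDB _ => k x [].
Qed.

Lemma ptime_has (X : encType) (D : Ctx -> X -> Prop) (Y : encType) (y0 : Y)
    (s : Ctx -> X -> seq Y) (p : Ctx -> X -> Y -> bool) :
  pt D s ->
  let DB := fun k (q : X * Y) => D k q.1 /\ List.In q.2 (s k q.1) in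
  (small DB -> pt DB (fun k q => p k q.1 q.2)) ->
  pt D (fun k x => has (p k x) (s k x)).
Proof.
move=> ps DB pp; apply: (ptime_eq (ptime_not (ptime_nilp (ptime_filter y0 ps pp)))) => k x _.
by rewrite /nilp size_filter has_count lt0n.
Qed.

Lemma enc_size_nat n : enc_size n <= n.+2.
Proof. by rewrite /enc_size /=; apply: int_size_le;
  apply: leq_trans (ltn_expl n (isT : 1 < 2)) _; rewrite leq_pexp2l. Qed.

Lemma enc_size_iota_le (m : nat) (s : seq nat) B :
  s = iota m (size s) -> m + size s <= B ->
  enc_size (m, s) <= B.+2 + (B * B.+3).+2.
Proof.
move=> sE leB; rewrite enc_size_pair; have lem := enc_size_nat m.
have les : enc_size s <= (size s * B.+3).+1.
  apply: enc_size_seq_le => i; rewrite In_mem sE mem_iota => /andP[_ lti].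
  by apply: leq_trans (enc_size_nat i) _; rewrite !ltnS ltnW // (leq_trans lti).
have : size s * B.+3 <= B * B.+3 by rewrite leq_mul2r; lia.
by lia.
Qed.

(** The list is built from its end. Being listed in unary, the number [n k x]
itself must be polynomial, not only its length. *)
Lemma ptime_iota (X : encType) (D : Ctx -> X -> Prop) (n : Ctx -> X -> nat) :
  pt D n -> pbounded D n -> pt D (fun k x => iota 0 (n k x)).
Proof.
move=> pn [c nc].
pose DZ k (z : nat * seq nat) := exists x, [/\ D k x,
  z.1 + size z.2 = n k x & z.2 = iota z.1 (size z.2)].
have sDZ : small DZ.
  apply: pbounded_le (_ : pbounded _ (fun k _ =>
    ((msize k).+2 ^ c).+2 + ((msize k).+2 ^ c * ((msize k).+2 ^ c).+3).+2)) _.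
    by do ![apply: pboundedD | apply: pboundedS | apply: pboundedM]; exists c.
  move=> k [m s] [x [/= Dx ms sE]]; apply: enc_size_iota_le sE _.
  by rewrite ms nc.
pose F (k : Ctx) (z : nat * seq nat) := (0, iota 0 z.1 ++ z.2).
suff pF : pt DZ F.
  have pin := ptime_pair pn (ptime_cst ev cp ([::] : seq nat) (ptime_in pn)).
  apply: (ptime_eq (ptime_snd (ptime_comp pF pin _))) => [k x Dx|k x Dx].
    by exists x; rewrite /= addn0.
  by rewrite /= cats0.
have pz := ptime_id ev cp sDZ.
pose b (k : Ctx) (z : nat * seq nat) := 0 < z.1.
have pb : pt DZ b.
  have p1 : pt DZ (fun _ z => z.1%:Z) by apply: (ptime_cast (ptime_fst pz)).
  apply: (ptime_eq (ptime_le (ptime_cst ev cp 1%Z sDZ) p1)) => k z _; by rewrite lez_nat.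
have pz' : pt (fun k z => DZ k z /\ b k z) (fun _ z => z) by apply: ptime_weak pz _ => k z [].
have p1 : pt (fun k z => DZ k z /\ b k z) (fun _ z => z.1.-1).
  have p1 : pt (fun k z => DZ k z /\ b k z) (fun _ z =>
    z.1%:Z) by apply: (ptime_cast (ptime_fst pz')).
  apply: (ptime_cast (ptime_sub p1 (ptime_cst ev cp 1%Z (ptime_in pz')))) => k [[|m] s] [_ //= _].
  by congr VInt; lia.
apply: (ptime_while (b := b) (g := fun _ z => (z.1.-1, z.1.-1 :: z.2)) (m := fun _ z => z.1) pb).
- exact: ptime_pair p1 (ptime_cons p1 (ptime_snd pz')).
- by apply: pbounded_le (_ : pbounded _ (fun k _ => (msize k).+2 ^ c)) _;
  [exists c | move=> k z [x [Dx E _]] /=; apply: leq_trans (nc k x Dx); rewrite -E leq_addr].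
- move=> k [[|m] s] [x [/= Dx ms sE]] // _; split=> //=.
    by exists x; split=> //=; [rewrite -ms addnS | rewrite -sE].
  by rewrite /F /fst /snd -[iota 0 m.+1]/(iota 0 (1 + m)) addnC iotaD -catA.
- by move=> k [[|m] s] _.
Qed.

Lemma ptime_eqseq (X : encType) (D : Ctx -> X -> Prop) (s t : Ctx -> X -> seq int) :
  pt D s -> pt D t -> pt D (fun k x => s k x == t k x).
Proof.
move=> ps pt_.
pose st (a : bool * seq int) (y : int) := (a.1 && ~~ nilp a.2 && (y == head 0%R a.2), behead a.2).
have stE b (u v : seq int) : foldl st (b, v) u = (b && (take (size u) v == u), drop (size u) v).
  elim: u b v => [|y u IH] b v /=; first by rewrite take0 drop0 eqxx andbT.
  case: v => [|z v] /=; rewrite IH /=; first by rewrite andbF.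
  by rewrite eqseq_cons andbT -andbA (eq_sym y).
apply: (ptime_eq (F := fun k x =>
  (foldl st (true, t k x) (s k x)).1 && nilp (foldl st (true, t k x) (s k x)).2)); last first.
  move=> k x _; rewrite stE /= /nilp size_drop subn_eq0.
  have [le|gt] := leqP (size (t k x)) (size (s k x)); last first.
    by rewrite andbF; apply/esym/eqP => E; rewrite E ltnn in gt.
  by rewrite take_oversize // andbT eq_sym.
have pf : pt D (fun k x => foldl st (true, t k x) (s k x)).
  apply: (ptime_foldl (st := fun _ _ => st) (0%R : int) ps).
  - exact: ptime_pair (ptime_cst _ _ true (ptime_in ps)) pt_.
  - have [c tc] := ptime_out pt_;
    apply: pbounded_le (_ : pbounded _ (fun k _ => (2 + (msize k).+2 ^ c).+1)) _.
      by apply: pboundedS; apply: pboundedD; [apply: pbounded_cst | exists c].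
    move=> k [x pre] [/= Dx _]; rewrite stE enc_size_pair /= ltnS leq_add //.
      by case: (_ == _).
    apply: leq_trans (tc k x Dx); rewrite -{2}(cat_take_drop (size pre) (t k x)).
    by rewrite -ltnS enc_size_cat -addn1 addnC leq_add2r enc_size_gt0.
  move=> sDB; have pz := ptime_id ev cp sDB; have pa := ptime_snd (ptime_snd pz).
  apply: ptime_pair (ptime_behead (ptime_snd pa)).
  apply: ptime_and.
    by apply: ptime_and (ptime_fst pa) (ptime_weak (ptime_not (ptime_nilp (ptime_snd pa))) _) =>
      k x [].
  apply: ptime_weak (ptime_eqz (ptime_fst (ptime_snd pz)) (ptime_head (0%R : int) (ptime_snd
    pa))) _ => k x [] //.
apply: ptime_and (ptime_fst pf) (ptime_weak (ptime_nilp (ptime_snd pf)) _) => k x [] //.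
Qed.

Lemma ptime_drop (X : encType) (D : Ctx -> X -> Prop) (Y : encType) n (s : Ctx -> X -> seq Y) :
  pt D s -> pt D (fun k x => drop n (s k x)).
Proof.
elim: n s => [|n IH] s ps; first by apply: (ptime_eq ps) => k x _; rewrite drop0.
by apply: (ptime_eq (IH _ (ptime_behead ps))) => k x _; case: (s k x).
Qed.

Lemma ptime_take (Y : encType) (y0 : Y) (X : encType) n (D : Ctx -> X -> Prop) (s : Ctx -> X ->
  seq Y) :
  pt D s -> pt D (fun k x => take n (s k x)).
Proof.
elim: n D s => [|n IH] D s ps.
  by apply: (ptime_eq (ptime_cst _ _ [::] (ptime_in ps))) => k x _; rewrite take0.
apply: (ptime_eq (F := fun k x =>
  if nilp (s k x) then [::] else head y0 (s k x) :: take n (behead (s k x)))).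
  apply: ptime_if; first exact: ptime_nilp.
    by move=> sD; apply: ptime_cst; apply: pbounded_sub sD _ => k x [].
  move=> sD; apply: ptime_weak (_ : pt D _) _ => [|k x []]; last by [].
  by apply: ptime_cons (ptime_head y0 ps) (IH _ _ (ptime_behead ps)).
by move=> k x _; case: (s k x).
Qed.

Lemma enc_size_drop (Y : encType) n (s : seq Y) : enc_size (drop n s) <= enc_size s.
Proof.
rewrite -[X in _ <= enc_size X](cat_take_drop n).
by rewrite -ltnS enc_size_cat -addn1 addnC leq_add2r enc_size_gt0.
Qed.

Lemma enc_size_take (Y : encType) n (s : seq Y) : enc_size (take n s) <= enc_size s.
Proof.
rewrite -[X in _ <= enc_size X](cat_take_drop n).
by rewrite -ltnS enc_size_cat -addn1 leq_add2l enc_size_gt0.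
Qed.

Lemma ptime_reshape (X : encType) (D : Ctx -> X -> Prop) (Y : encType) (y0 : Y) c
    (n : Ctx -> X -> nat) (s : Ctx -> X -> seq Y) :
  pt D n -> pbounded D n -> pt D s -> pt D (fun k x => reshape (nseq (n k x) c) (s k x)).
Proof.
move=> pn [d nd] ps.
pose st (a : seq Y * seq (seq Y)) (_ : nat) := (drop c a.1, take c a.1 :: a.2).
have stE (u : seq nat) v w : foldl st (v, w) u = (drop (size u * c) v,
  catrev (reshape (nseq (size u) c) v) w).
  elim: u v w => [|i u IH] v w /=; first by rewrite drop0.
  by rewrite IH /= drop_drop mulSn addnC.
apply: (ptime_eq (F := fun k x => rev (foldl st (s k x, [::]) (iota 0 (n k x))).2)); last first.
  by move=> k x _; rewrite stE size_iota /= catrevE cats0 revK.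
apply: (ptime_rev [::]); apply: ptime_snd.
have pi : pt D (fun k x => iota 0 (n k x)) by apply: ptime_iota => //; exists d.
apply: (ptime_foldl (st := fun _ _ => st) 0 pi).
- exact: ptime_pair ps (ptime_cst _ _ [::] (ptime_in ps)).
- have [e se] := ptime_out ps.
  apply: pbounded_le (_ : pbounded _ (fun k _ =>
    ((msize k).+2 ^ e + ((msize k).+2 ^ d * ((msize k).+2 ^ e).+1).+1).+1)) _.
    by do ![apply: pboundedD | apply: pboundedS | apply: pboundedM];
      [exists e | exists d | exists e].
  move=> k [x pre] [/= Dx [post E]]; rewrite stE enc_size_pair /= ltnS leq_add //.
    exact: leq_trans (enc_size_drop _ _) (se k x Dx).
  rewrite catrevE cats0 enc_size_rev.
  have pren : size pre <= n k x by rewrite -(size_iota 0 (n k x)) E size_cat leq_addr.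
  apply: leq_trans (@enc_size_seq_le _ _ ((msize k).+2 ^ e) _) _.
    have : forall m (u : seq Y) y, List.In y (reshape (nseq m c) u) -> enc_size y <= enc_size u.
      elim=> //= m IH u y [<-|/IH]; first exact: enc_size_take.
      by move=> h; apply: leq_trans h (enc_size_drop _ _).
    by move=> H y /H /leq_trans; apply; apply: se.
  rewrite ltnS leq_mul2r size_reshape size_nseq; apply/orP; right.
  exact: leq_trans pren (nd k x Dx).
move=> sDB; have pz := ptime_id ev cp sDB; have pa := ptime_snd (ptime_snd pz).
exact: ptime_pair (ptime_drop c (ptime_fst pa)) (ptime_cons (ptime_take y0 c (ptime_fst pa))
  (ptime_snd pa)).
Qed.

Lemma ptime_zip (X : encType) (D : Ctx -> X -> Prop) (Y Z : encType) (y0 : Y) (z0 : Z)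
    (s : Ctx -> X -> seq Y) (t : Ctx -> X -> seq Z) :
  pt D s -> pt D t -> (forall k x, D k x -> size (s k x) = size (t k x)) ->
  pt D (fun k x => zip (s k x) (t k x)).
Proof.
move=> ps pt_ st_size.
pose st (a : seq Z * seq (Y * Z)) (y : Y) := (behead a.1, (y, head z0 a.1) :: a.2).
have stE (u : seq Y) v w : size u <= size v ->
    foldl st (v, w) u = (drop (size u) v, catrev (zip u v) w).
  elim: u v w => [|y u IH] [|z v] w //= le.
  by rewrite IH.
apply: (ptime_eq (F := fun k x => rev (foldl st (t k x, [::]) (s k x)).2)); last first.
  by move=> k x Dx; rewrite stE ?st_size //= catrevE cats0 revK.
apply: (ptime_rev (y0, z0)); apply: ptime_snd; apply: (ptime_foldl (st := fun _ _ => st) y0 ps).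
- exact: ptime_pair pt_ (ptime_cst _ _ [::] (ptime_in ps)).
- have [c sc] := ptime_out ps; have [d td] := ptime_out pt_.
  apply: pbounded_le (_ : pbounded _ (fun k _ =>
    ((msize k).+2 ^ d + ((msize k).+2 ^ c + (msize k).+2 ^ d).+1).+1)) _.
    by do ![apply: pboundedD | apply: pboundedS | apply: pboundedM];
      [exists d | exists c | exists d].
  move=> k [x pre] [/= Dx [post E]].
  have le : size pre <= size (t k x) by rewrite -st_size // E size_cat leq_addr.
  rewrite stE // enc_size_pair /= ltnS leq_add //.
    exact: leq_trans (enc_size_drop _ _) (td k x Dx).
  rewrite catrevE cats0 enc_size_rev.
  have : forall (u : seq Y) (v : seq Z), enc_size (zip u v) < enc_size u + enc_size v.
    elim=> [|y u IH] [|z v]; rewrite /= ?enc_size_cons ?enc_size_nil ?enc_size_pair; try lia.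
    by have := IH v; lia.
  move/(_ pre (t k x)); have := sc k x Dx; have := td k x Dx.
  by have := enc_size_take (size pre) (s k x); rewrite {1}E take_size_cat //; lia.
move=> sDB; have pz := ptime_id ev cp sDB; have pa := ptime_snd (ptime_snd pz).
exact: ptime_pair (ptime_behead (ptime_fst pa)) (ptime_cons (ptime_pair (ptime_fst (ptime_snd
  pz)) (ptime_head z0 (ptime_fst pa))) (ptime_snd pa)).
Qed.

Section Arithmetic.
Context (X : encType) (D : Ctx -> X -> Prop).

Lemma ptime_seq_dot r (v : Ctx -> X -> seq int) : pt D v -> pt D (fun k x => seq_dot r (v k x)).
Proof.
elim: r v => [|c r IH] v pv; first exact: ptime_cst (ptime_in pv).
exact: ptime_add (ptime_mul (ptime_cst _ _ c (ptime_in pv)) (ptime_head (0%R : int) pv)) (IH _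
  (ptime_behead pv)).
Qed.

Lemma ptime_seq_residual rows (rho v : Ctx -> X -> seq int) :
  pt D rho -> pt D v -> pt D (fun k x => seq_residual rows (rho k x) (v k x)).
Proof.
move=> + pv; elim: rows rho => [|r rows IH] rho prho; first exact: ptime_cst (ptime_in pv).
exact: ptime_cons (ptime_sub (ptime_head (0%R : int) prho) (ptime_seq_dot r pv)) (IH _
  (ptime_behead prho)).
Qed.

Lemma ptime_exp e (z : Ctx -> X -> int) : pt D z -> pt D (fun k x => (z k x ^+ e)%R).
Proof.
move=> pz; elim: e => [|e IH]; first exact: ptime_cst (ptime_in pz).
by apply: (ptime_eq (ptime_mul pz IH)) => k x _; rewrite exprS.
Qed.

Lemma ptime_floorq (q : Ctx -> X -> rat) : pt D q -> pt D (fun k x => floorq (q k x)).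
Proof.
move=> pq; have pp : pt D (fun k x => (numq (q k x), denq (q k x))) by apply: (ptime_cast pq).
exact: ptime_div (ptime_fst pp) (ptime_snd pp).
Qed.

End Arithmetic.

Lemma ptime_bound (X : encType) (D : Ctx -> X -> Prop) (o : Ctx -> X -> option int) (z : Ctx -> X
  -> int) :
  pt D o -> pt D z -> pt D (fun k x => lower_ok (o k x) (z k x)) /\ pt D (fun k x =>
    upper_ok (o k x) (z k x)).
Proof.
move=> po pz; have pl := ptime_isleaf po; have sD := ptime_in po.
have ptrue : pt (fun k x => D k x /\ is_leaf (enc (o k x))) (fun _ _ => true).
  by apply: ptime_cst; apply: pbounded_sub sD _ => k x [].
pose D' := fun k x => D k x /\ ~~ is_leaf (enc (o k x)).
have pa : pt D' (fun k x => odflt 0%R (o k x)).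
  have pp : pt D' (fun k x => (0%Z, odflt 0%R (o k x))).
    have po' : pt D' o by apply: ptime_weak po _ => k x [].
    by apply: (ptime_cast po') => k x [_]; case: (o k x).
  exact: ptime_snd pp.
have pz' : pt D' z by apply: ptime_weak pz _ => k x [].
split.
  apply: (ptime_eq (F := fun k x =>
    if is_leaf (enc (o k x)) then true else (odflt 0 (o k x) <= z k x)%R)).
    by apply: ptime_if => // _; apply: ptime_le.
  by move=> k x _; rewrite /lower_ok; case: (o k x).
apply: (ptime_eq (F := fun k x =>
  if is_leaf (enc (o k x)) then true else (z k x <= odflt 0 (o k x))%R)).
  by apply: ptime_if => // _; apply: ptime_le.
by move=> k x _; rewrite /upper_ok; case: (o k x).
Qed.

Lemma ptime_enum_box (X : encType) (D : Ctx -> X -> Prop) n (rs : Ctx -> X -> seq (seq int)) :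
  pt D rs -> pt D (fun k x => enum_box n (rs k x)).
Proof.
elim: n rs => [|n IH] rs prs; first exact: ptime_cst (ptime_in prs).
apply: (ptime_flatten [::]).
apply: (ptime_map (0%R : int) ([::] : seq (seq int)) (f := fun k x c =>
  [seq c :: v | v <- enum_box n (behead (rs k x))])
  (ptime_head [::] prs)) => sDB.
have pin : pt (fun k (p : X * int) => D k p.1 /\ List.In p.2 (head [::] (rs k p.1)))
   (fun k p => enum_box n (behead (rs k p.1))).
  have pb := IH _ (ptime_behead prs).
  apply: (ptime_comp pb (ptime_fst (ptime_id ev cp sDB))) => k x [] //.
apply: (ptime_map ([::] : seq int) ([::] : seq int) pin) => sDB'; have pz := ptime_id ev cp sDB'.
exact: ptime_cons (ptime_snd (ptime_fst pz)) (ptime_snd pz).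
Qed.

End MorePrograms.

Local Open Scope ring_scope.

(** * Dynamic programming with comparison of complete solutions *)

Section DynamicProgram.
Variables (T W L : eqType) (succ : L -> T -> seq (W * T)) (fin : pred T).
Variable (cost : seq W -> int).
Implicit Types (t u : T) (ws p s : seq W) (l : L) (ls : seq L).
Local Notation table := (seq (T * seq W)).

Definition insert (acc : table) (e : T * seq W) : table :=
  if has (fun q => q.1 == e.1) acc then acc else e :: acc.

Definition extensions l (tab : table) : table :=
  flatten [seq [seq (wt.2, wt.1 :: tp.2) | wt <- succ l tp.1] | tp <- tab].

Definition forward_step l (tab : table) : table := foldl insert [::] (extensions l tab).

Definition forward t0 ls : seq (L * table) * table :=
  foldl (fun a l => ((l, a.2) :: a.1, forward_step l a.2)) ([::], [:: (t0, [::])]) ls.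

Definition completions l t (G : table) : seq (seq W) :=
  flatten [seq [seq wt.1 :: g.2 | g <- [seq g <- G | g.1 == wt.2]] | wt <- succ l t].

(** Candidates are priced only after completion by the reversed prefix [p]. *)
Definition better p (acc : seq (seq W)) s : seq (seq W) :=
  if nilp acc || (cost (catrev p s) < cost (catrev p (head [::] acc))) then [:: s] else acc.

Definition best p (ss : seq (seq W)) : seq (seq W) := foldl (better p) [::] ss.

Definition backward_step (G : table) (f : L * table) : table :=
  flatten [seq [seq (tp.1, s) | s <- best tp.2 (completions f.1 tp.1 G)] | tp <- f.2].

Definition final_table (tab : table) : table :=
  [seq (tp.1, [::]) | tp <- [seq tp <- tab | fin tp.1]].

(** The stack of the forward pass lists the layers backwards, each with the table
of the states in which it starts; this is the order of the backward pass. *)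
Definition dp t0 ls : table :=
  foldl backward_step (final_table (forward t0 ls).2) (forward t0 ls).1.

Fixpoint walk ls t ws u : Prop :=
  match ls, ws with
  | [::], [::] => t = u
  | l :: ls, w :: ws => exists2 v, (w, v) \in succ l t & walk ls v ws u
  | _, _ => False
  end.

Lemma walk_cat ls1 ls2 t p s v u :
  walk ls1 t p v -> walk ls2 v s u -> walk (ls1 ++ ls2) t (p ++ s) u.
Proof.
elim: ls1 t p => [|l ls1 IH] t [|w p] //=; first by move=> ->.
by case=> v' Sv Wp Ws; exists v' => //; apply: IH.
Qed.

Lemma walk_rcons ls l t p w v u :
  walk ls t p v -> (w, u) \in succ l v -> walk (rcons ls l) t (rcons p w) u.
Proof. by move=> Wp Su; rewrite -!cats1; apply: walk_cat Wp _; exists u. Qed.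

Lemma walk_rcons_inv ls l t q u : walk (rcons ls l) t q u ->
  exists p w v, [/\ q = rcons p w, walk ls t p v & (w, u) \in succ l v].
Proof.
elim: ls t q => [|l' ls IH] t [|w q] //=.
  by case: q => [|w' q] [v Sv] //= <-; exists [::], w, t.
case=> v Sv /IH[p [w' [v' [-> Wp Sw]]]]; exists (w :: p), w', v'; split=> //=.
by exists v.
Qed.

Lemma mem_insert acc e x : x \in insert acc e -> x \in e :: acc.
Proof. by rewrite /insert; case: ifP => // _; rewrite inE orbC => ->. Qed.

Lemma foldl_insert_sub acc es x : x \in foldl insert acc es -> x \in acc ++ es.
Proof.
elim: es acc => [|e es IH] acc /=; first by rewrite cats0.
move/IH; rewrite !mem_cat inE => /orP[/mem_insert|->]; last by rewrite !orbT.
by rewrite inE => /orP[->|->]; rewrite ?orbT.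
Qed.

Lemma insert_key acc e : e.1 \in map fst (insert acc e).
Proof.
rewrite /insert; case: ifP => [/hasP[q qa /eqP<-]|_]; first exact: map_f.
by rewrite inE eqxx.
Qed.

Lemma insert_keys acc e t : t \in map fst acc -> t \in map fst (insert acc e).
Proof. by rewrite /insert; case: ifP => //= _; rewrite inE orbC => ->. Qed.

Lemma foldl_insert_keys acc es t :
  t \in map fst (acc ++ es) -> t \in map fst (foldl insert acc es).
Proof.
elim: es acc => [|e es IH] acc /=; first by rewrite cats0.
move=> H; apply: IH; move: H; rewrite !map_cat !mem_cat /= inE.
case/or3P => [H|/eqP->|->]; rewrite ?orbT //; first by rewrite insert_keys.
by rewrite insert_key.
Qed.

Lemma foldl_insert_uniq acc es : uniq (map fst acc) -> uniq (map fst (foldl insert acc es)).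
Proof.
elim: es acc => //= e es IH acc Ua; apply: IH; rewrite /insert.
case: ifP => //= /negbT noe; rewrite Ua andbT; apply: contra noe => /mapP[q qa E].
by apply/hasP; exists q => //; rewrite E.
Qed.

Lemma extensionsP l tab u q :
  reflect (exists t p w, [/\ (t, p) \in tab, (w, u) \in succ l t & q = w :: p])
          ((u, q) \in extensions l tab).
Proof.
apply: (iffP flatten_mapP) => [[[t p] tp /mapP[[w v] Sw /= [-> ->]]]|[t [p [w [tp Sw ->]]]]].
  by exists t, p, w.
by exists (t, p) => //; apply/mapP; exists (w, u).
Qed.

Definition forward_ok t0 ls (tab : table) : Prop :=
  [/\ forall t p, (t, p) \in tab -> walk ls t0 (rev p) t,
      forall t p, walk ls t0 p t -> t \in map fst tab & uniq (map fst tab)].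

Lemma forward_step_ok t0 ls l tab :
  forward_ok t0 ls tab -> forward_ok t0 (rcons ls l) (forward_step l tab).
Proof.
move=> [snd_ cmp Ut]; split.
- move=> u q /foldl_insert_sub /extensionsP[t [p [w [tp Sw ->]]]].
  by rewrite rev_cons; apply: walk_rcons Sw; apply: snd_.
- move=> u q /walk_rcons_inv[p [w [v [_ Wp Sw]]]]; apply: foldl_insert_keys.
  have /mapP[[v' p'] vp /= E] := cmp _ _ Wp; subst v'.
  apply/mapP; exists (u, w :: p') => //; apply/extensionsP; by exists v, p', w.
- exact: foldl_insert_uniq.
Qed.

Fixpoint stack_ok t0 (stk : seq (L * table)) ls : Prop :=
  match stk with
  | [::] => ls = [::]
  | f :: stk' => exists ls', [/\ ls = rcons ls' f.1, forward_ok t0 ls' f.2 & stack_ok t0 stk' ls']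
  end.

Lemma forward_rcons t0 ls l : forward t0 (rcons ls l) =
  ((l, (forward t0 ls).2) :: (forward t0 ls).1, forward_step l (forward t0 ls).2).
Proof. by rewrite /forward foldl_rcons. Qed.

Lemma forwardP t0 ls : forward_ok t0 ls (forward t0 ls).2 /\ stack_ok t0 (forward t0 ls).1 ls.
Proof.
elim/last_ind: ls => [|ls l [Fok Sok]].
  split=> //; split=> // [t p|t [|//]] /=; last by move=> ->; rewrite inE.
  by rewrite inE => /eqP[-> ->].
by rewrite forward_rcons; split; [exact: forward_step_ok | exists ls].
Qed.

Section Backward.
Variables (t0 : T) (layers : seq L).

Definition complete ls t s := exists2 u, walk ls t s u & fin u.

(** Which of two completions of a state is better does not depend on the way in
which the state was reached. This holds for separable costs. *)
Hypothesis exchange : forall ls1 ls2 t p p' s s', layers = ls1 ++ ls2 ->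
  walk ls1 t0 p t -> walk ls1 t0 p' t -> complete ls2 t s -> complete ls2 t s' ->
  cost (p ++ s) <= cost (p ++ s') -> cost (p' ++ s) <= cost (p' ++ s').

Definition backward_ok ls1 ls2 (G : table) : Prop :=
  (forall t s, (t, s) \in G -> [/\ exists p, walk ls1 t0 p t, complete ls2 t s
     & forall p s', walk ls1 t0 p t -> complete ls2 t s' -> cost (p ++ s) <= cost (p ++ s')]) /\
  (forall t p s, walk ls1 t0 p t -> complete ls2 t s -> t \in map fst G).

Lemma bestP p ss :
  (forall s, s \in best p ss -> s \in ss /\ forall s',
    s' \in ss -> cost (rev p ++ s) <= cost (rev p ++ s')) /\
  (ss != [::] -> best p ss != [::]) /\ (size (best p ss) <= 1)%N.
Proof.
rewrite /best; elim/last_ind: ss => [|ss s0 [IH1 [IH2 IH3]]]; first by [].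
rewrite foldl_rcons; set acc := foldl _ _ _ in IH1 IH2 IH3 *.
rewrite /better; case: ifPn => [/orP[nil|lt]|]; last first.
- rewrite negb_or => /andP[nnil]; rewrite -leNgt !catrevE => le.
  split; last by split=> // _; case: (acc) nnil.
  case: (acc) nnil IH1 IH3 le => [//|a [|//]] _ IH1 _ le s; rewrite inE => /eqP->.
  have [ass amin] := IH1 a (mem_head _ _); split; first by rewrite mem_rcons inE ass orbT.
  by move=> s'; rewrite mem_rcons inE => /predU1P[->|/amin].
- split=> [s|//]; rewrite inE => /eqP->; split; first by rewrite mem_rcons mem_head.
  move: lt; rewrite !catrevE; case: (acc) IH1 IH2 => [|a acc'] IH1 IH2 lt.
    have ss0 : ss = [::] by apply/eqP/negPn/negP => /IH2.
    by move=> s'; rewrite ss0 inE => /eqP->.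
  have [_ amin] := IH1 a (mem_head _ _) => s'; rewrite mem_rcons inE => /predU1P[->//|/amin].
  by apply: le_trans; apply: ltW.
- split=> [s|//]; rewrite inE => /eqP->; split; first by rewrite mem_rcons mem_head.
  have ss0 : ss = [::] by apply/eqP/negPn/negP => /IH2; rewrite -size_eq0 -/(nilp acc) nil.
  by move=> s'; rewrite ss0 inE => /eqP->.
Qed.

Lemma completionsP l t G q :
  reflect (exists w v s, [/\ (w, v) \in succ l t, (v, s) \in G & q = w :: s])
          (q \in completions l t G).
Proof.
apply: (iffP flatten_mapP) => [[[w v] Sw /mapP[[v' s]]]|[w [v [s [Sw vs ->]]]]].
  by rewrite mem_filter /= => /andP[/eqP-> vs] ->; exists w, v, s.
by exists (w, v) => //; apply/mapP; exists (v, s); rewrite // mem_filter /= eqxx.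
Qed.

Lemma mem_backward_step G l tab t s : (t, s) \in backward_step G (l, tab) ->
  exists2 p, (t, p) \in tab & s \in best p (completions l t G).
Proof. by move=> /flatten_mapP[[t' p] tp /mapP[s' sb /= [-> ->]]]; exists p. Qed.

(** A completion [w :: s] is dominated by [w] followed by the stored completion of
the state after [w]; by [exchange] the winner for the stored prefix wins for
all prefixes. *)
Lemma backward_step_ok ls1 l ls2 tab G : layers = rcons ls1 l ++ ls2 ->
  forward_ok t0 ls1 tab -> backward_ok (rcons ls1 l) ls2 G ->
  backward_ok ls1 (l :: ls2) (backward_step G (l, tab)).
Proof.
move=> layE [Fs Fc _] [Gs Gc].
have complete_cons t w v s :
    (w, v) \in succ l t -> complete ls2 v s -> complete (l :: ls2) t (w :: s).
  by move=> Sw [u Wu fu]; exists u => //; exists v.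
have cand t p s : walk ls1 t0 p t -> complete (l :: ls2) t s ->
    exists2 s', s' \in completions l t G & forall p,
      walk ls1 t0 p t -> cost (p ++ s') <= cost (p ++ s).
  move=> Wp [u]; case: s => [//|w s] [v Sw Ws] fu.
  have Wpw := walk_rcons Wp Sw; have Cs : complete ls2 v s by exists u.
  have /mapP[[v' s1] vs /= E] := Gc _ _ _ Wpw Cs; subst v'.
  exists (w :: s1); first by apply/completionsP; exists w, v, s1.
  move=> p' Wp'; have [_ _ opt] := Gs _ _ vs; rewrite -!cat_rcons.
  by apply: opt => //; apply: walk_rcons Wp' Sw.
split.
- move=> t s /mem_backward_step[p tp sb]; have Wp := Fs _ _ tp.
  have [/(_ _ sb)[sc smin] _] := bestP p (completions l t G).
  have Cs : complete (l :: ls2) t s.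
    have /completionsP[w [v [s1 [Sw vs ->]]]] := sc.
    by apply: complete_cons Sw _; case: (Gs _ _ vs).
  split; [by exists (rev p) | by [] | move=> p' s' Wp' Cs'].
  apply: (exchange (ls1 := ls1) (ls2 := l :: ls2) _ Wp Wp' Cs Cs').
    by rewrite layE cat_rcons.
  have [s2 s2c le] := cand _ _ _ Wp Cs'.
  exact: le_trans (smin _ s2c) (le _ Wp).
- move=> t p s Wp Cs; have /mapP[[t' q] tq /= E] := Fc _ _ Wp; subst t'.
  have [s2 s2c _] := cand _ _ _ Wp Cs.
  have [_ [ne _]] := bestP q (completions l t G).
  have : best q (completions l t G) != [::] by apply: ne; case: (completions _ _ _) s2c.
  case E : (best _ _) => [//|s3 r] _; apply/mapP; exists (t, s3) => //.
  by apply/flatten_mapP; exists (t, q) => //; apply/mapP; exists s3; rewrite // E mem_head.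
Qed.

Lemma backward_ok_prefix pre post G :
  stack_ok t0 (pre ++ post) layers -> backward_ok layers [::] G ->
  exists ls1 ls2, [/\ layers = ls1 ++ ls2, stack_ok t0 post ls1,
     backward_ok ls1 ls2 (foldl backward_step G pre) & size ls2 = size pre].
Proof.
elim/last_ind: pre post => [|pre f IH] post; first by exists layers, [::]; rewrite cats0.
rewrite cat_rcons => Sok Gok; have [ls1 [ls2 [E /= [ls' [E' Fok Sok']] Bok msize]]] := IH _ Sok Gok.
subst ls1; exists ls', (f.1 :: ls2); split=> //.
- by rewrite E cat_rcons.
- by rewrite foldl_rcons; case: f E Fok Bok {Sok} => l tab /= E Fok Bok; apply: backward_step_ok.
- by rewrite size_rcons /= msize.
Qed.

(** All cost comparisons of the backward pass concern complete paths. *)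
Lemma completions_complete ls1 l ls2 tab G t p s : layers = rcons ls1 l ++ ls2 ->
  forward_ok t0 ls1 tab -> backward_ok (rcons ls1 l) ls2 G ->
  (t, p) \in tab -> s \in completions l t G -> complete layers t0 (rev p ++ s).
Proof.
move=> -> [Fs _ _] [Gs _] tp /completionsP[w [v [s1 [Sw vs ->]]]].
have [_ [u Wu fu] _] := Gs _ _ vs; exists u => //.
by rewrite cat_rcons; apply: walk_cat (Fs _ _ tp) _; exists v.
Qed.

Lemma final_table_ok tab : forward_ok t0 layers tab -> backward_ok layers [::] (final_table tab).
Proof.
move=> [Fs Fc _]; split.
  move=> t s /mapP[[t' p]]; rewrite mem_filter /= => /andP[ft tp] [-> ->].
  split; [by exists (rev p); apply: Fs | by exists t' |].
  by move=> p' [|w s'] _ [u].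
move=> t p [|w s] Wp [u] //= E ft; subst u.
have /mapP[[t' q] tq /= E] := Fc _ _ Wp; subst t'.
by apply/mapP; exists (t, [::]) => //; apply/mapP; exists (t, q); rewrite // mem_filter /= ft.
Qed.

Theorem dpP :
  (forall t s, (t, s) \in dp t0 layers -> complete layers t0 s /\
     forall s', complete layers t0 s' -> cost s <= cost s') /\
  ((exists s, complete layers t0 s) -> dp t0 layers != [::]).
Proof.
have [Fok Sok] := forwardP t0 layers; have Gok := final_table_ok Fok.
have [ls1 [ls2 [E /= ls1E [Bs Bc] _]]] := @backward_ok_prefix (forward t0 layers).1 [::] _
  (eq_ind_r (fun z => stack_ok t0 z layers) Sok (cats0 _)) Gok.
subst ls1; rewrite /= in E; subst ls2; split.
  move=> t s /Bs[[p] /=]; case: p => // <- Cs opt; split=> // s' Cs'.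
  exact: (opt [::] s').
move=> [s Cs]; have : t0 \in map fst (dp t0 layers) by apply: (Bc t0 [::] s).
by apply: contraTneq => ->.
Qed.
End Backward.
End DynamicProgram.

(** * Polynomial-time dynamic programming over blocks *)

Local Open Scope nat_scope.

Notation vect := (seq int).
Notation state := (vect * vect)%type.
Notation blayer := (bool * (seq vect * vect))%type.
Notation table := (seq (state * seq vect)).

Definition vect_enc : encType := seq_encType int_encType.
Definition table_enc : encType :=
  seq_encType (pair_encType (pair_encType vect_enc vect_enc) (seq_encType vect_enc)).

Section BlockProgram.
Variables (Ar Br Cr Dr : seq (seq int)) (zA zC : seq int).

(** The first layer, marked [true], chooses the shared block, which becomes part
of the state; each further layer chooses a block that solves its own rows.
The second component is what is left of the linking right-hand side. *)
Definition block_succ (l : blayer) (t : state) : seq (vect * state) :=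
  if l.1 then [seq (w, (w, seq_residual Cr t.2 w)) | w <- l.2.1]
  else [seq (w, (t.1, seq_residual Dr t.2 w)) | w <- [seq w <- l.2.1 | seq_residual Ar
    (seq_residual Br l.2.2 t.1) w == zA]].

Definition block_final (t : state) := t.2 == zC.

Lemma block_succ_label l t w u : (w, u) \in block_succ l t -> w \in l.2.1.
Proof.
rewrite /block_succ; case: l.1 => /mapP[v + [-> _]] //.
by rewrite mem_filter => /andP[].
Qed.

Lemma walk_enc_size ls t ws u : walk block_succ ls t ws u -> enc_size ws <= enc_size ls.
Proof.
elim: ls t ws => [|l ls IH] t [|w ws] //= [v /block_succ_label wl /IH].
rewrite !enc_size_cons; have : enc_size w < enc_size l.2.1 by apply: enc_size_mem; apply/In_mem.
have : enc_size l = (enc_size l.1 + (enc_size l.2.1 + enc_size l.2.2).+1).+1 by [].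
by lia.
Qed.

Lemma enc_size_table (tab : table) b : (forall t p, (t, p) \in tab -> enc_size p <= b) ->
  enc_size tab <= enc_size [seq tp.1 | tp <- tab] * b.+2.
Proof.
elim: tab => [|[t p] tab IH] H; first by rewrite /= !enc_size_nil mul1n.
rewrite /= !enc_size_cons enc_size_pair.
have := H t p (mem_head _ _); have := IH (fun t' p' h => H t' p' (mem_behead (s := _ :: _) h)).
have := enc_size_gt0 t; nia.
Qed.

Lemma enc_size_map_fst (Y Z : encType) (s : seq (Y * Z)) : enc_size (map fst s) <= enc_size s.
Proof. by elim: s => // -[y z] s IH; rewrite /= !enc_size_cons enc_size_pair /=; lia. Qed.

Section Ptime.
Variables (Ctx : Type) (msize : Ctx -> nat) (ev cp : Ctx -> tree -> tree -> Prop).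
Local Notation pt D F := (ptime msize ev cp D F).
Local Notation pbounded D x := (pbounded msize D x).
Local Notation small D := (small msize D).

Variables (evl : Ctx -> vect -> int) (feasl : Ctx -> vect -> Prop).
Hypothesis ptime_eval : pt feasl evl.
Definition bcost k (ws : seq vect) : int := evl k (flatten ws).

Lemma ptime_succ (X : encType) (D : Ctx -> X -> Prop) (l : Ctx -> X -> blayer) (t : Ctx -> X ->
  state) :
  pt D l -> pt D t -> pt D (fun k x => block_succ (l k x) (t k x)).
Proof.
move=> pl pt_; apply: ptime_if; first exact: ptime_fst pl.
  move=> _; pose D' k x := D k x /\ (l k x).1.
  have pl' : pt D' l by apply: ptime_weak pl _ => k x [].
  have pt' : pt D' t by apply: ptime_weak pt_ _ => k x [].
  apply: (ptime_map ([::] : vect) (([::], ([::], [::])) : vect * state)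
     (f := fun k x w => (w, (w, seq_residual Cr (t k x).2 w))) (ptime_fst (ptime_snd pl'))) => sDB.
  have pz := ptime_id ev cp sDB; have pw := ptime_snd pz.
  have ptx : pt _ (fun k (q : X * vect) =>
    t k q.1) := ptime_comp pt' (ptime_fst pz) (fun k x H => proj1 H).
  exact: ptime_pair pw (ptime_pair pw (ptime_seq_residual Cr (ptime_snd ptx) pw)).
move=> _; pose D' k x := D k x /\ ~~ (l k x).1.
have pl' : pt D' l by apply: ptime_weak pl _ => k x [].
have pt' : pt D' t by apply: ptime_weak pt_ _ => k x [].
have pf : pt D' (fun k x => [seq w <- (l k x).2.1 | seq_residual Ar (seq_residual Br (l k x).2.2
  (t k x).1) w == zA]).
  apply: (ptime_filter ([::] : vect) (p := fun k x w =>
    seq_residual Ar (seq_residual Br (l k x).2.2 (t k x).1) w == zA)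
    (ptime_fst (ptime_snd pl'))) => sDB.
  have pz := ptime_id ev cp sDB; have pw := ptime_snd pz.
  have ptx : pt _ (fun k (q : X * vect) =>
    t k q.1) := ptime_comp pt' (ptime_fst pz) (fun k x H => proj1 H).
  have plx : pt _ (fun k (q : X * vect) =>
    l k q.1) := ptime_comp pl' (ptime_fst pz) (fun k x H => proj1 H).
  apply: ptime_eqseq (ptime_cst _ _ zA sDB).
  exact: ptime_seq_residual (ptime_seq_residual Br (ptime_snd (ptime_snd plx)) (ptime_fst ptx)) pw.
apply: (ptime_map ([::] : vect) (([::], ([::], [::])) : vect * state)
   (f := fun k x w => (w, ((t k x).1, seq_residual Dr (t k x).2 w))) pf) => sDB.
have pz := ptime_id ev cp sDB; have pw := ptime_snd pz.
have ptx : pt _ (fun k (q : X * vect) => t k q.1) := ptime_comp pt' (ptime_fst pz) (fun k x H =>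
  proj1 H).
exact: ptime_pair pw (ptime_pair (ptime_fst ptx) (ptime_seq_residual Dr (ptime_snd ptx) pw)).
Qed.

Lemma ptime_eqstate (X : encType) (D : Ctx -> X -> Prop) (t u : Ctx -> X -> state) :
  pt D t -> pt D u -> pt D (fun k x => t k x == u k x).
Proof.
move=> pt_ pu; apply: (ptime_eq (F := fun k x =>
  ((t k x).1 == (u k x).1) && ((t k x).2 == (u k x).2))).
  apply: ptime_and; first exact: ptime_eqseq (ptime_fst pt_) (ptime_fst pu).
  by apply: ptime_weak (ptime_eqseq (ptime_snd pt_) (ptime_snd pu)) _ => k x [].
by move=> k x _; case: (t k x) => a b; case: (u k x).
Qed.

Definition entry0 : state * seq vect := (([::], [::]), [::]).
Definition move0 : vect * state := ([::], ([::], [::])).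

Lemma ptime_forward_step (X : encType) (D : Ctx -> X -> Prop) (l : Ctx -> X -> blayer) (tab : Ctx
  -> X -> table) :
  pt D l -> pt D tab -> pt D (fun k x => forward_step block_succ (l k x) (tab k x)).
Proof.
move=> pl ptab.
have pe : pt D (fun k x => extensions block_succ (l k x) (tab k x)).
  apply: (ptime_flatten entry0).
  apply: (ptime_map entry0 ([::] : table)
    (f := fun k x (tp : state * seq vect) =>
      [seq (wt.2, wt.1 :: tp.2) | wt <- block_succ (l k x) tp.1]) ptab) => sDB.
  have pz := ptime_id ev cp sDB; have ptp := ptime_snd pz.
  have plx : pt _ (fun k (q : X * (state * seq vect)) =>
    l k q.1) := ptime_comp pl (ptime_fst pz) (fun k x H => proj1 H).
  apply: (ptime_map move0 entry0 (f := fun k (q : X * (state * seq vect)) (wt : vect * state) =>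
    (wt.2, wt.1 :: q.2.2))
    (ptime_succ plx (ptime_fst ptp))) => sDB'.
  have pz' := ptime_id ev cp sDB'.
  exact: ptime_pair (ptime_snd (ptime_snd pz')) (ptime_cons (ptime_fst (ptime_snd pz'))
    (ptime_snd (ptime_snd (ptime_fst pz')))).
have insert_size (es acc : table) : enc_size (foldl (@insert _ _) acc es) <= enc_size acc +
  enc_size es.
  elim: es acc => [|e es IH] acc /=; first by rewrite enc_size_nil; lia.
  apply: leq_trans (IH _) _; rewrite enc_size_cons /insert; case: ifP => _;
    rewrite ?enc_size_cons; lia.
apply: (ptime_foldl (A := table_enc) (a0 := fun _ _ => [::]) (st := fun _ _ acc e =>
  insert acc e) entry0 pe).
- exact: ptime_cst (ptime_in pe).
- have [c pc] := ptime_out pe; apply: pbounded_le (_ : pbounded _ (fun k _ =>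
  1 + (msize k).+2 ^ c)) _.
    by apply: pboundedD; [apply: pbounded_cst | exists c].
  move=> k [x pre] [/= Dx [post E]]; apply: leq_trans (insert_size _ _) _.
  rewrite enc_size_nil leq_add2l; apply: leq_trans (pc k x Dx).
  by rewrite E -ltnS enc_size_cat -addn1 leq_add2l enc_size_gt0.
move=> sDB; have pz := ptime_id ev cp sDB; have pacc := ptime_snd (ptime_snd pz);
  have pel := ptime_fst (ptime_snd pz).
apply: ptime_if.
- apply: (ptime_has entry0 (p := fun k (q : X * ((state * seq vect) * table)) (y : state * seq
  vect) => y.1 == q.2.1.1) pacc) => sDB'.
  have pz' := ptime_id ev cp sDB'.
  exact: ptime_eqstate (ptime_fst (ptime_snd pz')) (ptime_fst (ptime_fst (ptime_snd (ptime_fst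
    pz')))).
- by move=> _; apply: ptime_weak pacc _ => k x [].
- by move=> _; apply: ptime_weak (ptime_cons pel pacc) _ => k x [].
Qed.

Lemma ptime_final_table (X : encType) (D : Ctx -> X -> Prop) (tab : Ctx -> X -> table) :
  pt D tab -> pt D (fun k x => final_table block_final (tab k x)).
Proof.
move=> ptab.
have pf : pt D (fun k x => [seq tp <- tab k x | block_final tp.1]).
  apply: (ptime_filter entry0 (p := fun _ _ (tp : state * seq vect) => block_final tp.1) ptab) =>
    sDB.
  have pz := ptime_id ev cp sDB.
  exact: ptime_eqseq (ptime_snd (ptime_fst (ptime_snd pz))) (ptime_cst _ _ zC sDB).
apply: (ptime_map entry0 entry0 (f := fun _ _ (tp : state * seq vect) => (tp.1, [::])) pf) => sDB.
have pz := ptime_id ev cp sDB.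
exact: ptime_pair (ptime_fst (ptime_snd pz)) (ptime_cst _ _ [::] sDB).
Qed.

Lemma ptime_completions (X : encType) (D : Ctx -> X -> Prop) (l : Ctx -> X -> blayer)
   (t : Ctx -> X -> state) (G : Ctx -> X -> table) :
  pt D l -> pt D t -> pt D G -> pt D (fun k x => completions block_succ (l k x) (t k x) (G k x)).
Proof.
move=> pl pt_ pG; apply: (ptime_flatten ([::] : seq vect)).
apply: (ptime_map move0 ([::] : seq (seq vect)) (f := fun k x (wt : vect * state) =>
  [seq wt.1 :: g.2 | g <- [seq g <- G k x | g.1 == wt.2]]) (ptime_succ pl pt_)) => sDB.
have pz := ptime_id ev cp sDB.
have pGx : pt _ (fun k (q : X * (vect * state)) =>
  G k q.1) := ptime_comp pG (ptime_fst pz) (fun k x H => proj1 H).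
pose DB k (q : X * (vect * state)) := D k q.1 /\ List.In q.2 (block_succ (l k q.1) (t k q.1)).
have pf : pt DB (fun k (q : X * (vect * state)) => [seq g <- G k q.1 | g.1 == q.2.2]).
  apply: (ptime_filter entry0 (p := fun _ (q : X * (vect * state)) (g : state * seq vect) =>
    g.1 == q.2.2) pGx) => sDB'.
  have pz' := ptime_id ev cp sDB'.
  exact: ptime_eqstate (ptime_fst (ptime_snd pz')) (ptime_snd (ptime_snd (ptime_fst pz'))).
apply: (ptime_map entry0 ([::] : seq vect) (f :=
  fun _ (q : X * (vect * state)) (g : state * seq vect) => q.2.1 :: g.2) pf) => sDB'.
have pz' := ptime_id ev cp sDB'.
exact: ptime_cons (ptime_fst (ptime_snd (ptime_fst pz'))) (ptime_snd (ptime_snd pz')).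
Qed.

Lemma foldl_better_sub (cost : seq vect -> int) p acc ss :
  foldl (better cost p) acc ss = acc \/ exists2 s,
    List.In s ss & foldl (better cost p) acc ss = [:: s].
Proof.
elim: ss acc => [|s ss IH] acc /=; first by left.
case: (IH (better cost p acc s)) => [->|[s' ss' ->]]; last by right; exists s'; first by right.
by rewrite /better; case: ifP => _; [right; exists s; first by left | left].
Qed.

(** Evaluation is fast on feasible points only, which is why candidates are
compared as complete solutions. *)
Lemma ptime_best (X : encType) (D : Ctx -> X -> Prop) (p : Ctx -> X -> seq vect)
    (ss : Ctx -> X -> seq (seq vect)) :
  pt D p -> pt D ss ->
  (forall k x s, D k x -> List.In s (ss k x) -> feasl k (flatten (catrev (p k x) s))) ->
  pt D (fun k x => best (bcost k) (p k x) (ss k x)).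
Proof.
move=> pp pss feas.
apply: (ptime_foldl (st := fun k x => better (bcost k) (p k x)) ([::] : seq vect) pss).
- exact: ptime_cst (ptime_in pss).
- have [c pc] := ptime_out pss; exists c => k [x pre] [/= Dx [post E]];
  apply: leq_trans (pc k x Dx).
  case: (foldl_better_sub (bcost k) (p k x) [::] pre) => [->|[s sp ->]].
    by rewrite enc_size_nil enc_size_gt0.
  have : List.In s (ss k x) by rewrite E; apply/List.in_app_iff; left.
  elim: (ss k x) => //= s1 s2 IH [->|/IH]; rewrite !enc_size_cons enc_size_nil; last by lia.
  by have := enc_size_gt0 s2; lia.
move=> sDB; have pz := ptime_id ev cp sDB; have pacc := ptime_snd (ptime_snd pz);
  have ps := ptime_fst (ptime_snd pz).
have ppx : pt _ (fun k (q : X * (seq vect * seq (seq vect))) =>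
  p k q.1) := ptime_comp pp (ptime_fst pz) (fun k x H => proj1 H).
pose DB k (q : X * (seq vect * seq (seq vect))) := D k q.1 /\ exists pre post,
  ss k q.1 = pre ++ q.2.1 :: post /\ q.2.2 = foldl (better (bcost k) (p k q.1)) [::] pre.
have pone : pt DB (fun k q => [:: q.2.1]) := ptime_cons ps (ptime_cst _ _ [::] sDB).
apply: (ptime_eq (F := fun k q => if nilp q.2.2 then [:: q.2.1] else
  if bcost k (catrev (p k q.1) (head [::] q.2.2)) <= bcost k (catrev (p k q.1) q.2.1) then q.2.2
    else [:: q.2.1])%R); last first.
  by move=> k q _; rewrite /better ltNge; case: nilp => //=; case: ifP.
apply: ptime_if; first exact: ptime_nilp.
  by move=> _; apply: ptime_weak pone _ => k x [].
move=> _; pose DN k q := DB k q /\ ~~ nilp q.2.2.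
have pw Y (F : Ctx -> _ -> enc_sort Y) : pt DB F -> pt DN F by move=> pF;
  apply: ptime_weak pF _ => k x [].
have pev (s : Ctx -> X * (seq vect * seq (seq vect)) -> seq vect) : pt DN s ->
    (forall k q, DN k q -> List.In (s k q) (ss k q.1)) -> pt DN (fun k q =>
      bcost k (catrev (p k q.1) (s k q))).
  move=> psq sin.
  have pfl : pt DN (fun k q => flatten (catrev (p k q.1) (s k q))).
    exact: (ptime_flatten (0%R : int) (ptime_catrev ([::] : vect) (pw _ _ ppx) psq)).
  apply: (ptime_comp ptime_eval pfl) => k q DNq; apply: feas; last exact: sin.
  by case: DNq => -[].
apply: ptime_if.
- apply: ptime_le; apply: pev.
  + exact: ptime_head (pw _ _ pacc).
  + move=> k [x [s acc]] [[/= Dx [pre [post [E accE]]]] ne].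
    case: (foldl_better_sub (bcost k) (p k x) [::] pre) => [E'|[s' sp E']].
      by rewrite accE E' in ne.
    by rewrite accE E' /= E; apply/List.in_app_iff; left.
  + exact: pw.
  + move=> k [x [s acc]] [[/= Dx [pre [post [E accE]]]] ne].
    by rewrite E; apply/List.in_app_iff; right; left.
- by move=> _; apply: ptime_weak pacc _ => k q [[]].
- by move=> _; apply: ptime_weak pone _ => k q [[]].
Qed.

Lemma ptime_backward_step (X : encType) (D : Ctx -> X -> Prop) (G : Ctx -> X -> table)
   (f : Ctx -> X -> blayer * table) :
  pt D G -> pt D f ->
  (forall k x t p s, D k x -> (t,
    p) \in (f k x).2 -> s \in completions block_succ (f k x).1 t (G k x) ->
     feasl k (flatten (catrev p s))) ->
  pt D (fun k x => backward_step block_succ (bcost k) (G k x) (f k x)).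
Proof.
move=> pG pf feas; apply: (ptime_flatten entry0).
apply: (ptime_map entry0 ([::] : table) (f := fun k x (tp : state * seq vect) =>
  [seq (tp.1, s) | s <- best (bcost k) tp.2 (completions block_succ (f k x).1 tp.1 (G k x))])
    (ptime_snd pf)) => sDB.
have pz := ptime_id ev cp sDB.
have pGx : pt _ (fun k (q : X * (state * seq vect)) =>
  G k q.1) := ptime_comp pG (ptime_fst pz) (fun k x H => proj1 H).
have pfx : pt _ (fun k (q : X * (state * seq vect)) =>
  f k q.1) := ptime_comp pf (ptime_fst pz) (fun k x H => proj1 H).
pose DB k (q : X * (state * seq vect)) := D k q.1 /\ List.In q.2 (f k q.1).2.
have pb : pt DB (fun k (q : X * (state * seq vect)) =>
    best (bcost k) q.2.2 (completions block_succ (f k q.1).1 q.2.1 (G k q.1))).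
  apply: (ptime_best (ptime_snd (ptime_snd pz)) (ptime_completions (ptime_fst pfx) (ptime_fst
    (ptime_snd pz)) pGx)).
  move=> k [x [t p]] s [/= Dx /In_mem tp] /In_mem sc; exact: feas tp sc.
apply: (ptime_map ([::] : seq vect) entry0 (f := fun _ (q : X * (state * seq vect)) s =>
  (q.2.1, s)) pb) => sDB'.
have pz' := ptime_id ev cp sDB'.
exact: ptime_pair (ptime_fst (ptime_snd (ptime_fst pz'))) (ptime_snd pz').
Qed.

Section Dp.
Variables (X : encType) (D : Ctx -> X -> Prop) (layers : Ctx -> X -> seq blayer) (t0 : Ctx -> X
  -> state).
Hypotheses (player : pt D layers) (pt0 : pt D t0).
Hypothesis states_small :
  pbounded (fun k (q : X * seq blayer) => D k q.1 /\ exists post, layers k q.1 = q.2 ++ post)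
    (fun k q => enc_size [seq tp.1 | tp <- (forward block_succ (t0 k q.1) q.2).2]).
Hypothesis exchange : forall k x ls1 ls2 t p p' s s', D k x -> layers k x = ls1 ++ ls2 ->
  walk block_succ ls1 (t0 k x) p t -> walk block_succ ls1 (t0 k x) p' t ->
  complete block_succ block_final ls2 t s -> complete block_succ block_final ls2 t s' ->
  (bcost k (p ++ s) <= bcost k (p ++ s') -> bcost k (p' ++ s) <= bcost k (p' ++ s'))%R.
Hypothesis complete_feas : forall k x s, D k x ->
  complete block_succ block_final (layers k x) (t0 k x) s -> feasl k (flatten s).

Lemma forward_table_small :
  pbounded (fun k (q : X * seq blayer) => D k q.1 /\ exists post, layers k q.1 = q.2 ++ post)
    (fun k q => enc_size (forward block_succ (t0 k q.1) q.2).2).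
Proof.
have [c1 H1] := states_small; have [c2 H2] := ptime_out player.
apply: pbounded_le (_ : pbounded _ (fun k _ => ((msize k).+2 ^ c1) * ((msize k).+2 ^ c2).+2)) _.
  by do ![apply: pboundedS | apply: pboundedM]; [exists c1 | exists c2].
move=> k [x pre] H; have [/= Dx [post E]] := H.
apply: leq_trans (enc_size_table (b := (msize k).+2 ^ c2) _) _; last by rewrite leq_mul2r;
  apply/orP; right; exact: (H1 k (x, pre) H).
move=> t p tp; have [[Fs _ _] _] := forwardP block_succ (t0 k x) pre.
have := walk_enc_size (Fs _ _ tp); rewrite enc_size_rev => /leq_trans; apply.
apply: leq_trans (H2 k x Dx); rewrite E.
by rewrite -ltnS enc_size_cat -addn1 leq_add2l enc_size_gt0.
Qed.

Lemma ptime_forward : pt D (fun k x => forward block_succ (t0 k x) (layers k x)).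
Proof.
apply: (ptime_foldl (st := fun _ _ (a : seq (blayer * table) * table) l =>
  ((l, a.2) :: a.1, forward_step block_succ l a.2))
  ((true, ([::], [::])) : blayer) player).
- exact: ptime_pair (ptime_cst _ _ [::] (ptime_in pt0)) (ptime_cons (ptime_pair pt0 (ptime_cst _
  _ [::] (ptime_in pt0))) (ptime_cst _ _ [::] (ptime_in pt0))).
- have [c1 H1] := forward_table_small; have [c2 H2] := ptime_out player.
  apply: pbounded_le (_ : pbounded _ (fun k _ =>
    ((msize k).+2 ^ c1 + ((msize k).+2 ^ c2 * ((msize k).+2 ^ c1 + (msize k).+2 ^
    c2).+2).+1).+1)) _.
    by do ![apply: pboundedS | apply: pboundedM | apply: pboundedD];
      [exists c1 | exists c2 | exists c1 | exists c2].
  move=> k [x pre] H; have [/= Dx [post E]] := H.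
  rewrite -/(forward block_succ (t0 k x) pre) [forward _ _ _]surjective_pairing enc_size_pair
    ltnS addnC leq_add //.
    exact: (H1 k (x, pre)).
  have szpre : size pre <= (msize k).+2 ^ c2.
    by apply: leq_trans (H2 k x Dx); have := size_enc_size (layers k x); rewrite E size_cat; lia.
  apply: (@leq_trans (size pre * ((msize k).+2 ^ c1 + (msize k).+2 ^ c2).+2).+1); last first.
    by rewrite ltnS leq_mul2r szpre orbT.
  have : exists post', layers k x = pre ++ post' by exists post.
  elim/last_ind: (pre) => [|pre' l IH] [post' E']; first by rewrite enc_size_nil.
  rewrite forward_rcons enc_size_cons enc_size_pair size_rcons.
  have E2 : layers k x = pre' ++ (l :: post') by rewrite E' cat_rcons.
  have := IH (ex_intro _ _ E2); have /= := H1 k (x, pre') (conj Dx (ex_intro _ _ E2)).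
  have : enc_size l < enc_size (layers k x).
    by apply: enc_size_mem; rewrite E2; apply/List.in_app_iff; right; left.
  have := H2 k x Dx; rewrite mulSn; lia.
move=> sDB; have pz := ptime_id ev cp sDB; have pa := ptime_snd (ptime_snd pz);
  have pl := ptime_fst (ptime_snd pz).
exact: ptime_pair (ptime_cons (ptime_pair pl (ptime_snd pa)) (ptime_fst pa)) (ptime_forward_step
  pl (ptime_snd pa)).
Qed.

Lemma backward_step_fst cost G f :
  enc_size (map fst (@backward_step _ _ _ block_succ cost G f)) <= enc_size (map fst f.2).
Proof.
rewrite /backward_step; elim: f.2 => // tp tab IH /=.
rewrite map_cat -map_comp; have [_ [_ sz1]] := bestP cost tp.2 (completions block_succ f.1 tp.1 G).
case: (best _ _ _) sz1 => [|s [|//]] _ /=; rewrite !enc_size_cons.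
  exact: leq_trans IH (leqW (leq_addl _ _)).
by rewrite ltnS leq_add2l; exact: IH.
Qed.

Theorem ptime_dp : pt D (fun k x => dp block_succ block_final (bcost k) (t0 k x) (layers k x)).
Proof.
have pfw := ptime_forward; have pft := ptime_final_table (ptime_snd pfw).
have okG k x : D k x -> forall pre post,
  (forward block_succ (t0 k x) (layers k x)).1 = pre ++ post ->
   exists ls1 ls2, [/\ layers k x = ls1 ++ ls2, stack_ok block_succ (t0 k x) post ls1,
     backward_ok block_succ block_final (bcost k) (t0 k x) ls1 ls2 (foldl (backward_step
       block_succ (bcost k))
       (final_table block_final (forward block_succ (t0 k x) (layers k x)).2) pre) & size ls2 =
         size pre].
  move=> Dx pre post E; have [Fok Sok] := forwardP block_succ (t0 k x) (layers k x).
  apply: backward_ok_prefix; last exact: final_table_ok.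
  - by move=> ls1 ls2 t p p' s s' lE W1 W2 C1 C2; exact: (exchange Dx lE W1 W2 C1 C2).
  - by rewrite -E.
apply: (ptime_foldl (st := fun k x =>
  backward_step block_succ (bcost k)) ((((true, ([::], [::])) : blayer), [::]) : blayer * table)
   (ptime_fst pfw) pft).
- have [c1 H1] := ptime_out pfw; have [c2 H2] := ptime_out player; have [c3 H3] := ptime_out pft.
  apply: pbounded_le (_ : pbounded _ (fun k _ =>
    (((msize k).+2 ^ c1 + (msize k).+2 ^ c3) * ((msize k).+2 ^ c2).+2))) _.
    by do ![apply: pboundedS | apply: pboundedM | apply: pboundedD];
      [exists c1 | exists c3 | exists c2].
  move=> k [x pre] [/= Dx [post E]].
  have [ls1 [ls2 [lE _ [Gs _] _]]] := okG k x Dx pre post E.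
  apply: leq_trans (enc_size_table (b := (msize k).+2 ^ c2) _) _ => [t p tp|].
    have [_ [u Wu _] _] := Gs t p tp; apply: leq_trans (walk_enc_size Wu) _.
    apply: leq_trans (H2 k x Dx); rewrite lE.
    by rewrite -ltnS enc_size_cat -addn1 addnC leq_add2r enc_size_gt0.
  rewrite leq_mul2r; apply/orP; right.
  case/lastP: pre E {Gs} => [|pre f] E.
    by apply: leq_trans (leq_trans (enc_size_map_fst _) (H3 k x Dx)) (leq_addl _ _).
  rewrite foldl_rcons; apply: leq_trans (backward_step_fst _ _ _) _.
  apply: leq_trans (enc_size_map_fst _) _; apply: leq_trans _ (leq_addr _ _).
  apply: leq_trans _ (H1 k x Dx); rewrite [forward _ _ _]surjective_pairing enc_size_pair.
  have : enc_size f < enc_size (forward block_succ (t0 k x) (layers k x)).1.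
    by apply: enc_size_mem; rewrite E cat_rcons; apply/List.in_app_iff; right; left.
  move=> lef; apply: leq_trans (leq_trans (ltnW _) (ltnW lef)) (leqW (leq_addr _ _)).
  by rewrite [X in _ < enc_size X]surjective_pairing enc_size_pair ltnS leq_addl.
move=> sDB; have pz := ptime_id ev cp sDB; have pa := ptime_snd (ptime_snd pz);
  have pl := ptime_fst (ptime_snd pz).
apply: (ptime_backward_step pa pl) => k [x [f G]] t p s [/= Dx [pre [post [E GE]]]] tp sc.
have [ls1 [ls2 [lE [ls' [ls1E Fok _]] Gok _]]] := okG k x Dx pre (f :: post) E.
rewrite catrevE; apply: (complete_feas Dx); subst ls1.
rewrite /= in GE tp sc *; subst G.
exact: (completions_complete lE Fok Gok tp sc).
Qed.
End Dp.
End Ptime.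
End BlockProgram.

Local Open Scope ring_scope.

(** * Vectors as lists and the number of states *)

Definition entries T n (x : 'cV[T]_n) : seq T := [seq x i 0 | i <- enum 'I_n].

Lemma size_entries T n (x : 'cV[T]_n) : size (entries x) = n.
Proof. by rewrite size_map size_enum_ord. Qed.

Lemma nth_entries T n (x : 'cV[T]_n) d (i : 'I_n) : nth d (entries x) i = x i 0.
Proof. by rewrite (nth_map i) ?size_enum_ord // nth_ord_enum. Qed.

Lemma enc_col_entries (T : encType) n (x : 'cV[T]_n) : enc_col enc x = enc (entries x).
Proof. by rewrite /enc_col /= /entries -map_comp. Qed.

Lemma flatten_iota k n :
  flatten [seq [seq (t * k + c)%N | c <- iota 0 k] | t <- iota 0 n] = iota 0 (n * k).
Proof.
elim: n => [|n IH]; first by rewrite mul0n.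
rewrite -[in LHS]addn1 iotaD map_cat flatten_cat IH /= cats0 mulSnr iotaD !add0n.
by congr (_ ++ _); have := iotaDl (n * k) 0 k; rewrite addn0 => ->.
Qed.

Lemma enum_block_index m N k : enum 'I_(nfold_dim m N k) =
  [seq block_index (inl c) | c <- enum 'I_m] ++
  flatten [seq [seq block_index (inr (t, c)) | c <- enum 'I_k] | t <- enum 'I_N].
Proof.
apply: (inj_map val_inj); rewrite val_enum_ord map_cat map_flatten iotaD; congr (_ ++ _).
  by rewrite -map_comp -val_enum_ord; apply: eq_map => c.
have -> : iota (0 + m) (\sum_(i < N) k) =
    [seq (m + j)%N | j <- flatten [seq [seq (t * k + c)%N | c <- iota 0 k] | t <- iota 0 N]].
  by rewrite flatten_iota sum_nat_const card_ord add0n -iotaDl addn0.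
have iota_enum (T : Type) n (F : nat -> T) : [seq F i | i <- iota 0 n] = [seq F (\val i) | i <-
  enum 'I_n].
  by rewrite -val_enum_ord -map_comp.
rewrite iota_enum !map_flatten; congr flatten.
rewrite -[LHS]map_comp -[RHS]map_comp; apply: eq_map => t.
rewrite /comp iota_enum -[LHS]map_comp -[RHS]map_comp; apply: eq_map => c /=.
have RE : nat_of_ord (@tagnat.Rank N (fun=> k) t c) = (t * k + c)%N.
  by rewrite tagnat.RankEsum (@big_ord_narrow _ _ _ _ _ (fun=> k) (ltnW (ltn_ord t)))
    sum_nat_const card_ord.
exact: (congr1 (addn m) (esym RE)).
Qed.

Section Blocks.
Variables (T : Type) (m N k : nat).
Implicit Types x : 'cV[T]_(nfold_dim m N k).

Definition head_part x : seq T := [seq x (block_index (inl c)) 0 | c <- enum 'I_m].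
Definition block_part x (t : 'I_N) : seq T := [seq x (block_index (inr (t, c))) 0 | c <- enum 'I_k].

Lemma entries_blocks x : entries x = head_part x ++ flatten [seq block_part x t | t <- enum 'I_N].
Proof.
rewrite /entries enum_block_index map_cat map_flatten; congr (_ ++ flatten _).
  by rewrite -[LHS]map_comp.
by rewrite -[LHS]map_comp; apply: eq_map => t; rewrite /comp -[LHS]map_comp.
Qed.

Lemma take_entries x : take m (entries x) = head_part x.
Proof. by rewrite entries_blocks take_size_cat // size_map size_enum_ord. Qed.

Lemma reshape_entries x : reshape (nseq N k) (drop m (entries x)) = [seq block_part x t | t <-
  enum 'I_N].
Proof.
rewrite entries_blocks drop_size_cat; last by rewrite size_map size_enum_ord.
rewrite -[RHS]flattenK; congr (reshape _ _).
rewrite /shape -map_comp -[in LHS](size_enum_ord N); elim: (enum 'I_N) => //= t s ->.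
by rewrite size_map size_enum_ord.
Qed.
End Blocks.

Definition rows m n (M : 'M[int]_(m, n)) : seq (seq int) :=
  [seq [seq M r c | c <- enum 'I_n] | r <- enum 'I_m].

Lemma seq_dot_map (I : Type) (s : seq I) (f w : I -> int) :
  seq_dot (map f s) (map w s) = \sum_(c <- s) f c * w c.
Proof. by elim: s => [|c s IH]; rewrite ?big_nil //= big_cons IH. Qed.

Lemma seq_residual_map m n (M : 'M[int]_(m, n)) (rho : 'I_m -> int) (w : 'I_n -> int) :
  seq_residual (rows M) [seq rho r | r <- enum 'I_m] [seq w c | c <- enum 'I_n] =
  [seq rho r - \sum_c M r c * w c | r <- enum 'I_m].
Proof.
rewrite /rows; elim: (enum 'I_m) => //= r s ->; rewrite seq_dot_map.
by rewrite big_enum.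
Qed.

Lemma nseq_map m : nseq m (0 : int) = [seq 0 | r <- enum 'I_m].
Proof. by rewrite -[in LHS](size_enum_ord m); elim: (enum 'I_m) => //= r s ->. Qed.

Lemma eq_map_enum m (f g : 'I_m -> int) :
  [seq f r | r <- enum 'I_m] = [seq g r | r <- enum 'I_m] <-> forall r, f r = g r.
Proof.
split=> [E r|E]; last exact: eq_map.
have nthE (h : 'I_m -> int) : nth 0 [seq h r | r <- enum 'I_m] r = h r.
  by rewrite (nth_map r) ?size_enum_ord // nth_ord_enum.
by rewrite -nthE E nthE.
Qed.

Lemma mem_enum_box n (rs : seq (seq int)) v : size rs = n ->
  (v \in enum_box n rs) = (size v == n) && all (fun p => p.1 \in p.2) (zip v rs).
Proof.
elim: n rs v => [|n IH] rs v.
  by case: rs => // _; case: v.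
case: rs => [//|r rs] [msize]; apply/flatten_mapP/andP => /= [[x xr /mapP[v' v'b ->]]|[]].
  by move: v'b; rewrite IH // => /andP[/eqP sv al] /=; rewrite sv xr.
case: v => [//|x v'] /=; rewrite eqSS => sv /andP[xr al].
by exists x => //; apply/mapP; exists v' => //; rewrite IH // sv.
Qed.

Lemma enum_box_enum n (F : 'I_n -> seq int) v :
  v \in enum_box n [seq F c | c <- enum 'I_n] <->
  exists2 g : 'I_n -> int, v = [seq g c | c <- enum 'I_n] & forall c, g c \in F c.
Proof.
rewrite mem_enum_box; last by rewrite size_map size_enum_ord.
split=> [/andP[/eqP sv al]|[g -> gF]]; last first.
  rewrite size_map size_enum_ord eqxx /=.
  by elim: (enum 'I_n) => //= c s ->; rewrite gF.
exists (fun c => nth 0 v c).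
  apply: (@eq_from_nth _ 0); first by rewrite size_map size_enum_ord.
  move=> i; rewrite sv => lt; rewrite (nth_map (Ordinal lt)) ?size_enum_ord //.
  by rewrite (nth_ord_enum (Ordinal lt) (Ordinal lt) : nth _ _ i = _).
move=> c; have := all_nthP (0, [::]) al c.
rewrite size_zip sv size_map size_enum_ord minnn => /(_ (ltn_ord c)).
rewrite nth_zip /=; last by rewrite sv size_map size_enum_ord.
by rewrite (nth_map c) ?size_enum_ord // nth_ord_enum.
Qed.

Lemma size_enum_box n rs b : (forall r, r \in rs -> size r <= b)%N -> (0 < b)%N ->
  (size (enum_box n rs) <= b ^ n)%N.
Proof.
move=> + b0; elim: n rs => [|n IH] rs H //; rewrite expnS /=.
rewrite size_allpairs leq_mul //; last first.
  by apply: IH => r rr; apply: H; apply: mem_behead.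
by case: rs H => [|r rs] H //=; apply: H; rewrite mem_head.
Qed.

Lemma abs_sub4_le (a b c d : int) (j p q : nat) :
  (`|(a - c)%R| <= j -> `|(b - d)%R| <= p -> p <= q -> `|(a - b - (c - d))%R| <= j + q)%N.
Proof. lia. Qed.

Lemma abs_sub_le (a b : int) (j p q : nat) :
  (`|a| <= j -> `|b| <= p -> p <= q -> `|(a - b)%R| <= j + q)%N.
Proof. lia. Qed.

Lemma abs_box (a b : int) (R : nat) : (`|(a - b)%R| <= R)%N ->
  a = b - R%:Z + `|(a - b + R%:Z)%R|%N%:Z /\ (`|(a - b + R%:Z)%R| < (2 * R).+1)%N.
Proof. lia. Qed.

Section StateCount.
Variables (Ar Br Cr Dr : seq (seq int)) (zA zC : seq int).
Local Notation bsucc := (block_succ Ar Br Cr Dr zA).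
Definition coeff_sum : nat := (sumn (map (fun r => sumn (map absz r)) Cr) + sumn (map (fun r =>
  sumn (map absz r)) Dr))%N.

Lemma seq_dot_diff (r w v : seq int) (K : nat) : (forall c, `|(nth 0 w c - nth 0 v c)%R| <= K)%N ->
  (`|(seq_dot r w - seq_dot r v)%R| <= sumn (map absz r) * K)%N.
Proof.
elim: r w v => [|a r IH] w v H //=.
rewrite mulnDl.
have -> : (a * head 0 w + seq_dot r (behead w) - (a * head 0 v + seq_dot r (behead v)))%R =
  (a * (nth 0 w 0 - nth 0 v 0) + (seq_dot r (behead w) - seq_dot r (behead v)))%R.
  by rewrite -!nth0; ring.
have h1 : (`|seq_dot r (behead w) - seq_dot r (behead v)| <= sumn (map absz r) * K)%N.
  by apply: IH => c; rewrite !nth_behead.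
have h2 : (`|(a * (nth 0 w 0 - nth 0 v 0))%R| <= `|a| * K)%N by rewrite abszM leq_mul.
lia.
Qed.

Lemma nth_seq_residual rws rho w i : (i < size rws)%N ->
  nth 0 (seq_residual rws rho w) i = nth 0 rho i - seq_dot (nth [::] rws i) w.
Proof.
elim: rws rho i => [|r rws IH] rho [|i] //= lt.
by rewrite IH // nth_behead.
Qed.

Lemma size_seq_residual rws rho w : size (seq_residual rws rho w) = size rws.
Proof. by elim: rws rho => //= r rws IH rho; rewrite IH. Qed.

Hypothesis sizeCD : size Cr = size Dr.

Lemma row_coeff (b : bool) i : (sumn (map absz (nth [::] (if b then Cr else Dr) i)) <= coeff_sum)%N.
Proof.
have H (s : seq (seq int)) : (sumn (map absz (nth [::] s i)) <= sumn (map (fun r =>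
  sumn (map absz r)) s))%N.
  elim: s i => [|r s IH] [|i] //=; first exact: leq_addr.
  exact: leq_trans (IH i) (leq_addl _ _).
rewrite /coeff_sum; have := H Cr; have := H Dr; case: b; lia.
Qed.

Definition lrows (l : blayer) := if l.1 then Cr else Dr.

Lemma block_succ_rho l t w u : (w, u) \in bsucc l t -> u.2 = seq_residual (lrows l) t.2 w.
Proof.
by rewrite /block_succ /lrows; case: l.1 => /mapP[v _ [-> ->]].
Qed.

Lemma block_succ_x l t w u : (w, u) \in bsucc l t -> u.1 = t.1 \/ u.1 \in l.2.1.
Proof.
rewrite /block_succ; case: l.1 => /mapP[v]; first by move=> vl [_ ->]; right.
by rewrite mem_filter => /andP[_ vl] [_ ->]; left.
Qed.

Definition center (ls : seq blayer) (rho : seq int) : seq int :=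
  foldl (fun rho l => seq_residual (lrows l) rho (head [::] l.2.1)) rho ls.

Definition tight (K : nat) (l : blayer) : Prop :=
  forall w v, w \in l.2.1 -> v \in l.2.1 -> forall c, (`|(nth 0 w c - nth 0 v c)%R| <= K)%N.

(** The labels of a layer are close to each other, so every residual is close to
the one obtained from the first label of each layer. *)
Lemma walk_center K (ls : seq blayer) t ws u beta j : (forall l, l \in ls -> tight K l) ->
  walk bsucc ls t ws u ->
  (forall i, i < size Cr -> `|(nth 0 t.2 i - nth 0 beta i)%R| <= j)%N ->
  (forall i, i < size Cr -> `|(nth 0 u.2 i - nth 0 (center ls beta) i)%R| <= j + size ls *
    (coeff_sum * K))%N.
Proof.
elim: ls t ws beta j => [|l ls IH] t [|w ws] beta j // cl /=.
  by move=> -> H i lt; rewrite mul0n addn0; apply: H.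
move=> [v Sv Wv] H i lt; rewrite mulSn addnA.
apply: (IH v ws) => // [l' l'ls|{lt} i' lt].
  by apply: cl; rewrite inE l'ls orbT.
have sl : (i' < size (lrows l))%N by rewrite /lrows; case: l.1; rewrite -?sizeCD.
rewrite (block_succ_rho Sv) !nth_seq_residual //.
have wl := block_succ_label Sv; have vl : head [::] l.2.1 \in l.2.1 by case: (l.2.1) wl => //= *;
  rewrite mem_head.
have h := seq_dot_diff (nth [::] (lrows l) i') (cl l (mem_head _ _) _ _ wl vl).
have h' : (sumn (map absz (nth [::] (lrows l) i')) * K <= coeff_sum * K)%N.
  by rewrite leq_mul2r row_coeff orbT.
exact: abs_sub4_le (H i' lt) h h'.
Qed.

Lemma walk_x ls t ws u : walk bsucc ls t ws u ->
  u.1 = t.1 \/ u.1 \in flatten [seq l.2.1 | l : blayer <- ls].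
Proof.
elim: ls t ws => [|l ls IH] t [|w ws] //=; first by move=> ->; left.
move=> [v Sv /IH[->|]]; last by rewrite mem_cat => ->; right; rewrite orbT.
by case: (block_succ_x Sv) => [->|h]; [left | right; rewrite mem_cat h].
Qed.

Lemma walk_size_rho ls t ws u : walk bsucc ls t ws u -> size t.2 = size Cr -> size u.2 = size Cr.
Proof.
elim: ls t ws => [|l ls IH] t [|w ws] //=; first by move=> ->.
move=> [v Sv Wv] _; apply: IH Wv _; rewrite (block_succ_rho Sv) size_seq_residual /lrows.
by case: l.1.
Qed.

Lemma abs_lt_enc_size (z : int) : (`|z| < 2 ^ enc_size z)%N.
Proof. by apply: leq_trans (int_size_gt z) _; rewrite leq_pexp2l // leq_pred. Qed.

Lemma nth_lt_enc_size (w : vect) c : (`|nth 0%R w c| < 2 ^ enc_size w)%N.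
Proof.
have [lt|ge] := ltnP c (size w); last by rewrite nth_default // expn_gt0.
apply: leq_trans (abs_lt_enc_size _) _; rewrite leq_pexp2l //; apply: ltnW.
by apply: enc_size_mem; apply/In_mem/mem_nth.
Qed.

Lemma walk_rho_bits (ls : seq blayer) t ws u E j : (forall (l : blayer) (w : vect),
  l \in ls -> w \in l.2.1 -> enc_size w <= E)%N ->
  walk bsucc ls t ws u ->
  (forall i, i < size Cr -> `|nth 0%R t.2 i| <= j)%N ->
  (forall i, i < size Cr -> `|nth 0%R u.2 i| <= j + size ls * (coeff_sum * 2 ^ E))%N.
Proof.
elim: ls t ws j => [|l ls IH] t [|w ws] j // HE /=.
  by move=> -> H i lt; rewrite mul0n addn0; apply: H.
move=> [v Sv Wv] H i lt; rewrite mulSn addnA.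
apply: (IH v ws) => // [l' w' l'ls|{lt} i' lt].
  by apply: HE; rewrite inE l'ls orbT.
have sl : (i' < size (lrows l))%N by rewrite /lrows; case: l.1; rewrite -?sizeCD.
rewrite (block_succ_rho Sv) nth_seq_residual //.
have wl := block_succ_label Sv; have Ew := HE l w (mem_head _ _) wl.
have hw c : (`|(nth 0 w c - nth 0 [::] c)%R| <= 2 ^ E)%N.
  rewrite nth_nil subr0; apply: leq_trans (ltnW (nth_lt_enc_size _ _)) _.
  by rewrite leq_pexp2l.
have h := seq_dot_diff (nth [::] (lrows l) i') hw.
have h0 r : seq_dot r [::] = 0 by elim: r => //= a r ->; rewrite mulr0.
rewrite h0 subr0 in h.
have h' : (sumn (map absz (nth [::] (lrows l) i')) * 2 ^ E <= coeff_sum * 2 ^ E)%N.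
  by rewrite leq_mul2r row_coeff orbT.
exact: abs_sub_le (H i' lt) h h'.
Qed.

Definition state_bits n E := (n + coeff_sum + E + E).+4%N.

(** The states of a table are distinct, and they lie in the product of the
possible shared blocks and a cube around [center]; [state_bits] bounds the
length of the residuals. *)
Lemma forward_states_bound (ls : seq blayer) b0 K E tab :
  forward_ok bsucc ([::], b0) ls tab ->
  (forall l, l \in ls -> tight K l) -> size b0 = size Cr ->
  (forall (l : blayer) (w : vect),
    l \in ls -> w \in l.2.1 -> enc_size w <= E)%N -> (enc_size b0 <= E)%N ->
  forall R, R = (size ls * (coeff_sum * K))%N ->
  (enc_size [seq tp.1 | tp <- tab] <=
   ((size (flatten [seq l.2.1 | l : blayer <- ls])).+1 * (2 * R).+1 ^ size Cr *
     (E.+1 + (size Cr * (state_bits (size ls) E).+1).+2).+3).+1)%N.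
Proof.
move=> [Fs _ Ut] cl sb HE bE R RE.
have reach t : t \in [seq tp.1 | tp <- tab] -> exists ws, walk bsucc ls ([::], b0) ws t.
  by case/mapP=> [[t' p] /Fs W ->]; exists (rev p).
pose xs := [::] :: flatten [seq l.2.1 | l : blayer <- ls].
pose beta := center ls b0.
have [n nE] : exists n, n = (2 * R).+1 by eexists.
pose rhos := enum_box (size Cr) [seq [seq nth 0 beta r - R%:Z + i%:Z | i <- iota 0 n] | r <- iota
  0 (size Cr)].
have cnt : (size [seq tp.1 | tp <- tab] <= (size (flatten [seq l.2.1 | l : blayer <- ls])).+1 *
  (2 * R).+1 ^ size Cr)%N.
  apply: (@leq_trans (size [seq (x, rho) | x <- xs, rho <- rhos])).
    apply: uniq_leq_size => // t /reach[ws W]; apply/allpairsP; exists t; split; last by case: (t).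
    - by rewrite /xs inE; case: (walk_x W) => [->|->]; rewrite ?eqxx ?orbT.
    - rewrite mem_enum_box ?size_map ?size_iota // (walk_size_rho W sb) eqxx /=.
      apply/(all_nthP (0, [::])) => i;
        rewrite size_zip (walk_size_rho W sb) size_map size_iota minnn => lt.
      rewrite nth_zip /=; last by rewrite (walk_size_rho W sb) size_map size_iota.
      rewrite (nth_map 0%N) ?size_iota // nth_iota // add0n.
      have H0 i' : (i' < size Cr -> `|(nth 0 (([::],
        b0) : state).2 i' - nth 0 b0 i')%R| <= 0)%N by rewrite subrr.
      have := walk_center cl W H0 lt; rewrite add0n -RE -/beta => h.
      have [E1 E2] := abs_box h; apply/mapP;
        exists `|(nth 0 t.2 i - nth 0 beta i + R%:Z)%R|%N => //.
      by rewrite mem_iota nE add0n.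
  rewrite size_allpairs /= leq_mul // -nE size_enum_box ?nE // => r /mapP[i _ ->].
  by rewrite size_map size_iota.
apply: leq_trans (enc_size_seq_le (b :=
  (E.+1 + (size Cr * (state_bits (size ls) E).+1).+2).+2) _) _; last first.
  by rewrite ltnS leq_mul2r cnt orbT.
move=> t /In_mem/reach[ws W]; rewrite [t]surjective_pairing enc_size_pair !ltnS.
have ex : (enc_size t.1 <= E.+1)%N.
  case: (walk_x W) => [->|/flatten_mapP[l ll /(HE _ _ ll)/leqW //]]; by rewrite enc_size_nil.
have er : (enc_size t.2 <= (size Cr * (state_bits (size ls) E).+1).+1)%N.
  rewrite -(walk_size_rho W sb); apply: enc_size_seq_le => z /In_mem/(nthP 0)[i lt <-].
  rewrite (walk_size_rho W sb) in lt.
  have H0 i' : (i' < size Cr -> `|nth 0%R (([::], b0) : state).2 i'| <= 2 ^ E)%N.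
    move=> _; apply: leq_trans (ltnW (nth_lt_enc_size _ _)) _; by rewrite leq_pexp2l.
  have h := walk_rho_bits HE W H0 lt.
  apply: leq_trans (int_size_le (e := (size ls + coeff_sum + E + E).+2) _) _;
    last by rewrite /state_bits.
  apply: leq_ltn_trans h _.
  have p1 := ltn_expl (size ls) (isT : 1 < 2)%N; have p2 := ltn_expl coeff_sum (isT : 1 < 2)%N.
  have p3 : (0 < 2 ^ E)%N by rewrite expn_gt0.
  have -> : (2 ^ (size ls + coeff_sum + E + E).+2 = 4 * (2 ^ size ls * (2 ^ coeff_sum * 2 ^ E)) *
    2 ^ E)%N.
    by rewrite !expnS !expnD !mulnA.
  have : (size ls * (coeff_sum * 2 ^ E) <= 2 ^ size ls * (2 ^ coeff_sum * 2 ^ E))%N.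
    by rewrite leq_mul ?leq_mul // ltnW.
  have : (0 < 2 ^ size ls * (2 ^ coeff_sum * 2 ^ E))%N by rewrite !muln_gt0 !expn_gt0.
  have : (2 ^ E <= 2 ^ size ls * (2 ^ coeff_sum * 2 ^ E))%N.
    by rewrite mulnA leq_pmull // muln_gt0 !expn_gt0.
  move: (2 ^ size ls * (2 ^ coeff_sum * 2 ^ E))%N (size ls * (coeff_sum * 2 ^ E))%N => P S h1 h2 h3.
  have : (4 * P <= 4 * P * 2 ^ E)%N by rewrite leq_pmulr.
  by lia.
by lia.
Qed.
End StateCount.

(** * Complete paths and feasible points *)

Lemma zip_map_same (I S T : Type) (s : seq I) (f : I -> S) (g : I -> T) :
  zip (map f s) (map g s) = [seq (f i, g i) | i <- s].
Proof. by elim: s => //= i s ->. Qed.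

Lemma all2_map_enum N (S : Type) (P : 'I_N -> S -> bool) (Y : 'I_N -> S) :
  (forall t, P t (Y t)) -> all2 P (enum 'I_N) (map Y (enum 'I_N)).
Proof. by move=> H; elim: (enum 'I_N) => //= t s ->; rewrite H. Qed.

Lemma all2_enum N (S : Type) (P : 'I_N -> S -> bool) (d : S) ws :
  all2 P (enum 'I_N) ws ->
  ws = [seq nth d ws t | t : 'I_N <- enum 'I_N] /\ forall t : 'I_N, P t (nth d ws t).
Proof.
rewrite all2E size_enum_ord => /andP[/eqP msize al].
split.
  apply: (@eq_from_nth _ d); first by rewrite size_map size_enum_ord.
  move=> i; rewrite -msize => lt; rewrite (nth_map (Ordinal lt)) ?size_enum_ord //.
  by rewrite (nth_ord_enum (Ordinal lt) (Ordinal lt) : nth _ _ i = _).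
move=> t; have := all_nthP (t, d) al t;
  rewrite size_zip size_enum_ord -msize minnn => /(_ (ltn_ord t)).
rewrite nth_zip ?size_enum_ord //=.
by rewrite (nth_ord_enum t t).
Qed.

Definition offsets (K : nat) : seq int := [seq i%:Z - K%:Z | i <- iota 0 (2 * K).+1].

Definition window (K : nat) (q : option int * (option int * int)) : seq int :=
  [seq z <- [seq q.2.2 + o | o <- offsets K] | lower_ok q.1 z && upper_ok q.2.1 z].

Lemma mem_window K q z :
  (z \in window K q) = [&& lower_ok q.1 z, upper_ok q.2.1 z & `|z - q.2.2| <= K%:Z].
Proof.
rewrite mem_filter -andbA; do 2 congr andb; apply/mapP/idP => [[a /mapP[i]]|le].
  by rewrite mem_iota => /andP[_ lt] -> ->; lia.
exists (z - q.2.2); last by ring.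
have [E1 E2] := @abs_box (z - q.2.2) 0 K ltac:(lia).
apply/mapP; exists `|(z - q.2.2 - 0 + K%:Z)%R|%N; first by rewrite mem_iota; lia.
lia.
Qed.

Lemma lbP (o : option int) (z : int) : lower_bounded o z <-> lower_ok o z.
Proof. by case: o => [a|] //=; rewrite intz. Qed.

Lemma ubP (o : option int) (z : int) : upper_bounded o z <-> upper_ok o z.
Proof. by case: o => [a|] //=; rewrite intz. Qed.

Section Link.
Variables (dA dC nA nB : nat).
Variables (A : 'M[int]_(dA, nA)) (B : 'M[int]_(dA, nB)).
Variables (C : 'M[int]_(dC, nB)) (D : 'M[int]_(dC, nA)).
Local Notation zA := (nseq dA (0 : int)).
Local Notation zC := (nseq dC (0 : int)).
Local Notation bsucc := (block_succ (rows A) (rows B) (rows C) (rows D) zA).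
Local Notation bfin := (block_final zC).

Lemma feasible_blocks N (l u : 'cV[option int]_(nfold_dim nB N nA))
    (b : 'cV[int]_(nfold_dim dC N dA)) (z : 'cV[int]_(nfold_dim nB N nA)) :
  feasible (nfold4 A B C D N) b l u z <->
  [/\ forall r, \sum_c C r c * z (block_index (inl c)) 0 +
        \sum_t \sum_c D r c * z (block_index (inr (t, c))) 0 = b (block_index (inl r)) 0,
      forall t r, \sum_c B r c * z (block_index (inl c)) 0 +
        \sum_c A r c * z (block_index (inr (t, c))) 0 = b (block_index (inr (t, r))) 0
    & forall i, lower_ok (l i 0) (z i 0) && upper_ok (u i 0) (z i 0)].
Proof.
have eL r : (map_mx intr (nfold4 A B C D N) *m z) (block_index (inl r)) 0 =
    \sum_c C r c * z (block_index (inl c)) 0 + \sum_t \sum_c D r c * z (block_index (inr (t, c))) 0.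
  rewrite nfold4_mulE sum_column; congr (_ + _).
    by apply: eq_bigr => c _; rewrite nfold4_linking intz.
  by apply: eq_bigr => t _; apply: eq_bigr => c _; rewrite nfold4_linking intz.
have eU t r : (map_mx intr (nfold4 A B C D N) *m z) (block_index (inr (t, r))) 0 =
    \sum_c B r c * z (block_index (inl c)) 0 + \sum_c A r c * z (block_index (inr (t, c))) 0.
  rewrite nfold4_mulE; under eq_bigr do rewrite nfold4_two_stage.
  rewrite (two_stageE A B (fun j => z (block_index j) 0)).
  by congr (_ + _); apply: eq_bigr => c _; rewrite intz.
have eB i : (lower_bounded (l i 0) (z i 0) /\ upper_bounded (u i 0) (z i 0)) <->
    lower_ok (l i 0) (z i 0) && upper_ok (u i 0) (z i 0).
  split=> [[/lbP -> /ubP -> //]|/andP[/lbP h1 /ubP h2]]; by split.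
rewrite /feasible map_intr_id; split=> [[E bd]|[HL HU bd]].
  split=> [r|t r|i]; last exact/eB.
    by rewrite -eL map_intr_id E map_intr_id.
  by rewrite -eU map_intr_id E map_intr_id.
split; last by move=> i; apply/eB.
apply/matrixP => i j; rewrite (ord1 j).
have [inv _ Kinv] := block_index_bij dC N dA; rewrite -(Kinv i).
rewrite -[X in (X *m _) _ _]map_intr_id [RHS]mxE intz.
by case: (inv i) => [r|[t r]]; rewrite ?eL ?eU.
Qed.

Section Layers.
Variables (N : nat) (b : 'cV[int]_(nfold_dim dC N dA)) (rv : 'cV[seq int]_(nfold_dim nB N nA)).

Definition block_layer t : blayer := (false, (enum_box nA (block_part rv t), block_part b t)).
Definition block_layers : seq blayer :=
  (true, (enum_box nB (head_part rv), [::])) :: [seq block_layer t | t <- enum 'I_N].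
Definition block_start : state := ([::], head_part b).

Lemma walk_blocksE s x rho ws u :
  walk bsucc (map block_layer s) (x, rho) ws u <->
  all2 (fun t w => (w \in enum_box nA (block_part rv t)) &&
                   (seq_residual (rows A) (seq_residual (rows B) (block_part b t) x) w == zA)) s
                     ws /\
  u = (x, foldl (seq_residual (rows D)) rho ws).
Proof.
elim: s rho ws => [|t s IH] rho [|w ws] /=; try by split=> [<-|[]//] || by split=> // -[].
split=> [[v Sv Wv]|[/andP[/andP[wb /eqP wA] al] uE]].
  move: Sv; rewrite /block_succ /= => /mapP[w']; rewrite mem_filter => /andP[wA wb] [E1 E2];
    subst w' v.
  have [al ->] := proj1 (IH _ _) Wv.
  by rewrite wA wb.
exists (x, seq_residual (rows D) rho w); last by apply/IH.
by rewrite /block_succ /=; apply/mapP; exists w => //; rewrite mem_filter wA eqxx.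
Qed.

Lemma foldl_seq_residual (rho : 'I_dC -> int) (h : 'I_N -> 'I_nA -> int) s :
  foldl (seq_residual (rows D)) [seq rho r | r <- enum 'I_dC] [seq [seq h t c | c <- enum 'I_nA]
    | t <- s] =
  [seq rho r - \sum_(t <- s) \sum_c D r c * h t c | r <- enum 'I_dC].
Proof.
elim: s rho => [|t s IH] rho /=.
  by apply: eq_map => r; rewrite big_nil subr0.
rewrite seq_residual_map IH; apply: eq_map => r; rewrite big_cons; ring.
Qed.

Definition pieces (z : 'cV[int]_(nfold_dim nB N nA)) : seq vect :=
  head_part z :: [seq block_part z t | t <- enum 'I_N].

Lemma flatten_pieces z : flatten (pieces z) = entries z.
Proof. by rewrite entries_blocks. Qed.

(** Complete paths are feasible points in the window: the residuals of a layer test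
the rows of its block, and the linking residual must end at 0. *)
Lemma complete_pieces (z : 'cV[int]_(nfold_dim nB N nA)) :
  (forall r, \sum_c C r c * z (block_index (inl c)) 0 +
        \sum_t \sum_c D r c * z (block_index (inr (t, c))) 0 = b (block_index (inl r)) 0) ->
  (forall t r, \sum_c B r c * z (block_index (inl c)) 0 +
        \sum_c A r c * z (block_index (inr (t, c))) 0 = b (block_index (inr (t, r))) 0) ->
  (forall i, z i 0 \in rv i 0) ->
  complete bsucc bfin block_layers block_start (pieces z).
Proof.
move=> HL HU zr.
exists (head_part z, foldl (seq_residual (rows D)) (seq_residual (rows C) (head_part b)
  (head_part z)) [seq block_part z t | t <- enum 'I_N]).
  exists (head_part z, seq_residual (rows C) (head_part b) (head_part z)).
    rewrite /block_succ /=; apply/mapP; exists (head_part z) => //.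
    by apply/enum_box_enum; exists (fun c => z (block_index (inl c)) 0).
  apply/walk_blocksE; split=> //; apply: all2_map_enum => t; apply/andP; split.
    by apply/enum_box_enum; exists (fun c => z (block_index (inr (t, c))) 0).
  rewrite /block_part /head_part !seq_residual_map nseq_map; apply/eqP/eq_map_enum => r.
  by rewrite -HU -addrA -opprD subrr.
rewrite /block_final /= /head_part /block_part seq_residual_map foldl_seq_residual nseq_map.
apply/eqP/eq_map_enum => r; by rewrite -HL big_enum -addrA -opprD subrr.
Qed.

Lemma complete_inv ws : complete bsucc bfin block_layers block_start ws ->
  exists z : 'cV[int]_(nfold_dim nB N nA), [/\ ws = pieces z,
   forall r, \sum_c C r c * z (block_index (inl c)) 0 +
        \sum_t \sum_c D r c * z (block_index (inr (t, c))) 0 = b (block_index (inl r)) 0,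
   forall t r, \sum_c B r c * z (block_index (inl c)) 0 +
        \sum_c A r c * z (block_index (inr (t, c))) 0 = b (block_index (inr (t, r))) 0
   & forall i, z i 0 \in rv i 0].
Proof.
case=> u; case: ws => [//|w ws] [v Sv Wv] fu.
move: Sv; rewrite /block_succ /= => /mapP[w' w'b [E Ev]]; subst w' v.
have [g wE gr] := proj1 (enum_box_enum _ _) w'b.
have [al uE] := proj1 (walk_blocksE _ _ _ _ _) Wv.
have [wsE wsP] := all2_enum [::] al.
have hP (t : 'I_N) : exists h : 'I_nA -> int, nth [::] ws t = [seq h c | c <- enum 'I_nA] /\
     forall c, h c \in rv (block_index (inr (t, c))) 0.
  by have /andP[/enum_box_enum[h hE hr] _] := wsP t; exists h.
have [h hE] := fin_all_exists hP.
have [inv invK Kinv] := block_index_bij nB N nA.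
pose z : 'cV[int]_(nfold_dim nB N nA) :=
  \col_i match inv i with inl c => g c | inr (t, c) => h t c end.
have zl c : z (block_index (inl c)) 0 = g c by rewrite mxE invK.
have zr t c : z (block_index (inr (t, c))) 0 = h t c by rewrite mxE invK.
have hpz : head_part z = w by rewrite wE; apply: eq_map => c; rewrite zl.
have bpz (t : 'I_N) : block_part z t = nth [::] ws t.
  by have [-> _] := hE t; apply: eq_map => c; rewrite zr.
have wsz : ws = [seq block_part z t | t <- enum 'I_N].
  by rewrite {1}wsE; apply: eq_map => t; rewrite bpz.
exists z; split.
- by rewrite /pieces hpz -wsz.
- move=> r; move: fu; rewrite uE /block_final /= wsz -hpz /head_part /block_part seq_residual_map
  foldl_seq_residual nseq_map.
  by move=> /eqP/eq_map_enum/(_ r)/eqP; rewrite big_enum -addrA -opprD subr_eq0 => /eqP.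
- move=> t r; have /andP[_] := wsP t;
  rewrite -bpz -hpz /block_part /head_part !seq_residual_map nseq_map.
  by move=> /eqP/eq_map_enum/(_ r)/eqP; rewrite -addrA -opprD subr_eq0 => /eqP.
- move=> i; rewrite -(Kinv i); case: (inv i) => [c|[t c]]; first by rewrite zl.
  by rewrite zr; have [_ ->] := hE t.
Qed.

End Layers.
End Link.

(** * The algorithm and its running time *)

Lemma enum_box_close n (F : 'I_n -> seq int) (K : nat) :
  (forall i a b, a \in F i -> b \in F i -> `|(a - b)%R| <= K)%N ->
  forall w v, w \in enum_box n [seq F c | c <- enum 'I_n] ->
  v \in enum_box n [seq F c | c <- enum 'I_n] ->
  forall c, (`|(nth 0 w c - nth 0 v c)%R| <= K)%N.
Proof.
move=> H w v /enum_box_enum[g wE gF] /enum_box_enum[h vE hF] c.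
have [lt|ge] := ltnP c n; last first.
  have sw : (size w <= c)%N by rewrite wE size_map size_enum_ord.
  have sv : (size v <= c)%N by rewrite vE size_map size_enum_ord.
  by rewrite (nth_default 0 sw) (nth_default 0 sv) subrr.
have nthE (f : 'I_n -> int) : nth 0 [seq f c | c <- enum 'I_n] c = f (Ordinal lt).
  rewrite (nth_map (Ordinal lt)) ?size_enum_ord //.
  by rewrite (nth_ord_enum (Ordinal lt) (Ordinal lt) : nth _ _ c = _).
by rewrite wE vE !nthE; apply: H (gF _) (hF _).
Qed.

Section SeparableCost.
Variables (R : realType) (n : nat).

(** The offset makes the cost of a concatenation split, also when the first part
is not a whole vector. *)
Fixpoint list_cost (G : nat -> int -> R) (off : nat) (s : seq int) : R :=
  if s is z :: s' then G off z + list_cost G off.+1 s' else 0.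

Lemma list_cost_cat G off s t :
  list_cost G off (s ++ t) = list_cost G off s + list_cost G (off + size s)%N t.
Proof.
elim: s off => [|z s IH] off /=; first by rewrite add0r addn0.
by rewrite IH addSnnS addrA.
Qed.

Lemma list_cost_sum G s : list_cost G 0 s = \sum_(0 <= i < size s) G i (nth 0 s i).
Proof.
suff H off : list_cost G off s = \sum_(0 <= i < size s) G (off + i)%N (nth 0 s i) by exact: H.
elim: s off => [|z s IH] off /=; first by rewrite big_nil.
rewrite big_nat_recl // addn0 /= IH; congr (_ + _).
by apply: eq_bigr => i _; rewrite addSnnS.
Qed.

Lemma separable_list_cost (f : 'cV[R]_n -> R) : separable_convex f ->
  exists G, forall s, size s = n ->
    f (map_mx intr (\col_(i < n) nth 0 s i)) = list_cost G 0 s.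
Proof.
move=> [g [_ fE]].
exists (fun i z => if insub i is Some j then g j z%:~R else 0) => s sn.
rewrite list_cost_sum sn fE big_mkord; apply: eq_bigr => i _.
by rewrite valK !mxE.
Qed.
End SeparableCost.

Section Main.
Variables (R : realType) (dA dC nA nB : nat).
Variables (A : 'M[int]_(dA, nA)) (B : 'M[int]_(dA, nB)).
Variables (C : 'M[int]_(dC, nB)) (D : 'M[int]_(dC, nA)).
Local Notation zA := (nseq dA (0 : int)).
Local Notation zC := (nseq dC (0 : int)).
Local Notation bsucc := (block_succ (rows A) (rows B) (rows C) (rows D) zA).
Local Notation bfin := (block_final zC).

(** What varies between runs; the block matrices are constants. *)
Record instance := Instance {
  iN : nat;
  il : 'cV[option int]_(nfold_dim nB iN nA);
  iu : 'cV[option int]_(nfold_dim nB iN nA);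
  ib : 'cV[int]_(nfold_dim dC iN dA);
  iobj : 'cV[R]_(nfold_dim nB iN nA) -> R;
  ihat : int;
  iev : 'cV[int]_(nfold_dim nB iN nA) -> int;
  icp : rat -> answer rat (nfold_dim nB iN nA) }.

Implicit Types k : instance.

Definition iIP k := @feasible int _ _ (nfold4 A B C D (iN k)) (ib k) (il k) (iu k).
Definition iCP k := @feasible R _ _ (nfold4 A B C D (iN k)) (ib k) (il k) (iu k).

Definition valid k : Prop :=
  [/\ separable_convex (@iobj k),
      forall z, @iIP k z -> `|@iobj k (map_mx intr z)| <= (ihat k)%:~R,
      evaluation_oracle (@iobj k) (@iev k)
    & approx_cont_oracle (@iobj k) (@iCP k) (icp k)].

Definition ireply k : tree := enc_answer enc_rat (icp k 1).

(** Reading the reply of the continuous oracle is charged, so its length counts. *)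
Definition isize k : nat :=
  (input_size (iN k) (il k) (iu k) (ib k) (ihat k) + val_size (ireply k))%N.

Definition iev_graph k := eval_graph (@iev k).
Definition icp_graph k := cont_graph (icp k).

Local Notation pt D F := (ptime isize iev_graph icp_graph D F).
Local Notation pbounded D x := (pbounded isize D x).
Local Notation small D := (small isize D).

Local Notation input_t := (nat * (seq (option int) * (seq (option int) * seq int)))%type.

Definition iinput k : input_t := (iN k, (entries (il k), (entries (iu k), entries (ib k)))).

Definition irelaxed k : seq rat := if icp k 1 is Solution r then entries r else [::].

Definition solved k (p : input_t * seq rat) : Prop :=
  valid k /\ p.1 = iinput k /\ exists r, icp k 1 = Solution r /\ p.2 = entries r.

Lemma enc_size_input k : (enc_size (iinput k) <= (isize k).+2 * 3)%N.
Proof.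
rewrite /iinput !enc_size_pair; have := enc_size_nat (iN k).
have el : val_size (enc_col enc_bound (il k)) = enc_size (entries (il k)).
  by rewrite /enc_size -(enc_col_entries (T := option_encType int_encType)).
have eu : val_size (enc_col enc_bound (iu k)) = enc_size (entries (iu k)).
  by rewrite /enc_size -(enc_col_entries (T := option_encType int_encType)).
have eb : val_size (enc_col VInt (ib k)) = enc_size (entries (ib k)).
  by rewrite /enc_size -(enc_col_entries (T := int_encType)).
rewrite /isize /input_size el eu eb; lia.
Qed.

Lemma small_input : small (fun k x => valid k /\ x = iinput k).
Proof.
apply: pbounded_le (_ : pbounded _ (fun k _ => (isize k).+2 * 3)%N) _ => [|k x [_ ->]].
  by apply: pboundedM (pbounded_cst _ _ _); do 2 apply: pboundedS; apply: pbounded_sz.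
exact: enc_size_input.
Qed.

Lemma small_solved : small solved.
Proof.
apply: pbounded_le (_ : pbounded _ (fun k _ => (isize k).+2 * 3 + isize k + 1)%N) _.
  apply: pboundedD (pbounded_cst _ _ _); apply: pboundedD (pbounded_sz _ _).
  by apply: pboundedM (pbounded_cst _ _ _); do 2 apply: pboundedS; apply: pbounded_sz.
move=> k [x s] [_ [/= -> [r [rE ->]]]]; rewrite enc_size_pair.
have : (enc_size (entries r) <= isize k)%N.
  have -> : enc_size (entries r) = val_size (enc_col enc_rat r).
    by rewrite /enc_size -(enc_col_entries (T := rat_encType)).
  by rewrite /isize /ireply rE /=; lia.
have := enc_size_input k; lia.
Qed.

Definition ieval k (s : vect) : int := @iev k (\col_i nth 0 s i).

(** Feasible points can be arbitrarily long, hence the bound on [s]. *)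
Definition evaluable c k (s : vect) : Prop :=
  [/\ valid k, (enc_size s <= (isize k).+2 ^ c)%N & exists2 z, @iIP k z & s = entries z].

Lemma col_entries n (z : 'cV[int]_n) : \col_i nth 0 (entries z) i = z.
Proof. by apply/matrixP => i j; rewrite (ord1 j) mxE nth_entries. Qed.

(** At feasible points the value is no longer than [ihat k]. *)
Lemma ptime_ieval c : pt (evaluable c) ieval.
Proof.
exists PEval, (fun k s => ((isize k).+2 ^ c + isize k).+1)%N; split.
  by apply: pboundedS; apply: pboundedD (pbounded_sz _ _); exists c.
move=> k s [[_ hat ev _] les [z Iz sE]]; eexists.
  by apply: run_eval; exists z; rewrite sE -(enc_col_entries (T := int_encType)) /ieval col_entries.
rewrite ltnS leq_add //.
have le : (`|@iev k z| <= `|ihat k|)%N.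
  have := hat z Iz; rewrite -ev -intr_norm ler_int => le; lia.
rewrite sE /ieval col_entries /=; apply: leq_trans (int_size_mono le) _.
by rewrite /isize /input_size; lia.
Qed.

Variable e : nat.
Definition radius (p : input_t * seq rat) : nat := (p.1.1.+2 ^ e)%N.

Definition windows (p : input_t * seq rat) : seq (seq int) :=
  [seq window (radius p) q | q <- zip p.1.2.1 (zip p.1.2.2.1 [seq floorq r | r <- p.2])].

Definition layers_of (p : input_t * seq rat) : seq blayer :=
  (true, (enum_box nB (take nB (windows p)), [::])) ::
  [seq (false, (enum_box nA q.1, q.2)) |
    q <- zip (reshape (nseq p.1.1 nA) (drop nB (windows p)))
             (reshape (nseq p.1.1 dA) (drop dC p.1.2.2.2))].

Definition start_of (p : input_t * seq rat) : state := ([::], take dC p.1.2.2.2).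

Lemma ptime_p : pt solved (fun _ p => p).
Proof. exact: ptime_id small_solved. Qed.

Lemma pbounded_iN : pbounded solved (fun _ p => p.1.1).
Proof.
apply: pbounded_le (pbounded_sz _ _) _ => k p [_ [-> _]] /=.
by rewrite /isize /input_size; lia.
Qed.

Lemma ptime_radius : pt solved (fun _ p => (radius p)%:Z).
Proof.
have pN : pt solved (fun _ (p : input_t * seq rat) => (p.1.1)%:Z).
  by apply: (ptime_cast (ptime_fst (ptime_fst ptime_p))).
have p2 := ptime_add pN (ptime_cst _ _ (2 : int) small_solved).
have powE m n : (m%:Z + 2) ^+ n = (m.+2 ^ n)%N%:Z.
  by elim: n => // n IH; rewrite exprS expnS PoszM -IH; congr (_ * _); lia.
by apply: (ptime_eq (ptime_exp e p2)) => k p _; rewrite powE.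
Qed.

Lemma ptime_offsets : pt solved (fun _ p => offsets (radius p)).
Proof.
have pn : pt solved (fun _ p => (2 * radius p).+1).
  apply: (ptime_cast (ptime_add (ptime_mul (ptime_cst _ _ (2 : int) small_solved) ptime_radius)
    (ptime_cst _ _ (1 : int) small_solved))).
  by move=> k p _ /=; congr VInt; lia.
have pb : pbounded solved (fun _ p => (2 * radius p).+1).
  apply: pboundedS; apply: pboundedM (pbounded_cst _ _ _) _; apply: pboundedX;
    do 2 apply: pboundedS; exact: pbounded_iN.
apply: (ptime_map (0%N) (0 : int) (f := fun _ p (i : nat) =>
  i%:Z - (radius p)%:Z) (ptime_iota pn pb)) => sDB.
have pz := ptime_id iev_graph icp_graph sDB.
apply: ptime_sub; first by apply: (ptime_cast (ptime_snd pz)).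
by apply: (ptime_comp ptime_radius (ptime_fst pz)) => k [p i] [].
Qed.

Lemma solved_sizes k p : solved k p ->
  size p.1.2.1 = nfold_dim nB (iN k) nA /\ size (zip p.1.2.2.1 [seq floorq r | r <- p.2]) =
    nfold_dim nB (iN k) nA
  /\ size p.1.2.2.1 = size [seq floorq r | r <- p.2].
Proof.
move=> [_ [-> [r [_ ->]]]] /=.
have -> : size [seq floorq q | q <- entries r] = nfold_dim nB (iN k) nA by rewrite size_map
  size_entries.
by rewrite size_zip !size_entries size_map size_entries minnn.
Qed.

Lemma ptime_windows : pt solved (fun _ p => windows p).
Proof.
have pc : pt solved (fun _ p => [seq floorq r | r <- p.2]).
  apply: (ptime_map (0 : rat) (0 : int) (f := fun _ _ => floorq) (ptime_snd ptime_p)) => sDB.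
  exact: ptime_floorq (ptime_snd (ptime_id _ _ sDB)).
have pzip : pt solved (fun _ p => zip p.1.2.1 (zip p.1.2.2.1 [seq floorq r | r <- p.2])).
  apply: (ptime_zip None (None, 0 : int) (ptime_fst (ptime_snd (ptime_fst ptime_p)))).
    apply: (ptime_zip None (0 : int) (ptime_fst (ptime_snd (ptime_snd (ptime_fst ptime_p)))) pc).
    by move=> k p /solved_sizes[_ [_ ->]].
  by move=> k p /solved_sizes[-> [-> _]].
apply: (ptime_map (None, (None, 0 : int)) ([::] : seq int) (f := fun _ p q =>
  window (radius p) q) pzip) => sDB.
have pz := ptime_id iev_graph icp_graph sDB.
have po : pt (fun k (q : (input_t * seq rat) * (option int * (option int * int))) => solved k q.1 /\
    List.In q.2 (zip q.1.1.2.1 (zip q.1.1.2.2.1 [seq floorq r | r <- q.1.2]))) (fun _ q =>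
      offsets (radius q.1)).
  by apply: (ptime_comp ptime_offsets (ptime_fst pz)) => k [p i] [].
have psum : pt (fun k (q : (input_t * seq rat) * (option int * (option int * int))) =>
  solved k q.1 /\
    List.In q.2 (zip q.1.1.2.1 (zip q.1.1.2.2.1 [seq floorq r | r <- q.1.2])))
    (fun _ q => [seq q.2.2.2 + o | o <- offsets (radius q.1)]).
  apply: (ptime_map (0 : int) (0 : int) (f :=
    fun _ (q : (input_t * seq rat) * (option int * (option int * int))) o => q.2.2.2 + o) po) =>
    sDB'.
  have pz' := ptime_id iev_graph icp_graph sDB'.
  exact: ptime_add (ptime_snd (ptime_snd (ptime_snd (ptime_fst pz')))) (ptime_snd pz').
apply: (ptime_filter (0 : int) (p :=
  fun _ (q : (input_t * seq rat) * (option int * (option int * int))) z =>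
  lower_ok q.2.1 z && upper_ok q.2.2.1 z) psum) => sDB'.
have pz' := ptime_id iev_graph icp_graph sDB'.
have [pl _] := ptime_bound (ptime_fst (ptime_snd (ptime_fst pz'))) (ptime_snd pz').
have [_ pu] := ptime_bound (ptime_fst (ptime_snd (ptime_snd (ptime_fst pz')))) (ptime_snd pz').
by apply: ptime_and pl _; apply: ptime_weak pu _ => k q [].
Qed.

Lemma reshape_size (T : Type) m N h (x : 'cV[T]_(nfold_dim m N h)) :
  size (reshape (nseq N h) (drop m (entries x))) = N.
Proof. by rewrite reshape_entries size_map size_enum_ord. Qed.

Definition sradius k : nat := ((iN k).+2 ^ e)%N.
Definition window_vec k (r : 'cV[rat]_(nfold_dim nB (iN k) nA)) :=
  \col_i window (sradius k) (il k i 0, (iu k i 0, floorq (r i 0))).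

Lemma windowsE k p (r : 'cV[rat]_(nfold_dim nB (iN k) nA)) : p.1 = iinput k -> p.2 = entries r ->
  windows p = entries (window_vec r).
Proof.
move=> pE pr; rewrite /windows /radius pE pr /= /entries -map_comp !zip_map_same -!map_comp.
apply: eq_map => i /=; by rewrite mxE.
Qed.

Lemma layersE k p (r : 'cV[rat]_(nfold_dim nB (iN k) nA)) : p.1 = iinput k -> p.2 = entries r ->
  layers_of p = block_layers (ib k) (window_vec r).
Proof.
move=> pE pr; rewrite /layers_of (windowsE pE pr) pE /= take_entries !reshape_entries.
by rewrite zip_map_same -map_comp.
Qed.

Lemma startE k p : p.1 = iinput k -> start_of p = block_start (ib k).
Proof. by move=> pE; rewrite /start_of pE /= take_entries. Qed.

Lemma ptime_layers : pt solved (fun _ p => layers_of p).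
Proof.
apply: ptime_cons.
  apply: ptime_pair (ptime_cst _ _ true small_solved) _.
  apply: ptime_pair (ptime_cst _ _ [::] small_solved).
  exact: (ptime_enum_box nB (ptime_take ([::] : vect) nB ptime_windows)).
have pb := ptime_snd (ptime_snd (ptime_snd (ptime_fst ptime_p))).
have pN := ptime_fst (ptime_fst ptime_p).
apply: (ptime_map (([::] : seq (seq int)), ([::] : vect)) ((true, ([::], [::])) : blayer)
   (f := fun _ _ (q : seq (seq int) * vect) => (false, (enum_box nA q.1, q.2)))
   (ptime_zip ([::] : seq (seq int)) ([::] : vect) (ptime_reshape ([::] : vect) nA pN pbounded_iN
     (ptime_drop nB ptime_windows)) (ptime_reshape (0 : int) dA pN pbounded_iN (ptime_drop dC
     pb)) _)) => [k p [_ [pE [r [_ pr]]]]|sDB].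
  by rewrite (windowsE pE pr) pE /= !reshape_size.
have pz := ptime_id iev_graph icp_graph sDB.
apply: ptime_pair (ptime_cst _ _ false sDB) (ptime_pair _ (ptime_snd (ptime_snd pz))).
exact: (ptime_enum_box nA (ptime_fst (ptime_snd pz))).
Qed.

Lemma ptime_start : pt solved (fun _ p => start_of p).
Proof.
apply: ptime_pair (ptime_cst _ _ [::] small_solved) _.
exact: (ptime_take (0 : int) dC (ptime_snd (ptime_snd (ptime_snd (ptime_fst ptime_p))))).
Qed.

Lemma rv_close k (r : 'cV[rat]_(nfold_dim nB (iN k) nA)) i a b :
  a \in window_vec r i 0 -> b \in window_vec r i 0 -> (`|(a - b)%R| <= 2 * sradius k)%N.
Proof.
rewrite !mxE !mem_window => /and3P[_ _ ha] /and3P[_ _ hb]; lia.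
Qed.

Lemma layers_close k (r : 'cV[rat]_(nfold_dim nB (iN k) nA)) l :
  l \in block_layers (ib k) (window_vec r) -> tight (2 * sradius k) l.
Proof.
rewrite inE => /orP[/eqP->|/mapP[t _ ->]]; apply: enum_box_close => c; exact: rv_close.
Qed.

Lemma layers_label_size k (r : 'cV[rat]_(nfold_dim nB (iN k) nA)) l w :
  l \in block_layers (ib k) (window_vec r) -> w \in l.2.1 -> size w = if l.1 then nB else nA.
Proof.
by rewrite inE => /orP[/eqP->|/mapP[t _ ->]] /enum_box_enum[g -> _]; rewrite size_map size_enum_ord.
Qed.

Lemma walk_flatten_size (ls : seq blayer) t ws u :
  (forall l w, l \in ls -> w \in l.2.1 -> size w = if l.1 then nB else nA) ->
  walk bsucc ls t ws u -> size (flatten ws) = sumn [seq if l.1 then nB else nA | l : blayer <- ls].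
Proof.
elim: ls t ws => [|l ls IH] t [|w ws] H //= [v Sv Wv].
rewrite size_cat (IH _ _ _ Wv); last by move=> l' w' l'ls; apply: H; rewrite inE l'ls orbT.
by rewrite (H l w) ?mem_head //; apply: block_succ_label Sv.
Qed.

Lemma complete_feasible k (r : 'cV[rat]_(nfold_dim nB (iN k) nA)) ws :
  complete bsucc bfin (block_layers (ib k) (window_vec r)) (block_start (ib k)) ws ->
  exists z, [/\ ws = pieces z, @iIP k z & forall i, `|z i 0 - floorq (r i 0)| <= (sradius k)%:Z].
Proof.
move=> /complete_inv[z [wsE HL HU zr]]; exists z; split=> //.
  apply/feasible_blocks; split=> // i.
  by have := zr i; rewrite mxE mem_window => /and3P[-> ->].
by move=> i; have := zr i; rewrite mxE mem_window => /and3P[].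
Qed.

Lemma feasible_complete k (r : 'cV[rat]_(nfold_dim nB (iN k) nA)) 
    (z : 'cV[int]_(nfold_dim nB (iN k) nA)) :
  @iIP k z -> (forall i, `|z i 0 - floorq (r i 0)| <= (sradius k)%:Z) ->
  complete bsucc bfin (block_layers (ib k) (window_vec r)) (block_start (ib k)) (pieces z).
Proof.
move=> /feasible_blocks[HL HU bd] zr; apply: complete_pieces => // i.
by rewrite mxE mem_window zr andbT; apply: bd.
Qed.

Definition icost k := bcost ieval k.

Lemma icost_pieces k (z : 'cV[int]_(nfold_dim nB (iN k) nA)) : icost k (pieces z) = @iev k z.
Proof. by rewrite /icost /bcost flatten_pieces /ieval col_entries. Qed.

(** The cost is a sum over positions, and all prefixes that end at the same layer
have the same number of entries. *)
Lemma icost_exchange k p : solved k p -> forall ls1 ls2 t q q' s s',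
  layers_of p = ls1 ++ ls2 ->
  walk bsucc ls1 (start_of p) q t -> walk bsucc ls1 (start_of p) q' t ->
  complete bsucc bfin ls2 t s -> complete bsucc bfin ls2 t s' ->
  icost k (q ++ s) <= icost k (q ++ s') -> icost k (q' ++ s) <= icost k (q' ++ s').
Proof.
move=> [[cvx _ ev _] [pE [r [_ pr]]]] ls1 ls2 t q q' s s' lE Wq Wq' Cs Cs'.
have [G GE] := separable_list_cost cvx.
have costE a c : walk bsucc ls1 (start_of p) a t -> complete bsucc bfin ls2 t c ->
    (icost k (a ++ c))%:~R = list_cost G 0 (flatten a) + list_cost G (size (flatten a)) (flatten c).
  move=> Wa [u Wc fu]; rewrite -list_cost_cat -flatten_cat -GE.
    by rewrite -ev /icost /bcost /ieval.
  have : complete bsucc bfin (block_layers (ib k) (window_vec r)) (block_start (ib k)) (a ++ c).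
    by rewrite -(layersE pE pr) -(startE pE) lE; exists u => //; apply: walk_cat Wa Wc.
  by move=> /complete_feasible[z [-> _ _]]; rewrite flatten_pieces size_entries.
have szE a : walk bsucc ls1 (start_of p) a t -> size (flatten a) = sumn [seq if l.1 then nB else
  nA | l : blayer <- ls1].
  apply: walk_flatten_size => l w ll wl; apply: (@layers_label_size k r) wl.
  by rewrite -(layersE pE pr) lE mem_cat ll.
rewrite -(ler_int R) (costE _ _ Wq Cs) (costE _ _ Wq Cs') (szE _ Wq) lerD2l => le.
by rewrite -(ler_int R) (costE _ _ Wq' Cs) (costE _ _ Wq' Cs') (szE _ Wq') lerD2l.
Qed.

Definition solve k p : option (seq int) :=
  let G := dp bsucc bfin (icost k) (start_of p) (layers_of p) in
  if nilp G then None else Some (flatten (head entry0 G).2).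

Lemma enc_size_labels (l : blayer) : (enc_size l.2.1 <= enc_size l)%N.
Proof. by rewrite /enc_size /=; lia. Qed.

Lemma size_flatten_labels (ls : seq blayer) : (size (flatten [seq l.2.1 | l : blayer <- ls]) <=
  enc_size ls)%N.
Proof.
elim: ls => // l ls IH; rewrite /= size_cat enc_size_cons.
have h3 : (size l.2.1 <= enc_size l)%N := leq_trans (ltnW (size_enc_size _)) (enc_size_labels l).
by apply: leqW; apply: leq_add.
Qed.

(** In [forward_states_bound] the exponent is the number of linking rows, a constant;
the number of shared blocks and the size of the labels are at most the size of
[layers_of p]. *)
Lemma ptime_solve : pt solved solve.
Proof.
have [c lc] := ptime_out ptime_layers; have [d sd] := ptime_out ptime_start.
have pdp : pt solved (fun k p => dp bsucc bfin (icost k) (start_of p) (layers_of p)).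
  apply: (ptime_dp (ptime_ieval c) ptime_layers ptime_start).
  - pose E k := ((isize k).+2 ^ (c + d))%N.
    have pE : pbounded (fun k (q : (input_t * seq rat) * seq blayer) =>
      solved k q.1 /\ exists post, layers_of q.1 = q.2 ++ post)
      (fun k _ => E k) by exists (c + d)%N.
    have preE k q : (solved k q.1 /\ exists post,
      layers_of q.1 = q.2 ++ post) -> (enc_size q.2 <= E k)%N.
      move=> [Sk [post qE]]; apply: (@leq_trans (enc_size (layers_of q.1))).
        by rewrite qE -ltnS enc_size_cat -addn1 leq_add2l enc_size_gt0.
      by apply: leq_trans (lc k _ Sk) _; rewrite leq_pexp2l // leq_addr.
    have psz : pbounded (fun k (q : (input_t * seq rat) * seq blayer) =>
      solved k q.1 /\ exists post, layers_of q.1 = q.2 ++ post)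
      (fun k q => size q.2).
      apply: pbounded_le pE _ => k q /preE; apply: leq_trans; exact: ltnW (size_enc_size _).
    have pfl : pbounded (fun k (q : (input_t * seq rat) * seq blayer) =>
      solved k q.1 /\ exists post, layers_of q.1 = q.2 ++ post)
      (fun k q => size (flatten [seq l.2.1 | l : blayer <- q.2])).
      apply: pbounded_le pE _ => k q /preE; apply: leq_trans; exact: size_flatten_labels.
    have pK : pbounded (fun k (q : (input_t * seq rat) * seq blayer) =>
      solved k q.1 /\ exists post, layers_of q.1 = q.2 ++ post)
      (fun k q => sradius k).
      apply: pboundedX; do 2 apply: pboundedS; apply: pbounded_le (pbounded_sz _ _) _ => k q _.
      by rewrite /isize /input_size; lia.
    pose R' k (q : (input_t * seq rat) * seq blayer) :=
      (size q.2 * (coeff_sum (rows C) (rows D) * (2 * sradius k)))%N.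
    have pR : pbounded (fun k (q : (input_t * seq rat) * seq blayer) =>
      solved k q.1 /\ exists post, layers_of q.1 = q.2 ++ post) R'.
      by apply: pboundedM psz _; apply: pboundedM (pbounded_cst _ _ _) _;
        apply: pboundedM (pbounded_cst _ _ _) _.
    apply: pbounded_le (_ : pbounded _ (fun k q =>
      ((size (flatten [seq l.2.1 | l : blayer <- q.2])).+1 * (2 * R' k q).+1 ^ size (rows C) *
     ((E k).+1 + (size (rows C) * (state_bits (rows C) (rows D) (size q.2) (E
       k)).+1).+2).+3).+1)%N) _.
      apply: pboundedS; apply: pboundedM; first apply: pboundedM.
      + exact: pboundedS.
      + by apply: pboundedX; apply: pboundedS; apply: pboundedM (pbounded_cst _ _ _) _.
      + do 3 apply: pboundedS; apply: pboundedD; first exact: pboundedS.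
        do 2 apply: pboundedS; apply: pboundedM (pbounded_cst _ _ _) _; apply: pboundedS.
        rewrite /state_bits; do 4 apply: pboundedS; apply: pboundedD (pE); apply: pboundedD (pE).
        exact: pboundedD psz (pbounded_cst _ _ _).
    move=> k [p pre] Hq; have [Sk [post /= qE]] := Hq; have [_ [pE' [r [_ pr]]]] := Sk.
    have [Fok _] := forwardP bsucc (start_of p) pre.
    have sC : size (rows C) = size (rows D) by rewrite !size_map.
    have inl l : l \in pre -> l \in block_layers (ib k) (window_vec r).
      by move=> lp; rewrite -(layersE pE' pr) qE mem_cat lp.
    apply: (forward_states_bound (K := 2 * sradius k) sC Fok) => //.
    + by move=> l /inl/layers_close.
    + by rewrite pE' /= take_entries [RHS]size_map [LHS]size_map.
    + move=> l w lp wl; apply: leq_trans (preE k _ Hq) => /=.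
      have h1 : (enc_size w < enc_size l.2.1)%N by apply: enc_size_mem; apply/In_mem.
      have h2 : (enc_size l < enc_size pre)%N by apply: enc_size_mem; apply/In_mem.
      exact: leq_trans (ltnW h1) (leq_trans (enc_size_labels l) (ltnW h2)).
    + apply: (@leq_trans (enc_size (start_of p))).
        by rewrite /start_of enc_size_pair; lia.
      by apply: leq_trans (sd k _ Sk) _; rewrite leq_pexp2l // leq_addl.
  - by move=> k p ls1 ls2 t q q' s s' Sk; apply: icost_exchange.
  - move=> k p s Sk Cs; have [vk [pE [r [_ pr]]]] := Sk; split=> //.
      have [u Ws _] := Cs; apply: leq_trans (lc k p Sk).
      by apply: leq_trans (enc_size_flatten _) (walk_enc_size Ws).
    rewrite (layersE pE pr) (startE pE) in Cs.
    by have [z [-> Iz _]] := complete_feasible Cs; exists z => //; rewrite flatten_pieces.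
apply: ptime_if; first exact: ptime_nilp.
  by move=> sD; apply: ptime_cst; apply: pbounded_sub sD _ => k x [].
move=> sD.
have pf : pt solved (fun k p => flatten (head entry0 (dp bsucc bfin (icost k) (start_of p)
  (layers_of p))).2).
  exact: (ptime_flatten (0 : int) (ptime_snd (ptime_head entry0 pdp))).
have ps : pt solved (fun k p => Some (flatten (head entry0 (dp bsucc bfin (icost k) (start_of p)
  (layers_of p))).2)).
  by apply: (ptime_cast (ptime_pair (ptime_cst _ _ (0 : int) small_solved) pf)).
by apply: ptime_weak ps _ => k p [].
Qed.

(** Precision 1 is enough, since proximity loses more than that anyway. A leaf
encodes one of the replies without a point; either implies that there is no
integer feasible point. *)
Definition imain k (x : input_t) : option (seq int) :=
  if is_leaf (ireply k) then None else solve k (x, irelaxed k).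

Definition at_input k (x : input_t) : Prop := valid k /\ x = iinput k.

Lemma ptime_reply : pt at_input (fun k _ => ireply k).
Proof.
have pq : pt (fun k (q : rat) => valid k /\ q = 1) (fun k _ => ireply k).
  exists PCont, (fun k q => (val_size (enc_rat 1) + isize k).+1); split.
    by apply: pboundedS; apply: pboundedD (pbounded_cst _ _ _) (pbounded_sz _ _).
  move=> k q [_ ->]; eexists; first by apply: run_cont; exists 1.
  by rewrite ltnS leq_add // /isize leq_addl.
by apply: (ptime_comp pq (ptime_cst _ _ (1 : rat) small_input)) => k x [].
Qed.

Lemma ptime_main : pt at_input imain.
Proof.
apply: ptime_if; first exact: ptime_isleaf ptime_reply.
  by move=> sD; apply: ptime_cst; apply: pbounded_sub sD _ => k x [].
move=> sD; pose D' k x := at_input k x /\ ~~ is_leaf (ireply k).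
have px : pt D' (fun _ x => x) by apply: ptime_weak (ptime_id _ _ sD) _ => k x [].
have pr : pt D' (fun k _ => ((0 : int), irelaxed k)).
  apply: (ptime_cast (ptime_weak ptime_reply _)) => [k x []//|k x [_]].
  rewrite /ireply /irelaxed; case: (icp k 1) => // r _ /=.
  by rewrite (enc_col_entries (T := rat_encType)).
apply: (ptime_comp ptime_solve (ptime_pair px (ptime_snd pr))) => k x [[vk ->]].
rewrite /ireply /solved /irelaxed => leaf; split=> //; split=> //=.
by case: (icp k 1) leaf => // r _; exists r.
Qed.

End Main.

(** * Correctness *)

Lemma floorq_itv (q : rat) : (floorq q)%:~R <= q < (floorq q)%:~R + 1.
Proof.
have d0 : 0 < (denq q)%:~R :> rat by rewrite ltr0z denq_gt0.
have dn : denq q != 0 by rewrite denq_neq0.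
have nE : numq q = floorq q * denq q + (numq q %% denq q)%Z by rewrite -divz_eq.
have m0 : 0 <= (numq q %% denq q)%Z by rewrite modz_ge0.
have m1 : (numq q %% denq q)%Z < denq q by apply: ltz_pmod; rewrite denq_gt0.
rewrite -{2 3}(divq_num_den q) ler_pdivlMr // ltr_pdivrMr //.
rewrite -[1]/(1%:~R) -rmorphD -!rmorphM /= ler_int ltr_int.
by apply/andP; split; nia.
Qed.

Lemma horner_poly_nat (c x : nat) : (('X + 2%:P) ^+ c : {poly nat}).[x] = (x.+2 ^ c)%N.
Proof.
have E (y : nat) : y ^+ c = (y ^ c)%N by elim: c => // n IH; rewrite exprS expnS IH.
by rewrite horner_exp hornerD hornerX hornerC E -[(x + 2)%R]/(x + 2)%N addn2.
Qed.

Section Correctness.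
Variables (R : realType) (dA dC nA nB : nat).
Variables (A : 'M[int]_(dA, nA)) (B : 'M[int]_(dA, nB)).
Variables (C : 'M[int]_(dC, nB)) (D : 'M[int]_(dC, nA)).

Lemma relax_feasible m n (M : 'M[int]_(m, n)) b l u (z : 'cV[int]_n) :
  feasible M b l u z -> feasible M b l u (map_mx intr z : 'cV[R]_n).
Proof.
move=> [Mz bz]; split; first by rewrite -mulmx_intr Mz map_intr_id.
move=> i; have [lz uz] := bz i; rewrite !mxE.
split; first by case: (l i 0) lz => [a|] //=; rewrite intz ler_int.
by case: (u i 0) uz => [a|] //=; rewrite intz ler_int.
Qed.

Lemma entry_le_norm n (x : 'cV[R]_n) (c : R) i : `|x| <= c -> `|x i 0| <= c.
Proof.
by apply: le_trans; rewrite [leRHS]/Num.norm /= /mx_norm;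
  exact: (le_bigmax _ (fun i => `|x i.1 i.2|%:nng) (i, 0)).
Qed.

Local Notation inst := (instance R dA dC nA nB).

Definition answer_of (k : inst) (o : option (seq int)) : answer int (nfold_dim nB (iN k) nA) :=
  if o is Some s then Solution (\col_i nth 0 s i) else Infeasible.

(** The exponent grows by 2 because the oracle answers up to 1 and rounding down
costs another 1. An optimum of the window is then a global one, and if the
window contains no feasible point there is none at all. *)
Lemma imain_correct e0 : optima_within R A B C D e0 ->
  forall k : inst, valid A B C D k ->
  let o := imain A B C D e0.+2 k (iinput k) in
  enc o = enc_answer VInt (answer_of k o) /\
  correct_answer (@iobj _ _ _ _ _ k) (@iIP _ _ _ _ _ A B C D k) (answer_of k o).
Proof.
move=> prox k vk o; have [cvx hat ev cpk] := vk; have := cpk 1 ltr01.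
rewrite /o /imain /ireply /irelaxed.
case cpE : (icp k 1) => [r| |] /=; last first.
- move=> unb; split=> // z Iz; exact: (relaxation_bounded cvx Iz hat unb).
- by move=> inf; split=> // z /relax_feasible; apply: inf.
move=> [Cr [rhat rmin near]].
have Sk : solved A B C D k (iinput k, entries r) by split=> //; split=> //; exists r.
have lE := @layersE _ _ _ _ _ e0.+2 k (iinput k, entries r) r erefl erefl.
have sE := @startE _ _ _ _ _ k (iinput k, entries r) erefl.
have [opt ne] := dpP (icost_exchange (e := e0.+2) Sk).
have close_box (z : 'cV[int]_(nfold_dim nB (iN k) nA)) : @iIP R _ _ _ _ A B C D k z ->
  exists z' : 'cV[int]_(nfold_dim nB (iN k) nA), [/\ @iIP R _ _ _ _ A B C D k z',
  @iobj _ _ _ _ _ k (map_mx intr z') <= @iobj _ _ _ _ _ k (map_mx intr z)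
    & complete (block_succ (rows A) (rows B) (rows C) (rows D) (nseq dA 0))
       (block_final (nseq dC 0)) (layers_of dA dC nA nB e0.+2 (iinput k, entries r))
       (start_of dC (iinput k, entries r)) (pieces z')].
  move=> Iz; have [z' [Iz' le zr]] := prox _ _ _ _ _ z rhat cvx Iz rmin.
  exists z'; split=> //; rewrite lE sE; apply: feasible_complete => // i.
  rewrite -(ler_int R) intr_norm rmorphB /=.
  have := zr i; have := entry_le_norm i near; rewrite !mxE rmorph1.
  have /andP[] := floorq_itv (r i 0); rewrite -(ler_rat R) -(ltr_rat R) rmorphD rmorph1 /= ratr_int.
  rewrite /sradius; have : ((iN k).+2 ^ e0)%N%:R + 2 <= ((iN k).+2 ^ e0.+2)%N%:R :> R.
    rewrite -natrD ler_nat !expnS; have : (0 < (iN k).+2 ^ e0)%N by rewrite expn_gt0.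
    by nia.
  rewrite !ler_norml => h0 h1 h2 /andP[h3 h4] /andP[h5 h6]; apply/andP.
  by rewrite -[_%:~R]/(((iN k).+2 ^ e0.+2)%N%:R); split; lra.
rewrite /solve; case: nilP => [nil|/eqP nnil].
  split=> //= z Iz; have [z' [_ _ Cz]] := close_box z Iz.
  by have := ne (ex_intro _ _ Cz); rewrite nil.
case GE : (dp _ _ _ _ _) nnil => [//|[t s] G'] _ /=.
have [|Cs smin] := opt t s; first by rewrite GE mem_head.
have [z [zE Iz _]] := complete_feasible (eq_ind _ (fun x =>
  complete _ _ x _ _) (eq_ind _ (fun x => complete _ _ _ x _) Cs _ sE) _ lE).
rewrite zE flatten_pieces col_entries; split.
  by congr VPair; exact: (esym (enc_col_entries (T := int_encType) z)).
split=> // y Iy; have [z' [Iz' le Cz']] := close_box y Iy; apply: le_trans le.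
by have := smin _ Cz'; rewrite zE !icost_pieces -(ler_int R) !ev.
Qed.
End Correctness.

Theorem theorem2p3 (R : realType) (dA dC nA nB : nat)
    (A : 'M[int]_(dA, nA)) (B : 'M[int]_(dA, nB))
    (C : 'M[int]_(dC, nB)) (D : 'M[int]_(dC, nA)) :
  exists (P : prog) (p q : {poly nat}),
  forall (N : nat) (l u : 'cV[option int]_(nfold_dim nB N nA))
    (b : 'cV[int]_(nfold_dim dC N dA))
    (f : 'cV[R]_(nfold_dim nB N nA) -> R) (fhat : int)
    (ev : 'cV[int]_(nfold_dim nB N nA) -> int)
    (cp : rat -> answer rat (nfold_dim nB N nA)),
  let IP := @feasible int _ _ (nfold4 A B C D N) b l u in
  let CP := @feasible R _ _ (nfold4 A B C D N) b l u in
  separable_convex f ->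
  (forall z : 'cV[int]_(nfold_dim nB N nA), f (map_mx intr z) \is a Num.int) ->
  (forall z, IP z -> `|f (map_mx intr z)| <= fhat%:~R) ->
  evaluation_oracle f ev ->
  approx_cont_oracle f CP cp ->
  exists (a : answer int (nfold_dim nB N nA)) (t : nat),
    [/\ run (eval_graph ev) (cont_graph cp) P (enc_instance N l u b)
          (enc_answer VInt a) t,
        correct_answer f IP a
      & oracle_poly_bound p q cp (input_size N l u b fhat) t].
Proof.
have [e0 prox] := proximity R A B C D.
have [P [tau [[c tauc] HP]]] := ptime_main R A B C D e0.+2.
exists P, (('X + 2%:P) ^+ c), ((val_size (enc_rat 1))%:P) =>
  N l u b f fhat ev cp IP CP cvx _ hat evo cpo.
pose k : instance R dA dC nA nB := Instance l u b f fhat ev cp.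
have vk : valid A B C D k by [].
have [t rt tle] := HP k (iinput k) (conj vk erefl).
have [encE cor] := imain_correct prox vk.
exists (answer_of k (imain A B C D e0.+2 k (iinput k))), t; split=> //.
  move: rt; rewrite encE; congr run.
  rewrite /enc_instance (enc_col_entries (T := int_encType)).
  by rewrite (enc_col_entries (T := option_encType int_encType) l) (enc_col_entries (T :=
    option_encType int_encType) u).
move=> L HL; rewrite horner_poly_nat; apply: leq_trans tle _.
apply: leq_trans (tauc k (iinput k) (conj vk erefl)) _; apply: leq_exp2r_weak.
rewrite !ltnS /isize leq_add2l; apply: HL => //.
by rewrite hornerC.
Qed.
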